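(* Assume the structural hypotheses of the context. 1. For pure Dirichlet conditions ($N''=\mathrm{rank}\,\Upsilon_3=0$), sufficiently small-amplitude layers are transversal, and likewise for mixed Dirichlet–Neumann conditions in the extreme case $\mathrm{rank}\,\Upsilon_3=N^2_-=N'$. 2. When the number of Neumann boundary conditions $\mathrm{rank}\,\Upsilon_3=N''$ exceeds $N^2_-$, constant layers are non-transversal. Equivalently, a necessary condition for transversality of constant layers is that the number $(N'-N'')+N^1_+$ of scalar Dirichlet conditions for the parabolic problem is greater than or equal to the number $N_+$ of Dirichlet conditions for the residual hyperbolic problem.
   Context: **System.** Let $1\le N'\le N$, $d\ge1$, $T>0$, and let $\Omega\subset\mathbb{R}^d$ be a bounded open set with smooth boundary; $\nu=\nu(x_0)$ is the inward unit normal at $x_0\in\partial\Omega$. Write $u=(u^1,u^2)\in\mathbb{R}^{N-N'}\times\mathbb{R}^{N'}$ and $M^{\alpha\beta}$ for the corresponding blocks of a matrix $M$. The system is $A_0(u)\partial_tu+\sum_jA_j(u)\partial_ju-\varepsilon\sum_{j,k}\partial_j(B_{jk}(u)\partial_ku)=0$, where $A_0^{12}=0$ and $B_{jk}^{22}$ is the only possibly nonzero block of $B_{jk}$. Set $\overline A_j=A_0^{-1}A_j$, $\overline B_{jk}=A_0^{-1}B_{jk}$, $\overline A(u,\xi)=\sum\xi_j\overline A_j(u)$, $\overline B(u,\xi)=\sum\xi_j\xi_k\overline B_{jk}(u)$, $A_\nu=\sum\nu_jA_j$, $\overline A_\nu=\overline A(\cdot,\nu)$, $B_\nu=\sum\nu_j\nu_kB_{jk}$.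 Boundary operator: $\Upsilon=(\Upsilon_1(u^1),\Upsilon_2(u^2),\Upsilon_3)$, $\Upsilon_3=K_\nu\partial_\nu u^2+\sum_jK_j(u)V_ju^2$, $V_j$ smooth vector fields tangent to $\partial\Omega$, $K_\nu$ constant. **State sets.** $\mathcal{O}(t,x)$ ($t\in[-T,T]$, $x\in\overline\Omega$) and $\mathcal{O}^*(t,x_0)\supset\mathcal{O}(t,x_0)$ ($x_0\in\partial\Omega$) are open subsets of $\mathbb{R}^N$ depending continuously on their arguments; $\mathcal{U}=\{(t,x,u):u\in\mathcal{O}(t,x)\}$, $\mathcal{U}_\partial=\{(t,x_0,u):x_0\in\partial\Omega,u\in\mathcal{O}(t,x_0)\}$, $\mathcal{U}^*=\{(t,x_0,u):u\in\mathcal{O}^*(t,x_0)\}$; $\pi\mathcal{U},\pi\mathcal{U}_\partial,\pi\mathcal{U}^*$ are the corresponding sets of $u$. When $u\in\pi\mathcal{U}_\partial$ or $\pi\mathcal{U}^*$ and $\nu$ occur together, $\nu=\nu(x_0)$ with $(t,x_0,u)$ in the corresponding set. $\mathcal{U}_{\partial,\nu}=\{(u,\nu(x_0)):(t,x_0,u)\in\mathcal{U}_\partial\}$. **Structural hypotheses.** (1) $A_j,B_{jk}$ are real $C^\infty$ functions on $\pi\mathcal{U}\cup\pi\mathcal{U}^*$, $\det A_0\ne0$. (2) There is $c>0$ with $\mathrm{Re}\,\mu\ge c|\xi|^2$ for all eigenvalues $\mu$ of $\overline B^{22}(u,\xi)$, $u\in\pi\mathcal{U}\cup\pi\mathcal{U}^*$,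 $\xi\in\mathbb{R}^d$. (3) For $u\in\pi\mathcal{U}\cup\pi\mathcal{U}^*$, $\xi\ne0$, the eigenvalues of $\overline A^{11}(u,\xi)$ are real, semisimple, of constant multiplicity; for $u\in\pi\mathcal{U}^*$ the eigenvalues of $\overline A^{11}(u,\nu)$ are nonzero and either all positive or all negative. (4) For $u\in\pi\mathcal{U}$, $\xi\ne0$, the eigenvalues of $\overline A(u,\xi)$ are real, semisimple, of constant multiplicity; for $u\in\pi\mathcal{U}_\partial$, $\det\overline A(u,\nu)\ne0$ and the number of positive (negative) eigenvalues of $\overline A(u,\nu)$ is independent of $u$. (5) There is $c>0$ such that for $u\in\pi\mathcal{U}$, $\xi\in\mathbb{R}^d$ the eigenvalues $\mu$ of $i\overline A(u,\xi)+\overline B(u,\xi)$ satisfy $\mathrm{Re}\,\mu\ge c|\xi|^2/(1+|\xi|^2)$. (6) $\Upsilon_1,\Upsilon_2,\Upsilon_3$ are smooth with values in $\mathbb{R}^{N^1_+},\mathbb{R}^{N'-N''},\mathbb{R}^{N''}$, $0\le N''\le N'$; $K_\nu$ has rank $N''=:\mathrm{rank}\,\Upsilon_3$, and for $u\in\pi\mathcal{U}^*$, $\Upsilon_1'(u^1)$ and $\Upsilon_2'(u^2)$ have maximal ranks $N^1_+$ and $N'-N''$. **Numbers.** $N_+$ (resp. $N^1_+$) is the number of positive eigenvalues of $\overline A_\nu(u)$, $u\in\pi\mathcal{U}_\partial$ (resp. $\overline A^{11}_\nu(u)$, $u\in\pi\mathcal{U}^*$); $N_b=N'+N^1_+$.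 $N^2_-$ is the number of eigenvalues with negative real part of $G_\nu(u)=(B^{22}_\nu)^{-1}(A^{22}_\nu-A^{21}_\nu(A^{11}_\nu)^{-1}A^{12}_\nu)(u)$, $u\in\pi\mathcal{U}_\partial$; one has $N_++N^2_-=N_b$. **Layers and transversality.** A layer is a solution $w(z)$ of $A_\nu(w)\partial_zw-\partial_z(B_\nu(w)\partial_zw)=0$ on $z\ge0$ with a limit as $z\to\infty$; a constant layer is $w\equiv u$, $(u,\nu)\in\mathcal{U}_{\partial,\nu}$. Let $\mathcal{S}$ be the space of solutions $\dot w$ of the ODE linearized at $w$ that have finite limits at $+\infty$, $\mathcal{S}_0$ those tending to $0$, and $\Gamma_\nu\dot w=(\Upsilon_1'(w^1(0))\dot w^1,\Upsilon_2'(w^2(0))\dot w^2,K_\nu\partial_z\dot w^2)|_{z=0}$. $w$ is transversal if no nonzero $\dot w\in\mathcal{S}_0$ has $\Gamma_\nu\dot w=0$ and $\Gamma_\nu:\mathcal{S}\to\mathbb{C}^{N_b}$ has rank $N_b$. ''Sufficiently small-amplitude layers are transversal'' means: for every compact $D\subset\mathcal{U}_{\partial,\nu}$ there is $\varepsilon>0$ such that every layer $w$ with normal $\nu$ for which $\|(w,\partial_zw^2)-(\underline u,0)\|_{L^\infty(0,\infty)}\le\varepsilon$, $|\nu-\underline\nu|\le\varepsilon$ for some $(\underline u,\underline\nu)\in D$ is transversal. *)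

(* Defs.v *)
From HB Require Import structures.
From mathcomp Require Import all_boot all_order all_algebra.
From mathcomp Require Import complex.
From mathcomp Require Import all_classical all_reals all_analysis.

Set Implicit Arguments.
Unset Strict Implicit.
Unset Printing Implicit Defensive.

Import Order.TTheory GRing.Theory Num.Theory.
Import numFieldNormedType.Exports.

Local Open Scope classical_set_scope.
Local Open Scope ring_scope.

(* Vectors are columns and the splitting u = (u^1, u^2) is
   (usubmx u, dsubmx u) for u : 'cV_(n1 + n2), with n1 = N - N', n2 = N'. *)

Section Calculus.
Variable R : realType.

Definition enorm n (v : 'cV[R]_n) : R := Num.sqrt (\sum_i v i 0 ^+ 2).

(* C^k on an open set U; the matrix norm of the library gives the topology. *)
Fixpoint Ck_on (V W : normedModType R) (k : nat) (U : set V) (f : V -> W)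
    : Prop :=
  if k is k'.+1 then
    (forall x, U x -> differentiable f x) /\
    (forall v, Ck_on k' U (fun x => 'D_v f x))
  else forall x, U x -> {for x, continuous f}.

Definition smooth_on (V W : normedModType R) (U : set V) (f : V -> W) : Prop :=
  forall k, Ck_on k U f.

Definition jacobian_mx m n (f : 'cV[R]_n -> 'cV[R]_m) (u : 'cV[R]_n) :
  'M[R]_(m, n) := \matrix_(i, j) ('D_(delta_mx j 0) f u) i 0.

Definition gradient n (phi : 'cV[R]_n -> R) (x : 'cV[R]_n) : 'cV[R]_n :=
  \col_j 'D_(delta_mx j 0) phi x.

Definition bdry (X : topologicalType) (A : set X) : set X :=
  closure A `\` interior A.

(* phi is a smooth defining function of Om in the neighbourhood W of x0. *)
Definition local_defining d (Om : set 'cV[R]_d) (x0 : 'cV[R]_d)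
    (W : set 'cV[R]_d) (phi : 'cV[R]_d -> R) : Prop :=
  [/\ open W, W x0, smooth_on W phi, gradient phi x0 != 0 &
      Om `&` W = [set x | 0 < phi x] `&` W].

Definition smooth_boundary d (Om : set 'cV[R]_d) : Prop :=
  forall x0, bdry Om x0 -> exists W phi, local_defining Om x0 W phi.

Definition inward_unit_normal d (Om : set 'cV[R]_d) (x0 n : 'cV[R]_d) : Prop :=
  exists W phi, local_defining Om x0 W phi /\
    n = (enorm (gradient phi x0))^-1 *: gradient phi x0.

(* Continuity of a family of open sets: points of F p stay in F q, and points
   of the exterior of F p stay outside F q, for q in D close to p, locally
   uniformly (inner and outer semicontinuity). *)
Definition continuous_open_family (X Y : topologicalType) (D : set X)
    (F : X -> set Y) : Prop :=
  [/\ forall p, D p -> open (F p),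
      forall p u, D p -> F p u ->
        \forall q \near within D (nbhs p) & u' \near u, F q u' &
      forall p u, D p -> ~ closure (F p) u ->
        \forall q \near within D (nbhs p) & u' \near u, ~ F q u'].

(* Derivative relative to the closed half-line [0, +oo[: one-sided at 0, and
   independent of the values of f on ]-oo, 0[. *)
Definition hl_quotient (W : normedModType R) (f : R -> W) (z h : R) : W :=
  h^-1 *: (f (z + h) - f z).

Definition hl_derivable (W : normedModType R) (f : R -> W) : Prop :=
  forall z, 0 <= z ->
    cvg (hl_quotient f z h @[h --> within [set h | 0 <= z + h] 0^']).

Definition hl_deriv (W : normedModType R) (f : R -> W) (z : R) : W :=
  lim (hl_quotient f z h @[h --> within [set h | 0 <= z + h] 0^']).

Definition Linf_norm n (f : R -> 'cV[R]_n) : \bar R :=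
  Lnorm (mrestr (@lebesgue_measure R)
           (measurable_itv `]0, +oo[ : measurable (`]0, +oo[%classic : set R)))
    +oo%E (fun z => (enorm (f z))%:E).

End Calculus.

Section Spectra.
Variable R : realType.

Definition cmx m n (M : 'M[R]_(m, n)) : 'M[R[i]]_(m, n) :=
  map_mx (real_complex R) M.

(* Eigenvalues with algebraic multiplicity. *)
Definition eigvals n (M : 'M[R[i]]_n) : seq R[i] :=
  sval (closed_field_poly_normal (char_poly M)).

Definition num_eig n (P : pred R[i]) (M : 'M[R[i]]_n) : nat :=
  count P (eigvals M).

(* In R[i], 0 < z means that z is real and positive. *)
Definition num_pos n (M : 'M[R]_n) := num_eig [pred z : R[i] | 0 < z] (cmx M).
Definition num_neg n (M : 'M[R]_n) := num_eig [pred z : R[i] | z < 0] (cmx M).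
Definition num_Re_neg n (M : 'M[R]_n) :=
  num_eig [pred z : R[i] | complex.Re z < 0] (cmx M).

Definition real_spectrum n (M : 'M[R]_n) : Prop :=
  forall mu : R[i], eigenvalue (cmx M) mu -> complex.Im mu = 0.

Definition semisimple_spectrum n (M : 'M[R]_n) : Prop :=
  forall mu : R[i], eigenvalue (cmx M) mu ->
    \rank (eigenspace (cmx M) mu) = mup mu (char_poly (cmx M)).

(* M has exactly the real eigenvalues lam_0 < lam_1 < ..., lam_k being of
   algebraic multiplicity ms_k. *)
Definition has_multiplicities n (ms : seq nat) (M : 'M[R]_n) : Prop :=
  exists lam : seq R,
    [/\ size lam = size ms, sorted <%R lam, all (leq 1) ms &
        char_poly M = \prod_(k < size ms)
          ('X - (nth 0 lam k)%:P) ^+ nth 0%N ms k].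

(* The multiplicities of the ordered eigenvalues do not vary along the family;
   this is required locally, since the ordering (hence the list ms) may differ
   between connected components of D, e.g. between xi and -xi when d = 1. *)
Definition constant_multiplicity (X : topologicalType) n (D : set X)
    (M : X -> 'M[R]_n) : Prop :=
  forall p, D p -> exists ms : seq nat,
    \forall q \near within D (nbhs p), has_multiplicities ms (M q).

(* The linear map G, restricted to the set S of vectors, has rank k. *)
Definition has_rank (X : Type) m (S : set X) (G : X -> 'cV[R[i]]_m) (k : nat)
    : Prop :=
  (exists e : 'I_k -> X, (forall j, S (e j)) /\
      \rank (\matrix_(i < m, j < k) G (e j) i 0) = k) /\
  (forall l (e : 'I_l -> X), (forall j, S (e j)) ->
      (\rank (\matrix_(i < m, j < l) G (e j) i 0)%R <= k)%N).

End Spectra.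

(* n1 = N - N', n2 = N', n3 = N'', N1p = N^1_+; r is the number of tangential
   terms in Upsilon_3 = K_nu d_nu u^2 + sum_j K_j(u) V_j u^2, whose data are
   Knu, Ktan and Vtan (so that smoothness of Upsilon_3 is smoothness of the
   Ktan j, and rank Upsilon_3 = rank Knu).  Functions of u are total, but only
   constrained on the relevant sets of states. *)
Record bvp (R : realType) (d n1 n2 n3 N1p r : nat) := Bvp {
  horizon : R;
  Omega : set 'cV[R]_d;
  inner_normal : 'cV[R]_d -> 'cV[R]_d;
  Ost : R * 'cV[R]_d -> set 'cV[R]_(n1 + n2);
  Ostar : R * 'cV[R]_d -> set 'cV[R]_(n1 + n2);
  coefA0 : 'cV[R]_(n1 + n2) -> 'M[R]_(n1 + n2);
  coefA : 'I_d -> 'cV[R]_(n1 + n2) -> 'M[R]_(n1 + n2);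
  coefB : 'I_d -> 'I_d -> 'cV[R]_(n1 + n2) -> 'M[R]_(n1 + n2);
  Ups1 : 'cV[R]_n1 -> 'cV[R]_N1p;
  Ups2 : 'cV[R]_n2 -> 'cV[R]_(n2 - n3);
  Knu : 'M[R]_(n3, n2);
  Ktan : 'I_r -> 'cV[R]_(n1 + n2) -> 'M[R]_(n3, n2);
  Vtan : 'I_r -> 'cV[R]_d -> 'cV[R]_d
}.

Section Problem.
Variables (R : realType) (d n1 n2 n3 N1p r : nat).
Variable P : bvp R d n1 n2 n3 N1p r.

Local Notation N := (n1 + n2)%N.
Local Notation state := 'cV[R]_N.

Definition time_int : set R := [set t | - horizon P <= t <= horizon P].

Definition piU : set state :=
  [set u | exists t x, [/\ time_int t, closure (Omega P) x & Ost P (t, x) u]].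

(* Pairs (u, nu(x0)) with (t, x0, u) in U_bd, resp. in U^*. *)
Definition Ubd_nu : set (state * 'cV[R]_d) :=
  [set p | exists t x0, [/\ time_int t, bdry (Omega P) x0, Ost P (t, x0) p.1 &
                            p.2 = inner_normal P x0]].
Definition Ustar_nu : set (state * 'cV[R]_d) :=
  [set p | exists t x0, [/\ time_int t, bdry (Omega P) x0, Ostar P (t, x0) p.1 &
                            p.2 = inner_normal P x0]].

Definition piUstar : set state :=
  [set u | exists t x0, [/\ time_int t, bdry (Omega P) x0 & Ostar P (t, x0) u]].

Definition states : set state := piU `|` piUstar.

Definition Asym (xi : 'cV[R]_d) (u : state) : 'M[R]_N :=
  \sum_j xi j 0 *: coefA P j u.
Definition Bsym (xi : 'cV[R]_d) (u : state) : 'M[R]_N :=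
  \sum_j \sum_k (xi j 0 * xi k 0) *: coefB P j k u.
Definition Abar (u : state) (xi : 'cV[R]_d) : 'M[R]_N :=
  \sum_j xi j 0 *: (invmx (coefA0 P u) *m coefA P j u).
Definition Bbar (u : state) (xi : 'cV[R]_d) : 'M[R]_N :=
  \sum_j \sum_k (xi j 0 * xi k 0) *: (invmx (coefA0 P u) *m coefB P j k u).
Definition Abar11 (u : state) (xi : 'cV[R]_d) : 'M[R]_n1 := ulsubmx (Abar u xi).
Definition Bbar22 (u : state) (xi : 'cV[R]_d) : 'M[R]_n2 := drsubmx (Bbar u xi).

Definition Gnu (nu : 'cV[R]_d) (u : state) : 'M[R]_n2 :=
  invmx (drsubmx (Bsym nu u)) *m
  (drsubmx (Asym nu u) -
   dlsubmx (Asym nu u) *m invmx (ulsubmx (Asym nu u)) *m ursubmx (Asym nu u)).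

Record setting : Prop := {
  horizon_gt0 : 0 < horizon P;
  Om_open : open (Omega P);
  Om_bounded : bounded_set (Omega P);
  Om_smooth : smooth_boundary (Omega P);
  normalE : forall x0, bdry (Omega P) x0 ->
    inward_unit_normal (Omega P) x0 (inner_normal P x0);
  Ost_continuous : continuous_open_family
    [set p : R * 'cV[R]_d | time_int p.1 /\ closure (Omega P) p.2] (Ost P);
  Ostar_continuous : continuous_open_family
    [set p : R * 'cV[R]_d | time_int p.1 /\ bdry (Omega P) p.2] (Ostar P);
  Ost_sub_Ostar : forall t x0, time_int t -> bdry (Omega P) x0 ->
    Ost P (t, x0) `<=` Ostar P (t, x0);
  A0_block : forall u, states u -> ursubmx (coefA0 P u) = 0;
  B_block : forall j k u, states u ->
    coefB P j k u = block_mx 0 0 0 (drsubmx (coefB P j k u))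
}.

Record structural_hypotheses : Prop := {
  A0_smooth : smooth_on states (coefA0 P);
  A_smooth : forall j, smooth_on states (coefA P j);
  B_smooth : forall j k, smooth_on states (coefB P j k);
  A0_det : forall u, states u -> \det (coefA0 P u) != 0;
  B22_parabolic : exists2 c : R, 0 < c & forall u xi (mu : R[i]),
    states u -> eigenvalue (cmx (Bbar22 u xi)) mu ->
    c * enorm xi ^+ 2 <= complex.Re mu;
  A11_real : forall u xi, states u -> xi != 0 -> real_spectrum (Abar11 u xi);
  A11_semisimple : forall u xi, states u -> xi != 0 ->
    semisimple_spectrum (Abar11 u xi);
  A11_mult : constant_multiplicity
    [set p : state * 'cV[R]_d | states p.1 /\ p.2 != 0]
    (fun p => Abar11 p.1 p.2);
  A11_sign : forall u nu, Ustar_nu (u, nu) ->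
    (forall mu : R[i], eigenvalue (cmx (Abar11 u nu)) mu -> 0 < mu) \/
    (forall mu : R[i], eigenvalue (cmx (Abar11 u nu)) mu -> mu < 0);
  A_real : forall u xi, piU u -> xi != 0 -> real_spectrum (Abar u xi);
  A_semisimple : forall u xi, piU u -> xi != 0 ->
    semisimple_spectrum (Abar u xi);
  A_mult : constant_multiplicity
    [set p : state * 'cV[R]_d | piU p.1 /\ p.2 != 0]
    (fun p => Abar p.1 p.2);
  A_noncharacteristic : forall u nu, Ubd_nu (u, nu) -> \det (Abar u nu) != 0;
  A_index : forall u nu u' nu', Ubd_nu (u, nu) -> Ubd_nu (u', nu') ->
    num_pos (Abar u nu) = num_pos (Abar u' nu') /\
    num_neg (Abar u nu) = num_neg (Abar u' nu');
  dissipative : exists2 c : R, 0 < c & forall u xi (mu : R[i]),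
    piU u -> eigenvalue ('i%C *: cmx (Abar u xi) + cmx (Bbar u xi)) mu ->
    c * enorm xi ^+ 2 / (1 + enorm xi ^+ 2) <= complex.Re mu;
  Ups1_smooth : smooth_on [set usubmx u | u in piUstar] (Ups1 P);
  Ups2_smooth : smooth_on [set dsubmx u | u in piUstar] (Ups2 P);
  Ktan_smooth : forall j, smooth_on piUstar (Ktan P j);
  Vtan_smooth : forall j, exists W,
    [/\ open W, bdry (Omega P) `<=` W & smooth_on W (Vtan P j)];
  Vtan_tangent : forall j x0, bdry (Omega P) x0 ->
    (inner_normal P x0)^T *m Vtan P j x0 = 0;
  Ups3_rank : \rank (Knu P) = n3;
  Ups1_rank : forall u, piUstar u ->
    \rank (jacobian_mx (Ups1 P) (usubmx u)) = N1p;
  Ups2_rank : forall u, piUstar u ->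
    \rank (jacobian_mx (Ups2 P) (dsubmx u)) = (n2 - n3)%N
}.

(* The coefficients only make sense on states, hence the first condition. *)
Definition layer (nu : 'cV[R]_d) (w : R -> state) : Prop :=
  let flux z := Bsym nu (w z) *m hl_deriv w z in
  [/\ forall z, 0 <= z -> states (w z),
      hl_derivable w, hl_derivable flux,
      forall z, 0 <= z ->
        Asym nu (w z) *m hl_deriv w z - hl_deriv flux z = 0 &
      cvg (w z @[z --> +oo])].

Definition linearized_sol (nu : 'cV[R]_d) (w a : R -> state) : Prop :=
  let flux z := Bsym nu (w z) *m hl_deriv a z
                + 'D_(a z) (Bsym nu) (w z) *m hl_deriv w z in
  [/\ hl_derivable a, hl_derivable flux &
      forall z, 0 <= z ->
        Asym nu (w z) *m hl_deriv a z
        + 'D_(a z) (Asym nu) (w z) *m hl_deriv w z - hl_deriv flux z = 0].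

(* The linearized equation has real coefficients, so that a complex-valued
   function solves it iff its real and imaginary parts do. *)
Definition rpart n (v : 'cV[R[i]]_n) : 'cV[R]_n := map_mx (@complex.Re R) v.
Definition ipart n (v : 'cV[R[i]]_n) : 'cV[R]_n := map_mx (@complex.Im R) v.

Definition Ssol (nu : 'cV[R]_d) (w : R -> state) : set (R -> 'cV[R[i]]_N) :=
  [set a | [/\ linearized_sol nu w (fun z => rpart (a z)),
               linearized_sol nu w (fun z => ipart (a z)),
               cvg (rpart (a z) @[z --> +oo]) &
               cvg (ipart (a z) @[z --> +oo])]].

Definition S0sol (nu : 'cV[R]_d) (w : R -> state) : set (R -> 'cV[R[i]]_N) :=
  [set a | [/\ Ssol nu w a, rpart (a z) @[z --> +oo] --> (0 : state) &
               ipart (a z) @[z --> +oo] --> (0 : state)]].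

Definition chl_deriv n (a : R -> 'cV[R[i]]_n) (z : R) : 'cV[R[i]]_n :=
  cmx (hl_deriv (fun s => rpart (a s)) z)
  + 'i%C *: cmx (hl_deriv (fun s => ipart (a s)) z).

Definition Gamma (w : R -> state) (a : R -> 'cV[R[i]]_N) :
    'cV[R[i]]_(N1p + (n2 - n3 + n3)) :=
  col_mx (cmx (jacobian_mx (Ups1 P) (usubmx (w 0))) *m usubmx (a 0))
    (col_mx (cmx (jacobian_mx (Ups2 P) (dsubmx (w 0))) *m dsubmx (a 0))
       (cmx (Knu P) *m chl_deriv (fun z => dsubmx (a z)) 0)).

(* N_b = N' + N^1_+ *)
Definition Nb : nat := n2 + N1p.

Definition transversal_layer (nu : 'cV[R]_d) (w : R -> state) : Prop :=
  (forall a, S0sol nu w a -> Gamma w a = 0 -> forall z, 0 <= z -> a z = 0) /\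
  has_rank (Ssol nu w) (Gamma w) Nb.

Definition small_layers_transversal : Prop :=
  forall D : set (state * 'cV[R]_d), compact D -> D `<=` Ubd_nu ->
  exists2 eps : R, 0 < eps &
    forall (x0 : 'cV[R]_d) (w : R -> state) u nu,
      bdry (Omega P) x0 -> layer (inner_normal P x0) w -> D (u, nu) ->
      (Linf_norm (fun z => (col_mx (w z) (dsubmx (hl_deriv w z))
                            - col_mx u 0)%R) <= eps%:E)%E ->
      enorm (inner_normal P x0 - nu) <= eps ->
      transversal_layer (inner_normal P x0) w.

End Problem.

(* Main.v *)
Require Import Defs.
From HB Require Import structures.
From mathcomp Require Import all_boot all_order all_algebra.
From mathcomp Require Import complex.
From mathcomp Require Import all_classical all_reals all_analysis.
From mathcomp Require Import ring lra zify.

Set Implicit Arguments.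
Unset Strict Implicit.
Unset Printing Implicit Defensive.

Import Order.TTheory GRing.Theory Num.Theory.
Import numFieldNormedType.Exports.

Local Open Scope classical_set_scope.
Local Open Scope ring_scope.

(** Only the second block of [B_nu] is nonzero, so the profile equation linearized at a layer w
    becomes a first-order system for the perturbation a and the second block b of its flux: a' = H b
    + Ha a, b' = G b + Ga a. Here H and G are functions of w, and Ha and Ga are linear in the slope
    w'.

    At a constant layer Ha = Ga = 0 and G is conjugate to [Gnu]. Dissipativity and
    noncharacteristicity keep its spectrum off the imaginary axis. Then a - H G^-1 b is constant,
    and a is bounded exactly when b(0) has no expanding part. The solutions with a limit are thus
    parametrized by a(0) and by the contracting part of b(0), which has dimension N^2_-. Along a
    solution tending to 0 one has a = H G^-1 b, and b is recovered from a^2 alone.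

    For a layer close to a state u0 the flux v of w itself solves v' = G(w) v with G(w) close to
    G(u0). Being bounded, it decays exponentially, so Ha and Ga are small and exponentially decaying
    ([layer_perturbed]). A cone argument with quadratic Lyapunov forms shows that the description
    above survives the perturbation: [decaying_exists] solves with a(0) and the contracting part of
    b(0) prescribed, and [decaying_unique] annihilates a decaying solution whose flux at 0 is
    controlled by the slow variable a - H G^-1 b.

    Transversality in the two extreme cases follows ([layer_transversal_near]). For a decaying
    solution, either a^2(0) = 0 (Dirichlet) or the derivative of a^2 vanishes at 0 (Neumann), and
    each forces a = 0. Surjectivity of the boundary operator is clear in the Dirichlet case, a(0)
    being free. When N^2_- = N' the whole of b(0) is free as well, hence so is the derivative of a^2
    at 0. Compactness makes the neighbourhoods uniform over D.

    At a constant layer, [B_nu] times the derivative of a^2 at 0 is confined to the contracting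
    space of G, so at most N^2_- independent Neumann data are reached ([constant_layer_neumann_le]).
    The reformulation with Dirichlet conditions is the identity N_+ + N^2_- = N' + N^1_+
    ([index_formula]). It is proved by counting the roots r with Re r < 0 of det (la + r A - r^2 B)
    = 0 for la > 0: dissipativity forbids imaginary roots, so the count does not depend on la. Its
    limits for la tending to 0 and to infinity are the two sides. *)

Lemma cvg_sum (K : numFieldType) (V : normedModType K) (T I : Type)
    (F : set_system T) (r : seq I) (P : pred I) (f : I -> T -> V) (a : I -> V) :
  Filter F -> (forall i, P i -> f i x @[x --> F] --> a i) ->
  \sum_(i <- r | P i) f i x @[x --> F] --> \sum_(i <- r | P i) a i.
Proof. by move=> FF h; apply: cvg_big => //; exact: add_continuous. Qed.

(** * Semicontinuity of the number of roots of a polynomial in an open set *)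

Section RootContinuity.
Variables (C : numFieldType) (T : Type) (F : set_system T).
Context {FF : Filter F}.

Definition coef_cvg (q : T -> {poly C}) (p : {poly C}) : Prop :=
  forall i, (q t)`_i @[t --> F] --> p`_i.

Lemma coef_cvg_cst p : coef_cvg (fun=> p) p.
Proof. by move=> i; exact: cvg_cst. Qed.

Lemma coef_cvgD q1 q2 p1 p2 : coef_cvg q1 p1 -> coef_cvg q2 p2 ->
  coef_cvg (fun t => q1 t + q2 t) (p1 + p2).
Proof.
move=> h1 h2 i; rewrite coefD.
under eq_fun do rewrite coefD.
exact: cvgD.
Qed.

Lemma coef_cvgM q1 q2 p1 p2 : coef_cvg q1 p1 -> coef_cvg q2 p2 ->
  coef_cvg (fun t => q1 t * q2 t) (p1 * p2).
Proof.
move=> h1 h2 i; rewrite coefM.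
under eq_fun do rewrite coefM.
by apply: cvg_sum => j _; exact: cvgM.
Qed.

Lemma coef_cvg_sum (I : Type) (s : seq I) (P : pred I) q p :
  (forall i, coef_cvg (q i) (p i)) ->
  coef_cvg (fun t => \sum_(i <- s | P i) q i t) (\sum_(i <- s | P i) p i).
Proof.
move=> h i; rewrite coef_sum.
under eq_fun do rewrite coef_sum.
by apply: cvg_sum => j _; exact: h.
Qed.

Lemma coef_cvg_prod (I : Type) (s : seq I) q p :
  (forall i, coef_cvg (q i) (p i)) ->
  coef_cvg (fun t => \prod_(i <- s) q i t) (\prod_(i <- s) p i).
Proof.
move=> h; elim: s => [|x s IHs].
  by rewrite big_nil; under eq_fun do rewrite big_nil; exact: coef_cvg_cst.
rewrite big_cons; under eq_fun do rewrite big_cons.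
exact: coef_cvgM.
Qed.

Lemma char_poly_coef_cvg n (M : T -> 'M[C]_n) (M0 : 'M[C]_n) :
  (forall i j, M t i j @[t --> F] --> M0 i j) ->
  coef_cvg (fun t => char_poly (M t)) (char_poly M0).
Proof.
move=> hM; rewrite /char_poly /determinant.
apply: coef_cvg_sum => s; apply: coef_cvgM; first exact: coef_cvg_cst.
apply: coef_cvg_prod => i.
rewrite !mxE; under eq_fun do rewrite !mxE.
apply: coef_cvgD; first exact: coef_cvg_cst.
move=> k; rewrite coefN coefC; under eq_fun do rewrite coefN coefC.
by apply: cvgN; case: ifP => _; [exact: hM|exact: cvg_cst].
Qed.

Lemma nearest_root (z : C) (s : seq C) : s != [::] ->
  exists w, w \in s /\ forall w', w' \in s -> `|z - w| <= `|z - w'|.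
Proof.
elim: s => // x [|y s] IHs _.
  by exists x; split=> [|w']; rewrite ?mem_head// inE => /eqP ->.
have [//|w [ws hw]] := IHs.
have [le_xw|lt_wx] := real_leP (normr_real (z - x)) (normr_real (z - w)).
  exists x; split; first exact: mem_head.
  move=> w'; rewrite in_cons => /orP[/eqP ->//|/hw]; exact: le_trans.
exists w; split; first by rewrite in_cons ws orbT.
by move=> w'; rewrite in_cons => /orP[/eqP ->|/hw//]; exact: ltW.
Qed.

(** Synthetic division by X - x, read from the top coefficient downwards. *)
Lemma prod_XsubC_coefS (x : C) (s : seq C) i :
  (\prod_(w <- s) ('X - w%:P))`_i =
  (\prod_(w <- x :: s) ('X - w%:P))`_i.+1
  + x * (\prod_(w <- s) ('X - w%:P))`_i.+1.
Proof.
by rewrite big_cons mulrBl coefB mulrC coefMX coefCM subrK.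
Qed.

(* Peel off the root of the perturbed polynomial nearest to a given root of the
   limit; synthetic division keeps the convergence of the coefficients. *)
Lemma count_roots_lsc (O : pred C) (zs : seq C) (ws : T -> seq C) :
  (forall z, O z -> exists2 e, 0 < e & forall w, `|z - w| < e -> O w) ->
  (forall t, size (ws t) = size zs) ->
  coef_cvg (fun t => \prod_(w <- ws t) ('X - w%:P))
           (\prod_(z <- zs) ('X - z%:P)) ->
  \forall t \near F, (count O zs <= count O (ws t))%N.
Proof.
move=> oO; elim: zs ws => [|z zs IHzs] ws szw cvg_ws.
  exact: nearW.
have ws_neq0 t : ws t != [::] by rewrite -size_eq0 szw.
have [w hw] := choice (fun t => nearest_root z (ws_neq0 t)).
have ws_perm t : perm_eq (ws t) (w t :: rem (w t) (ws t)).
  by apply: perm_to_rem; case: (hw t).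
have ws_prod t : \prod_(x <- ws t) ('X - x%:P) =
    \prod_(x <- w t :: rem (w t) (ws t)) ('X - x%:P) by exact: perm_big.
(* The value at z of the perturbed polynomial tends to 0, and its modulus is at least the power of
   order [size zs] + 1 of the distance from z to the nearest root. *)
have w_cvg : w t @[t --> F] --> z.
  have ev0 : (\prod_(x <- ws t) ('X - x%:P)).[z] @[t --> F] --> (0 : C).
    have -> : 0 = (\prod_(x <- z :: zs) ('X - x%:P)).[z].
      by rewrite big_cons hornerM !hornerE subrr mul0r.
    have szP s : size (\prod_(x <- s) ('X - x%:P) : {poly C}) = (size s).+1.
      by rewrite size_prod_XsubC.
    rewrite horner_coef; under eq_fun do rewrite horner_coef szP szw.
    rewrite szP; apply: cvg_sum => i _; apply: cvgMl; exact: cvg_ws.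
  apply/cvgrPdist_lt => e e0.
  have en0 : 0 < e ^+ (size zs).+1 by exact: exprn_gt0.
  move/cvgrPdist_lt : ev0 => /(_ _ en0); apply: filterS => t.
  rewrite sub0r normrN => lt_e.
  rewrite real_ltNge ?normr_real ?gtr0_real//; apply/negP => le_ew.
  suff : e ^+ (size zs).+1 <= `|(\prod_(x <- ws t) ('X - x%:P)).[z]|.
    by rewrite real_leNgt ?normr_real ?gtr0_real// lt_e.
  rewrite horner_prod normr_prod.
  have [_ hmin] := hw t.
  rewrite -[(size zs).+1]/(size (z :: zs)) -(szw t).
  elim: (ws t) hmin => [|x s IHs] hmin; first by rewrite big_nil expr0.
  rewrite big_cons /= exprS !hornerE ler_pM ?exprn_ge0 ?(ltW e0)//.
    by apply: (le_trans le_ew); apply: hmin; rewrite mem_head.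
  by apply: IHs => w' w's; apply: hmin; rewrite in_cons w's orbT.
have szr t : size (rem (w t) (ws t)) = size zs.
  by have := perm_size (ws_perm t); rewrite szw /= => -[].
have cvg_rem : coef_cvg (fun t => \prod_(x <- rem (w t) (ws t)) ('X - x%:P))
                        (\prod_(x <- zs) ('X - x%:P)).
  (* Downward induction on the index i: coefficients beyond the degree vanish, and synthetic
     division lowers the index by one. *)
  move=> i; have [m hm] : exists m, (i + m >= (size zs).+1)%N.
    by exists (size zs).+1; rewrite leq_addl.
  elim: m i hm => [|m IHm] i hm.
    have h0 (s : seq C) : size s = size zs ->
        (\prod_(x <- s) ('X - x%:P))`_i = (0 : C).
      by move=> ss; rewrite nth_default// size_prod_XsubC ss -(addn0 i).
    rewrite h0//; under eq_fun do rewrite h0//; exact: cvg_cst.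
  rewrite (prod_XsubC_coefS z).
  under eq_fun => t do rewrite (prod_XsubC_coefS (w t)) -ws_prod.
  apply: cvgD; first exact: cvg_ws.
  by apply: cvgM => //; apply: IHm; rewrite addSnnS.
have := IHzs _ szr cvg_rem.
have : \forall t \near F, (O z <= O (w t))%N.
  case: (boolP (O z)) => [Oz|_]; last exact: nearW.
  have [e e0 he] := oO z Oz.
  move/cvgrPdist_lt : w_cvg => /(_ _ e0); apply: filterS => t /he ->//.
apply: filterS2 => t le1 le2.
by rewrite (permP (ws_perm t)) /= leq_add.
Qed.

End RootContinuity.

(** * Entrywise convergence of matrices *)

Section MatrixConvergence.
Variables (R : numFieldType) (T : Type) (F : set_system T).
Context {FF : Filter F}.

Definition mx_cvg m n (M : T -> 'M[R]_(m, n)) (M0 : 'M[R]_(m, n)) : Prop :=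
  forall i j, M t i j @[t --> F] --> M0 i j.

Lemma mx_cvg_cst m n (M0 : 'M[R]_(m, n)) : mx_cvg (fun=> M0) M0.
Proof. by move=> i j; exact: cvg_cst. Qed.

Lemma mx_cvgZ m n (a : T -> R) (a0 : R) (M : T -> 'M[R]_(m, n)) M0 :
  a t @[t --> F] --> a0 -> mx_cvg M M0 ->
  mx_cvg (fun t => a t *: M t) (a0 *: M0).
Proof.
move=> ha hM i j; rewrite mxE; under eq_fun do rewrite mxE.
by apply: cvgM.
Qed.

Lemma mx_cvgD m n (M1 M2 : T -> 'M[R]_(m, n)) M10 M20 :
  mx_cvg M1 M10 -> mx_cvg M2 M20 ->
  mx_cvg (fun t => M1 t + M2 t) (M10 + M20).
Proof.
move=> h1 h2 i j; rewrite mxE; under eq_fun do rewrite mxE.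
by apply: cvgD; [exact: h1|exact: h2].
Qed.

Lemma mx_cvgN m n (M : T -> 'M[R]_(m, n)) M0 :
  mx_cvg M M0 -> mx_cvg (fun t => - M t) (- M0).
Proof.
move=> h i j; rewrite mxE; under eq_fun do rewrite mxE.
by apply: cvgN; exact: h.
Qed.

Lemma mx_cvgM m n p (M1 : T -> 'M[R]_(m, n)) (M2 : T -> 'M[R]_(n, p)) M10 M20 :
  mx_cvg M1 M10 -> mx_cvg M2 M20 ->
  mx_cvg (fun t => M1 t *m M2 t) (M10 *m M20).
Proof.
move=> h1 h2 i j; rewrite mxE; under eq_fun do rewrite mxE.
by apply: cvg_sum => k _; apply: cvgM; [exact: h1|exact: h2].
Qed.

Lemma mx_cvg_row m n p (M1 : T -> 'M[R]_(m, n)) (M2 : T -> 'M[R]_(m, p)) M10 M20 :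
  mx_cvg M1 M10 -> mx_cvg M2 M20 ->
  mx_cvg (fun t => row_mx (M1 t) (M2 t)) (row_mx M10 M20).
Proof.
move=> h1 h2 i j; rewrite mxE; under eq_fun do rewrite mxE.
by case: fintype.split => k; [exact: h1|exact: h2].
Qed.

Lemma mx_cvg_col m n p (M1 : T -> 'M[R]_(m, n)) (M2 : T -> 'M[R]_(p, n)) M10 M20 :
  mx_cvg M1 M10 -> mx_cvg M2 M20 ->
  mx_cvg (fun t => col_mx (M1 t) (M2 t)) (col_mx M10 M20).
Proof.
move=> h1 h2 i j; rewrite mxE; under eq_fun do rewrite mxE.
by case: fintype.split => k; [exact: h1|exact: h2].
Qed.

Lemma mx_cvg_block m n p q (Mul : T -> 'M[R]_(m, n)) (Mur : T -> 'M[R]_(m, q))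
    (Mdl : T -> 'M[R]_(p, n)) (Mdr : T -> 'M[R]_(p, q)) Mul0 Mur0 Mdl0 Mdr0 :
  mx_cvg Mul Mul0 -> mx_cvg Mur Mur0 -> mx_cvg Mdl Mdl0 -> mx_cvg Mdr Mdr0 ->
  mx_cvg (fun t => block_mx (Mul t) (Mur t) (Mdl t) (Mdr t))
    (block_mx Mul0 Mur0 Mdl0 Mdr0).
Proof.
by move=> *; rewrite /block_mx; apply: mx_cvg_col; exact: mx_cvg_row.
Qed.

End MatrixConvergence.

(** * Eigenvalues with multiplicity: similarity, block triangular matrices, inverses, limits *)

Section Eigenvalues.
Variable R : realType.
Local Notation C := R[i].

Lemma char_poly_eigvals n (M : 'M[C]_n) :
  char_poly M = \prod_(z <- eigvals M) ('X - z%:P).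
Proof.
rewrite /eigvals; case: closed_field_poly_normal => s /= {1}->.
by rewrite (monicP (char_poly_monic M)) scale1r.
Qed.

Lemma size_eigvals n (M : 'M[C]_n) : size (eigvals M) = n.
Proof.
apply/eqP; rewrite -eqSS -(size_char_poly M) char_poly_eigvals.
by rewrite size_prod_XsubC.
Qed.

Lemma eigvals_perm n (M : 'M[C]_n) s :
  char_poly M = \prod_(z <- s) ('X - z%:P) -> perm_eq (eigvals M) s.
Proof. by rewrite char_poly_eigvals; exact: prod_XsubC_eq. Qed.

Lemma mem_eigvals n (M : 'M[C]_n) z : (z \in eigvals M) = eigenvalue M z.
Proof. by rewrite eigenvalue_root_char char_poly_eigvals root_prod_XsubC. Qed.

Lemma char_poly_ublock (K : comNzRingType) m n (A : 'M[K]_m) B (D : 'M[K]_n) :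
  char_poly (block_mx A B 0 D) = char_poly A * char_poly D.
Proof.
rewrite /char_poly /char_poly_mx map_block_mx scalar_mx_block opp_block_mx.
by rewrite add_block_mx map_mx0 subr0 det_ublock.
Qed.

Lemma char_poly_lblock (K : comNzRingType) m n (A : 'M[K]_m) B (D : 'M[K]_n) :
  char_poly (block_mx A 0 B D) = char_poly A * char_poly D.
Proof.
rewrite /char_poly /char_poly_mx map_block_mx scalar_mx_block opp_block_mx.
by rewrite add_block_mx map_mx0 subr0 det_lblock.
Qed.

Lemma char_poly_sim (K : fieldType) n (P A B : 'M[K]_n) :
  P \in unitmx -> A *m P = P *m B -> char_poly A = char_poly B.
Proof.
move=> uP AP; set Q := map_mx polyC P.
have uQ : \det Q != 0.
  by rewrite det_map_mx polyC_eq0 -unitfE -unitmxE.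
apply: (mulIf uQ); rewrite /char_poly -det_mulmx mulrC -det_mulmx.
congr (\det _); rewrite mulmxBl mulmxBr -!map_mxM AP scalar_mxC.
by [].
Qed.

Lemma eq_num_eig n m (p : pred C) (M : 'M[C]_n) (M' : 'M[C]_m) :
  char_poly M = char_poly M' -> num_eig p M = num_eig p M'.
Proof.
move=> e; apply/permP/eigvals_perm; rewrite e; exact: char_poly_eigvals.
Qed.

Lemma num_eig_sim n (p : pred C) (P A B : 'M[C]_n) :
  P \in unitmx -> A *m P = P *m B -> num_eig p A = num_eig p B.
Proof. by move=> uP /(char_poly_sim uP) /eq_num_eig ->. Qed.

Lemma num_eig_mul n m k (p : pred C) (M : 'M[C]_n) (A : 'M[C]_m) (B : 'M[C]_k) :
  char_poly M = char_poly A * char_poly B ->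
  num_eig p M = (num_eig p A + num_eig p B)%N.
Proof.
move=> e; rewrite /num_eig -count_cat; apply/permP/eigvals_perm.
by rewrite e !char_poly_eigvals big_cat.
Qed.

(** Characteristic polynomials are compared below at nonzero points only, where division by x is
    allowed. *)
Lemma eq_poly_off0 (p q : {poly C}) :
  (forall x, x != 0 -> p.[x] = q.[x]) -> p = q.
Proof.
move=> h; apply/eqP; rewrite -subr_eq0; apply/negPn/negP => pq0.
(* Distinct nonzero points, as many as the size of p - q, which is one more than its possible number
   of roots. *)
pose s := [seq k.+1%:R : C | k <- iota 0 (size (p - q))].
have rs : all (root (p - q)) s.
  by apply/allP => _ /mapP[k _ ->]; rewrite rootE !hornerE h ?subrr// pnatr_eq0.
have us : uniq s.
  by rewrite map_inj_uniq ?iota_uniq// => i j /eqP; rewrite eqr_nat => /eqP[].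
by have := max_poly_roots pq0 rs us; rewrite size_map size_iota ltnn.
Qed.

Lemma horner_char_poly (K : comNzRingType) n (M : 'M[K]_n) x :
  (char_poly M).[x] = \det (x%:M - M).
Proof.
rewrite -[LHS]/(horner_eval x (char_poly M)) -det_map_mx; congr (\det _).
by apply/matrixP => i j; rewrite !mxE /= /horner_eval !(hornerE, hornerMn).
Qed.

(** A (x - B) = - x (c / x - A), so the determinant of x - B is read off the characteristic
    polynomial of A at c / x. *)
Lemma eigvals_inv n (A B : 'M[C]_n) (c : C) : c != 0 -> A *m B = c%:M ->
  perm_eq (eigvals B) [seq c / z | z <- eigvals A].
Proof.
move=> c0 AB; apply: eigvals_perm.
have detA : \det A = \prod_(z <- eigvals A) z.
  have := congr1 (fun p => p.[0]) (char_poly_eigvals A).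
  rewrite horner_prod horner_char_poly raddf0 sub0r.
  under eq_bigr do rewrite !hornerE.
  under eq_bigr do rewrite -mulN1r.
  rewrite big_split /= big_const_seq count_predT iter_mulr_1 size_eigvals.
  rewrite -scaleN1r detZ => e.
  by apply: (@mulfI _ ((-1) ^+ n)); rewrite ?signr_eq0.
have detA0 : \det A != 0.
  apply/eqP => d0; have := congr1 determinant AB; rewrite det_mulmx d0 mul0r.
  by move=> /esym/eqP; rewrite det_scalar expf_eq0 (negbTE c0) andbF.
have z0 z : z \in eigvals A -> z != 0.
  move=> zA; apply: contra detA0 => /eqP z0; rewrite detA.
  by rewrite prodf_seq_eq0; apply/hasP; exists z => //; rewrite z0 /=.
apply: eq_poly_off0 => x x0.
apply: (mulfI detA0).
rewrite horner_char_poly -det_mulmx mulmxBr AB.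
have -> : A *m x%:M - c%:M = (- x) *: ((c / x)%:M - A).
  rewrite mul_mx_scalar scalerBr scale_scalar_mx scaleNr opprK.
  by rewrite mulNr mulrCA divff// mulr1 addrC raddfN.
rewrite detZ -horner_char_poly char_poly_eigvals !horner_prod big_map.
rewrite detA -big_split /= -{1}(size_eigvals A) -count_predT -iter_mulr_1.
rewrite -big_const_seq -big_split /=.
apply: eq_big_seq => z zA; rewrite !hornerE.
by field; rewrite x0 z0.
Qed.

Lemma num_eig_scale n (p : pred C) (c : C) (M : 'M[C]_n) : c != 0 ->
  num_eig p (c *: M) = num_eig [pred z | p (c * z)] M.
Proof.
move=> c0; rewrite /num_eig.
have /permP -> : perm_eq (eigvals (c *: M)) [seq c * z | z <- eigvals M].
  apply: eigvals_perm; apply: eq_poly_off0 => x _.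
  rewrite horner_char_poly.
  have -> : x%:M - c *: M = c *: ((x / c)%:M - M).
    by rewrite scalerBr scale_scalar_mx mulrC divfK.
  rewrite detZ -horner_char_poly char_poly_eigvals !horner_prod big_map.
  rewrite -{1}(size_eigvals M) -count_predT -iter_mulr_1.
  rewrite -big_const_seq -big_split /=.
  by apply: eq_bigr => z _; rewrite !hornerE; field.
by rewrite count_map; apply: eq_count => z.
Qed.

Lemma num_eig0 n (p : pred C) : ~~ p 0 -> num_eig p (0 : 'M[C]_n) = 0%N.
Proof.
move=> p0; apply/eqP; rewrite -leqn0 leqNgt -has_count; apply/hasP => -[z].
rewrite mem_eigvals => /eigenvalueP[v]; rewrite mulmx0 => /esym/eqP.
rewrite scaler_eq0 => /orP[/eqP -> _ |/eqP ->]; first exact/negP.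
by rewrite eqxx.
Qed.

(** Only an inequality can hold: eigenvalues of the limit lying on the boundary of O may move into
    O. *)
Lemma num_eig_lsc (T : Type) (F : set_system T) (FF : Filter F) n
    (M : T -> 'M[R]_n) (M0 : 'M[R]_n) (O : pred C) :
  (forall z, O z -> exists2 e : R, 0 < e & forall w, `|z - w| < e%:C%C -> O w) ->
  (forall i j, M t i j @[t --> F] --> M0 i j) ->
  \forall t \near F, (num_eig O (cmx M0) <= num_eig O (cmx (M t)))%N.
Proof.
move=> oO hM.
apply: (@count_roots_lsc (R[i] : numFieldType)) => //.
- by move=> z /oO[e e0 he]; exists (e%:C%C); rewrite ?ltcR.
- by move=> t; rewrite !size_eigvals.
- rewrite -char_poly_eigvals; under eq_fun do rewrite -char_poly_eigvals.
  apply: char_poly_coef_cvg => i j.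
  apply/cvgrPdist_lt => /= e; rewrite ltcE /= => /andP[/eqP ei e0].
  have := hM i j; move=> /cvgrPdist_lt/(_ _ e0); apply: filterS => t.
  rewrite !mxE -rmorphB /= => h.
  rewrite (_ : e = (complex.Re e)%:C%C); last first.
    by apply/eqP; rewrite eq_complex /= ei !eqxx.
  by rewrite normc_def /= expr0n addr0 ltcR sqrtr_sqr.
Qed.

End Eigenvalues.

(** * Counting eigenvalues in the two half-planes, at two scales *)

Section HalfPlaneCounts.
Variable R : realType.
Local Notation C := R[i].

Definition left_half : pred C := [pred z | complex.Re z < 0].
Definition right_half : pred C := [pred z | 0 < complex.Re z].

Lemma complex_ReMr (c : R) (z : C) : complex.Re (c%:C%C * z) = c * complex.Re z.
Proof. by case: z => x y /=; rewrite mul0r subr0. Qed.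

Lemma complex_ImMr (c : R) (z : C) : complex.Im (c%:C%C * z) = c * complex.Im z.
Proof. by case: z => x y /=; rewrite mul0r addr0. Qed.

Lemma Re_inv (z : C) : z != 0 ->
  exists2 k : R, 0 < k & complex.Re z^-1 = k * complex.Re z.
Proof.
case: z => x y z0; exists (x ^+ 2 + y ^+ 2)^-1; last by rewrite /= mulrC.
rewrite invr_gt0 lt_neqAle addr_ge0 ?sqr_ge0// andbT eq_sym.
by rewrite paddr_eq0 ?sqr_ge0// !sqrf_eq0; rewrite eq_complex in z0.
Qed.

Lemma left_half_div (c : R) (z : C) : 0 < c -> z != 0 ->
  left_half (c%:C%C / z) = left_half z.
Proof.
move=> c0 /Re_inv[k k0 e]; rewrite /left_half /= complex_ReMr e.
by rewrite mulrA pmulr_rlt0// mulr_gt0.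
Qed.

Lemma right_half_div (c : R) (z : C) : 0 < c -> z != 0 ->
  right_half (c%:C%C / z) = right_half z.
Proof.
move=> c0 /Re_inv[k k0 e]; rewrite /right_half /= complex_ReMr e.
by rewrite mulrA pmulr_rgt0// mulr_gt0.
Qed.

Definition open_pred (O : pred C) :=
  forall z, O z -> exists2 e : R, 0 < e & forall w, `|z - w| < e%:C%C -> O w.

Lemma Re_dist (z w : C) (e : R) : `|z - w| < e%:C%C ->
  `|complex.Re z - complex.Re w| < e.
Proof.
move=> h; rewrite -ltcR; apply: le_lt_trans h.
by have := normc_ge_Re (z - w); rewrite raddfB.
Qed.

Lemma open_left_half : open_pred left_half.
Proof.
move=> z z0; exists (- complex.Re z); first by rewrite oppr_gt0.
move=> w /Re_dist; rewrite ltr_distlC /left_half /= => /andP[_].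
by rewrite subrr.
Qed.

Lemma open_right_half : open_pred right_half.
Proof.
move=> z z0; exists (complex.Re z) => //.
move=> w /Re_dist; rewrite ltr_distlC /right_half /= => /andP[+ _].
by rewrite subrr.
Qed.

Lemma open_outside (p : pred C) (d : R) : open_pred p ->
  open_pred [pred z | p z && (d%:C%C < `|z|)].
Proof.
move=> op z /andP[/op[e e0 he]]; rewrite normc_def ltcR.
set r := Num.sqrt _ => dr; exists (Num.min e (r - d)).
  by rewrite lt_min e0 subr_gt0.
move=> w zw; apply/andP; split.
  by apply: he; apply: lt_le_trans zw _; rewrite lecR ge_min lexx.
have zw' : `|z - w| < (r - d)%:C%C.
  by apply: lt_le_trans zw _; rewrite lecR ge_min lexx orbT.
have : `|z| - `|w| <= `|z - w| by rewrite lerB_dist.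
move=> /le_lt_trans/(_ zw'); rewrite {1}normc_def -/r rmorphB /=.
by rewrite ltrD2l ltrN2.
Qed.

Lemma count_outside (p : pred C) (s : seq C) : ~~ p 0 ->
  exists2 d : R, 0 < d & count [pred z | p z && (d%:C%C < `|z|)] s = count p s.
Proof.
move=> p0; elim: s => [|z s [d d0 IHs]]; first by exists 1.
have [z0|z0] := eqVneq z 0.
  by exists d; rewrite //= IHs z0 (negbTE p0).
have [r zr] : exists r : R, `|z| = r%:C%C by rewrite normc_def; eexists.
have r0 : 0 < r by rewrite -ltcR -zr normr_gt0.
exists (Num.min d (r / 2)); first by rewrite lt_min d0 divr_gt0.
apply/eqP; rewrite eqn_leq; apply/andP; split.
  by apply: sub_count => w /andP[].
rewrite /= -IHs leq_add//.
  case: (p z) => //=; rewrite lt0b zr ltcR gt_min.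
  by apply/orP; right; rewrite ltr_pdivrMr// ltr_pMr// ltr1n.
apply: sub_count => w /andP[pw dw]; apply/andP; split => //.
by apply: le_lt_trans dw; rewrite lecR ge_min lexx.
Qed.

Lemma num_eigE (p : pred C) n (M : 'M[C]_n) : num_eig p M = count p (eigvals M).
Proof. by []. Qed.

(* Eigenvalues of S t staying away from 0, and eigenvalues of size s t, seen as
   the inverses of those of Z t staying away from 0, are counted separately. *)
Lemma two_scale_lsc (T : Type) (F : set_system T) (FF : Filter F) n
    (p : pred C) (s : T -> R) (S Z : T -> 'M[R]_n) (S0 Z0 : 'M[R]_n) :
  open_pred p -> ~~ p 0 ->
  (forall c z, 0 < c -> z != 0 -> p (c%:C%C / z) = p z) ->
  (\forall t \near F, 0 < s t) -> s t @[t --> F] --> 0 ->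
  (forall i j, S t i j @[t --> F] --> S0 i j) ->
  (forall i j, Z t i j @[t --> F] --> Z0 i j) ->
  (\forall t \near F, exists2 U, U \in unitmx &
     exists2 Z', Z t *m U = U *m Z' & Z' *m S t = (s t)%:M) ->
  \forall t \near F,
    (num_eig p (cmx S0) + num_eig p (cmx Z0) <= num_eig p (cmx (S t)))%N.
Proof.
move=> op p0 pinv s0 scvg hS hZ hSZ.
have [d d0 hd] := count_outside (eigvals (cmx S0)) p0.
have [e e0 he] := count_outside (eigvals (cmx Z0)) p0.
have hS' := num_eig_lsc FF (open_outside (d := d) op) hS.
have hZ' := num_eig_lsc FF (open_outside (d := e) op) hZ.
(* An eigenvalue z counted at both scales would satisfy |z| > d and s / |z| > e, hence s > d e. Near
   the limit this is impossible. *)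
have hs : \forall t \near F, s t < d * e.
  move/cvgrPdist_lt : scvg => /(_ _ (mulr_gt0 d0 e0)); apply: filterS => t.
  by rewrite sub0r normrN; apply: le_lt_trans; exact: ler_norm.
near=> t; rewrite num_eigE -hd num_eigE -he.
have st0 : 0 < s t by near: t.
have [U uU [Z' ZU ZS]] : exists2 U, U \in unitmx &
     exists2 Z', Z t *m U = U *m Z' & Z' *m S t = (s t)%:M by near: t.
have stC : (s t)%:C%C != 0 by rewrite eq_complex /= (gt_eqF st0).
have cS0 : S t \in unitmx.
  suff: (s t)^-1 *: Z' *m S t = 1%:M by move=> /mulmx1_unit[].
  by rewrite -scalemxAl ZS scale_scalar_mx mulVf ?gt_eqF.
have nz z : z \in eigvals (cmx (S t)) -> z != 0.
  rewrite mem_eigvals => /eigenvalueP[v vS v0]; apply: contraNneq v0 => z0.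
  move: vS; rewrite z0 scale0r => /(congr1 (mulmx^~ (invmx (cmx (S t))))).
  by rewrite mul0mx mulmxK ?map_unitmx// => ->.
have eZ : perm_eq (eigvals (cmx Z')) [seq (s t)%:C%C / z | z <- eigvals (cmx (S t))].
  have /(_ (cmx (S t)) (cmx Z') _ stC) := @eigvals_inv R n; apply.
  rewrite /cmx -map_mxM -map_scalar_mx; congr map_mx.
  have := mulmxV cS0; have : Z' = s t *: invmx (S t).
    by rewrite -mul_scalar_mx -ZS mulmxK.
  by move=> -> Sv; rewrite -scalemxAr Sv scalemx1.
have le1 : (count [pred z | p z && (d%:C%C < `|z|)%R] (eigvals (cmx S0)) <=
  count [pred z | p z && (d%:C%C < `|z|)%R] (eigvals (cmx (S t))))%N by near: t.
have le2 : (count [pred z | p z && (e%:C%C < `|z|)%R] (eigvals (cmx Z0)) <=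
  count [pred z | p z && (e%:C%C < `|z|)%R] (eigvals (cmx (Z t))))%N by near: t.
apply: leq_trans (leq_add le1 le2) _.
have -> : count [pred z | p z && (e%:C%C < `|z|)] (eigvals (cmx (Z t))) =
    count [pred z | p z && (e%:C%C < `|(s t)%:C%C / z|)] (eigvals (cmx (S t))).
  rewrite -num_eigE (@num_eig_sim _ _ _ (cmx U) _ (cmx Z')).
  - rewrite num_eigE (permP eZ) count_map; apply: eq_in_count => z zS /=.
    by rewrite pinv ?nz.
  - by rewrite map_unitmx.
  - by rewrite /cmx -!map_mxM ZU.
rewrite -count_predUI -[leqRHS]addn0 leq_add//.
  by apply: sub_count => z /= /orP[] /andP[].
rewrite leqn0 -leqn0 leqNgt -has_count; apply/hasPn => z zS /=.
apply/negP => /andP[/andP[_ h1] /andP[_]]; rewrite normrM normfV.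
have nz0 : 0 < `|z| by rewrite normr_gt0 nz.
rewrite ltr_pdivlMr// => h2.
have hst : s t < d * e by near: t.
have : `|(s t)%:C%C| = (s t)%:C%C :> C.
  by rewrite ger0_norm// lecR ltW.
move=> ns; move: h2; rewrite ns; apply/negP.
rewrite -real_leNgt; last 2 first.
  by rewrite ger0_real// lecR ltW.
  by rewrite ger0_real// mulr_ge0 ?normr_ge0// lecR ltW.
apply: (@le_trans _ _ (e%:C%C * d%:C%C)).
  by rewrite -rmorphM /= lecR mulrC ltW.
by rewrite ler_pM2l ?ltcR// ltW.
Unshelve. all: by end_near. Qed.

Lemma num_left_right n (M : 'M[C]_n) :
  (forall z, eigenvalue M z -> complex.Re z != 0) ->
  (num_eig left_half M + num_eig right_half M)%N = n.
Proof.
move=> h; rewrite -[RHS](size_eigvals M) -(count_predC left_half) !num_eigE.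
congr addn; apply: eq_in_count => z; rewrite mem_eigvals => /h z0.
by rewrite /left_half /right_half /= -leNgt lt_neqAle eq_sym z0.
Qed.

End HalfPlaneCounts.

(** * The pencil of the index formula and its scaled inverse *)

Section IndexFormula.
Variables (R : realType) (n1 n2 : nat).
Variables (A : 'M[R]_(n1 + n2)) (B : 'M[R]_n2).
Local Notation C := R[i].
Local Notation A11 := (ulsubmx A).
Local Notation A12 := (ursubmx A).
Local Notation A21 := (dlsubmx A).
Local Notation A22 := (drsubmx A).

(** The matrix G_nu of these symbols: B times it is the Schur complement of [A11] in A. *)
Definition reduced_mx : 'M[R]_n2 := invmx B *m (A22 - A21 *m invmx A11 *m A12).
Local Notation G := reduced_mx.
Local Notation Bfull := (block_mx 0 0 0 B : 'M[R]_(n1 + n2)).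

Hypothesis A11_unit : A11 \in unitmx.
Hypothesis B_unit : B \in unitmx.

Lemma eigenvalue_col n (M : 'M[C]_n) a :
  eigenvalue M a <-> exists2 v : 'cV_n, v != 0 & M *m v = a *: v.
Proof.
have tr_char (N : 'M[C]_n) : char_poly N^T = char_poly N.
  rewrite /char_poly -det_tr; congr (\det _).
  by rewrite /char_poly_mx linearB /= tr_scalar_mx -map_trmx trmxK.
rewrite eigenvalue_root_char -tr_char -eigenvalue_root_char.
split=> [/eigenvalueP[v vM v0]|[v v0 vM]].
  exists v^T; first by rewrite trmx_eq0.
  by apply: trmx_inj; rewrite trmx_mul trmxK vM linearZ /= trmxK.
apply/eigenvalueP; exists v^T; last by rewrite trmx_eq0.
by rewrite -trmx_mul vM linearZ.
Qed.

(* The eigenvalues of [pencil_mx al be] are the s with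
   det (s^2 + al s A - be Bfull) = 0, up to a factor s^n1. *)
Definition pencil_mx (al be : R) : 'M[R]_(n1 + (n2 + n2)) :=
  block_mx (- al *: A11) (row_mx (- al *: A12) 0) (col_mx (- al *: A21) 0)
           (block_mx (- al *: A22) (be *: B) 1%:M 0).

(** A multiple of the inverse of the pencil, under the relations between parameters in
    [copencilK]. *)
Definition copencil_mx (a b c s : R) : 'M[R]_(n1 + (n2 + n2)) :=
  block_mx (- a *: invmx A11) (row_mx 0 (- s *: (invmx A11 *m A12)))
    (col_mx 0 (- (b / s) *: (invmx B *m A21 *m invmx A11)))
    (block_mx 0 s%:M ((b / s) *: invmx B) (c *: G)).

(** Conjugation by diag (1, 1, s) removes the entries in s and b / s, so that the limit s = 0 can be
    taken. *)
Lemma copencil_sim (a b c s : R) : s != 0 ->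
  exists2 U, U \in unitmx & copencil_mx a b c 1 *m U = U *m copencil_mx a b c s.
Proof.
move=> s0.
exists (block_mx 1%:M 0 0 (block_mx 1%:M 0 0 s%:M)).
  by rewrite unitmxE !det_ublock !det1 !mul1r det_scalar unitfE expf_neq0.
rewrite /copencil_mx !mulmx_block !(mul_row_block, mul_block_col, mulmx0).
rewrite !(mul0mx, mulmx1, mul1mx, mulmx0, addr0, add0r).
rewrite !mul_mx_scalar !mul_scalar_mx !scalerA divr1 mulrN1.
by rewrite mulrN [s * (b / s)]mulrC divfK// mulrC.
Qed.

Lemma copencilK (a b c s al be : R) : s != 0 -> s = a * al ->
  b * al = c * s -> b * be = s ^+ 2 ->
  copencil_mx a b c s *m pencil_mx al be = s%:M.
Proof.
move=> s0 sE bal bbe.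
have bs : b / s * al = c by rewrite mulrAC bal mulfK.
have bs' : b / s * be = s by rewrite mulrAC bbe expr2 mulfK.
rewrite /copencil_mx /pencil_mx mulmx_block.
rewrite !(mul_row_block, mul_block_col, mulmx_block, mul_row_col, mul_mx_row, mul_col_mx, mul_col_row).
rewrite ?(mul0mx, mulmx1, mul1mx, mulmx0, addr0, add0r).
rewrite -block_mxEh !(add_row_mx, add_col_mx) -block_mxEv.
rewrite !(addr0, add0r) -!scalemxAl -!scalemxAr !scalerA !mulrNN ?mulNr ?mulrN.
rewrite bs bs' -sE !mulVmx// -!mulmxA mulVmx// mulmx1 ?opprK ?bs.
rewrite scaleNr subrr row_mx0 scaleNr subrr col_mx0.
rewrite /reduced_mx mulmxBr !mulmxA !scaleNr !scalerBr.
by rewrite addKr subrr !scalemx1 -!scalar_mx_block.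
Qed.

Lemma char_poly_cast (K : comNzRingType) m n (e : m = n) (M : 'M[K]_m) :
  char_poly (castmx (e, e) M) = char_poly M.
Proof. by case: _ / e. Qed.

Lemma pencil_cvg (T : Type) (F : set_system T) (FF : Filter F)
    (al be : T -> R) (al0 be0 : R) :
  al t @[t --> F] --> al0 -> be t @[t --> F] --> be0 ->
  mx_cvg F (fun t => pencil_mx (al t) (be t)) (pencil_mx al0 be0).
Proof.
move=> hal hbe; have cst := @mx_cvg_cst R T F FF.
have hal' : - al t @[t --> F] --> - al0 by exact: cvgN.
apply: mx_cvg_block; first exact: mx_cvgZ hal' (cst _ _ _).
- exact: mx_cvg_row (mx_cvgZ hal' (cst _ _ _)) (cst _ _ _).
- exact: mx_cvg_col (mx_cvgZ hal' (cst _ _ _)) (cst _ _ _).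
- exact: mx_cvg_block (mx_cvgZ hal' (cst _ _ _)) (mx_cvgZ hbe (cst _ _ _))
    (cst _ _ _) (cst _ _ _).
Qed.

Lemma copencil_cvg (T : Type) (F : set_system T) (FF : Filter F)
    (a b c : T -> R) (a0 b0 c0 : R) :
  a t @[t --> F] --> a0 -> b t @[t --> F] --> b0 -> c t @[t --> F] --> c0 ->
  mx_cvg F (fun t => copencil_mx (a t) (b t) (c t) 1) (copencil_mx a0 b0 c0 1).
Proof.
move=> ha hb hc; have cst := @mx_cvg_cst R T F FF.
have hb1 : b t / 1 @[t --> F] --> b0 / 1.
  by under eq_fun do rewrite divr1; rewrite divr1.
have ha' : - a t @[t --> F] --> - a0 by exact: cvgN.
have hb' : - (b t / 1) @[t --> F] --> - (b0 / 1) by exact: cvgN.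
apply: mx_cvg_block; first exact: mx_cvgZ ha' (cst _ _ _).
- exact: mx_cvg_row (cst _ _ _) (cst _ _ _).
- exact: mx_cvg_col (cst _ _ _) (mx_cvgZ hb' (cst _ _ _)).
- exact: mx_cvg_block (cst _ _ _) (cst _ _ _) (mx_cvgZ hb1 (cst _ _ _))
    (mx_cvgZ hc (cst _ _ _)).
Qed.

Hypothesis A11_real : forall z, eigenvalue (cmx A11) z -> complex.Im z = 0.
Hypothesis A_real : forall z, eigenvalue (cmx A) z -> complex.Im z = 0.
Hypothesis A_unit : A \in unitmx.
Hypothesis B_pos : forall z, eigenvalue (cmx B) z -> 0 < complex.Re z.
Hypothesis dissip : forall (eta : R) (z : C), eta != 0 ->
  eigenvalue ('i%C *: cmx (eta *: A) + cmx (eta ^+ 2 *: Bfull)) z ->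
  0 < complex.Re z.

Lemma Re0_imag (z : C) : complex.Re z = 0 -> z = 'i%C * (complex.Im z)%:C%C.
Proof.
by move=> z0; rewrite {1}[z]complexE z0 raddf0 add0r.
Qed.

Lemma mulmx_Bfull n (x : 'M[C]_(n1 + n2, n)) :
  cmx Bfull *m x = col_mx 0 (cmx B *m dsubmx x).
Proof.
rewrite -{1}(vsubmxK x) /cmx map_block_mx !map_mx0 mul_block_col.
by rewrite !mul0mx !add0r.
Qed.

(** An eigenvector of G for i eta is the second block of some x with A x = i eta B x. Then i eta A +
    eta^2 B annihilates x, against dissipativity; for eta = 0 it is A that would annihilate x. *)
Lemma reduced_hyperbolic z : eigenvalue (cmx G) z -> complex.Re z != 0.
Proof.
move=> /eigenvalue_col[v v0 Gv]; apply/eqP => /Re0_imag.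
set eta := complex.Im z => zE.
pose x : 'cV[C]_(n1 + n2) :=
  col_mx (- (cmx (invmx A11 *m A12) *m v)) v.
have BG : B *m G = A22 - A21 *m invmx A11 *m A12 by rewrite mulKVmx.
have Ax : cmx A *m x = col_mx 0 (cmx (B *m G) *m v).
  rewrite -{1}(submxK A) /x /cmx map_block_mx mul_block_col BG !mulmxN.
  rewrite !mulmxA -!map_mxM !mulmxA mulmxV// mul1mx addNr.
  by rewrite addrC -mulmxBl -map_mxB.
have x0 : x != 0.
  by apply: contra v0 => /eqP; rewrite /x -col_mx0 => /eq_col_mx[_ ->].
have Ax' : cmx A *m x = z *: (cmx Bfull *m x).
  rewrite Ax mulmx_Bfull /x col_mxKd /cmx map_mxM -mulmxA [X in _ *m X]Gv.
  by rewrite -scalemxAr scale_col_mx scaler0.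
have [eta0|eta0] := eqVneq eta 0.
  move: Ax'; rewrite zE eta0 mulr0 scale0r => /(congr1 (mulmx (invmx (cmx A)))).
  by rewrite mulmx0 mulKmx ?map_unitmx// => /eqP; rewrite (negbTE x0).
have := @dissip eta 0 eta0; rewrite ltxx => /(_ _)/negP; case => //.
apply/eigenvalue_col; exists x => //.
rewrite scale0r mulmxDl -scalemxAl /cmx !map_mxZ -!scalemxAl Ax' zE !scalerA.
rewrite -scalerDl [X in X *: _](_ : _ = 0) ?scale0r//.
by rewrite rmorphXn mulrACA -expr2 sqr_i mulN1r -expr2 addNr.
Qed.

(** In terms of r = la / s an eigenvalue s is a root of la + r A - r^2 B. If s = i eta, then r = i
    xi with xi = - la / eta, and - la < 0 is an eigenvalue of i xi A + xi^2 B, against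
    dissipativity. The value s = 0 is excluded by the invertibility of [A11] and B. *)
Lemma pencil_hyperbolic (la : R) z : 0 < la ->
  eigenvalue (cmx (pencil_mx 1 la)) z -> complex.Re z != 0.
Proof.
move=> la0 /eigenvalue_col[v v0 Pv]; apply/eqP => /Re0_imag.
set eta := complex.Im z => zE.
pose x1 := usubmx v; pose x2 := usubmx (dsubmx v); pose y := dsubmx (dsubmx v).
have vE : v = col_mx x1 (col_mx x2 y) by rewrite !vsubmxK.
move: Pv; rewrite vE /cmx /pencil_mx !map_block_mx map_row_mx map_col_mx.
rewrite !map_mx0 map_mx1 !mul_block_col mul_row_col mul_col_mx !mul0mx mul1mx !addr0.
rewrite add_col_mx add0r !scale_col_mx => /eq_col_mx[e1 /eq_col_mx[e2 e3]].
pose x : 'cV[C]_(n1 + n2) := col_mx x1 x2.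
have Ax : cmx A *m x =
    col_mx (- z *: x1) (la%:C%C *: (cmx B *m y) - z *: x2).
  rewrite -{1}(submxK A) /x /cmx map_block_mx mul_block_col.
  move: e1 e2; rewrite !scaleN1r !map_mxN !mulNmx map_mxZ -scalemxAl scaleNr => <- <-.
  rewrite !opprD !opprK; congr col_mx.
  by rewrite [RHS]addrC -!addrA addNr addr0.
have Bx : cmx Bfull *m x = col_mx 0 (z *: (cmx B *m y)).
  by rewrite mulmx_Bfull /x col_mxKd e3 scalemxAr.
have zAx : z *: (cmx A *m x) = - z ^+ 2 *: x + la%:C%C *: (cmx Bfull *m x).
  rewrite Ax Bx /x !scale_col_mx add_col_mx scaler0 addr0; congr col_mx.
    by rewrite scalerA mulrN -expr2.
  by rewrite scalerBr !scalerA -expr2 addrC scaleNr (mulrC z).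
have yx : x = 0 -> y = 0.
  move=> xz; have := Ax; rewrite xz mulmx0 => /esym/eqP.
  rewrite -col_mx0 => /eqP/eq_col_mx[_].
  have -> : x2 = 0 by move: xz; rewrite /x -col_mx0 => /eq_col_mx[].
  rewrite scaler0 subr0 => /eqP; rewrite scaler_eq0 eq_complex /= gt_eqF//=.
  move=> /eqP/(congr1 (mulmx (invmx (cmx B)))).
  by rewrite mulmx0 mulKmx ?map_unitmx.
have x0 : x != 0.
  apply: contra v0 => /eqP xz; rewrite vE (yx xz).
  by move: xz; rewrite /x -col_mx0 => /eq_col_mx[-> ->]; rewrite !col_mx0.
have [eta0|eta0] := eqVneq eta 0.
  have z0 : z = 0 by rewrite zE eta0 mulr0.
  move/eqP: x0; apply.
  have x20 : x2 = 0 by rewrite e3 z0 scale0r.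
  move: Ax; rewrite z0 oppr0 !scale0r subr0 => Ax.
  have : cmx A11 *m x1 = 0.
    move: Ax; rewrite -{1}(submxK A) /x /cmx map_block_mx mul_block_col.
    by rewrite x20 !mulmx0 !addr0 => /eq_col_mx[].
  move=> /(congr1 (mulmx (invmx (cmx A11)))).
  by rewrite mulmx0 mulKmx ?map_unitmx// /x x20 => ->; rewrite col_mx0.
have z0 : z != 0.
  by rewrite zE mulf_neq0// eq_complex /= ?oner_eq0 ?andbF// (negbTE eta0).
have xi0 : - la / eta != 0 by rewrite mulf_neq0 ?invr_eq0// oppr_eq0 gt_eqF.
have := @dissip (- la / eta) (- la)%:C%C xi0 => /(_ _)/=.
suff h : eigenvalue ('i%C *: cmx ((- la / eta) *: A) +
    cmx ((- la / eta) ^+ 2 *: Bfull)) (- la)%:C%C.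
  by move=> /(_ h); rewrite oppr_gt0 ltNge ltW.
apply/eigenvalue_col; exists x => //.
have i0 : 'i%C != 0 :> C by rewrite eq_complex /= oner_eq0 andbF.
have etaC : eta%:C%C != 0 :> C by rewrite eq_complex /= (negbTE eta0).
have ii : 'i%C * 'i%C = -1 :> C by exact: sqr_i.
have iV : ('i%C : C)^-1 = - 'i%C.
  by apply: (mulfI i0); rewrite divff// mulrN ii opprK.
have c1 : 'i%C * (- la / eta)%:C%C = la%:C%C / z ^+ 2 * z.
  have -> : la%:C%C / z ^+ 2 * z = la%:C%C / z by field.
  rewrite zE invfM iV rmorphM fmorphV rmorphN /=; ring.
have c2 : ((- la / eta) ^+ 2)%:C%C = - (la%:C%C / z ^+ 2 * la%:C%C).
  have -> : z ^+ 2 = - eta%:C%C ^+ 2 by rewrite zE exprMn sqr_i mulN1r.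
  rewrite rmorphXn rmorphM fmorphV rmorphN /=.
  by field.
rewrite mulmxDl -scalemxAl /cmx !map_mxZ -!scalemxAl !scalerA.
rewrite [X in X *: _ + _]c1 [X in _ + X *: _]c2.
rewrite -scalerA zAx scalerDr !scalerA scaleNr addrK mulrN divfK ?expf_neq0//.
by rewrite rmorphN.
Qed.

End IndexFormula.

(** * The index formula, by homotopy in the spectral parameter *)

Section IndexCount.
Variables (R : realType) (n1 n2 : nat).
Variables (A : 'M[R]_(n1 + n2)) (B : 'M[R]_n2).
Local Notation C := R[i].
Local Notation A11 := (ulsubmx A).
Local Notation G := (reduced_mx A B).
Local Notation Bfull := (block_mx 0 0 0 B : 'M[R]_(n1 + n2)).
Local Notation pencil := (pencil_mx A B).
Local Notation copencil := (copencil_mx A B).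

Hypothesis A11_unit : A11 \in unitmx.
Hypothesis B_unit : B \in unitmx.
Hypothesis A11_real : forall z, eigenvalue (cmx A11) z -> complex.Im z = 0.
Hypothesis A_real : forall z, eigenvalue (cmx A) z -> complex.Im z = 0.
Hypothesis A_unit : A \in unitmx.
Hypothesis B_pos : forall z, eigenvalue (cmx B) z -> 0 < complex.Re z.
Hypothesis dissip : forall (eta : R) (z : C), eta != 0 ->
  eigenvalue ('i%C *: cmx (eta *: A) + cmx (eta ^+ 2 *: Bfull)) z ->
  0 < complex.Re z.

Lemma eigenvalue_neq0 n (M : 'M[R]_n) z :
  M \in unitmx -> eigenvalue (cmx M) z -> z != 0.
Proof.
move=> uM /eigenvalueP[v vM v0]; apply: contraNneq v0 => z0.
move: vM; rewrite z0 scale0r => /(congr1 (mulmx^~ (invmx (cmx M)))).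
by rewrite mul0mx mulmxK ?map_unitmx// => ->.
Qed.

Lemma num_pos_right n (M : 'M[R]_n) :
  (forall z, eigenvalue (cmx M) z -> complex.Im z = 0) ->
  num_pos M = num_eig (@right_half R) (cmx M).
Proof.
move=> h; apply: eq_in_count => z; rewrite mem_eigvals => /h z0.
by rewrite /right_half /= ltcE /= z0 eqxx.
Qed.

Lemma left_half_opp n (M : 'M[C]_n) :
  num_eig (@left_half R) (-1 *: M) = num_eig (@right_half R) M.
Proof.
rewrite num_eig_scale ?oppr_eq0 ?oner_eq0//; apply: eq_count => z.
by rewrite /left_half /right_half /= mulN1r raddfN oppr_lt0.
Qed.

Lemma right_half_opp n (M : 'M[C]_n) :
  num_eig (@right_half R) (-1 *: M) = num_eig (@left_half R) M.
Proof.
rewrite num_eig_scale ?oppr_eq0 ?oner_eq0//; apply: eq_count => z.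
by rewrite /left_half /right_half /= mulN1r raddfN oppr_gt0.
Qed.

Lemma num_eig_pencil10 (p : pred C) : ~~ p 0 ->
  num_eig p (cmx (pencil 1 0)) = num_eig p (-1 *: cmx A).
Proof.
move=> p0; rewrite /pencil_mx block_mxA.
rewrite -!scale_block_mx submxK scale0r col_mx0 /cmx map_castmx.
rewrite (@num_eig_mul _ _ _ _ _ _ (-1 *: cmx A) (0 : 'M[C]_n2)).
  by rewrite num_eig0// addn0.
rewrite char_poly_cast map_block_mx map_mx0 char_poly_lblock map_mx0.
by rewrite /cmx map_mxZ rmorphN1.
Qed.

Lemma num_eig_pencil01 (p : pred C) : ~~ p 0 ->
  num_eig p (cmx (pencil 0 1)) = num_eig p (cmx (block_mx 0 B 1%:M 0)).
Proof.
move=> p0; rewrite /pencil_mx oppr0 !scale0r scale1r row_mx0 col_mx0.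
rewrite (@num_eig_mul _ _ _ _ _ _ (0 : 'M[C]_n1) (cmx (block_mx 0 B 1%:M 0))).
  by rewrite num_eig0.
by rewrite /cmx map_block_mx !map_mx0 char_poly_ublock.
Qed.

Lemma num_eig_copencil0 (p : pred C) : ~~ p 0 ->
  num_eig p (cmx (copencil 0 0 1 1)) = num_eig p (cmx G).
Proof.
move=> p0; rewrite /copencil_mx oppr0 mul0r oppr0 !scale0r scale1r col_mx0.
rewrite (@num_eig_mul _ _ _ _ _ _ (0 : 'M[C]_n1) (cmx (block_mx 0 1%:M 0 G))).
  rewrite num_eig0// add0n (@num_eig_mul _ _ _ _ _ _ (0 : 'M[C]_n2) (cmx G)).
    by rewrite num_eig0.
  by rewrite /cmx map_block_mx !map_mx0 char_poly_ublock.
by rewrite /cmx map_block_mx !map_mx0 char_poly_ublock.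
Qed.

Lemma num_eig_copencil1 (p : pred C) : ~~ p 0 ->
  num_eig p (cmx (copencil 1 0 0 1)) = num_eig p (-1 *: cmx (invmx A11)).
Proof.
move=> p0; rewrite /copencil_mx mul0r oppr0 !scale0r col_mx0.
rewrite (@num_eig_mul _ _ _ _ _ _ (-1 *: cmx (invmx A11)) (cmx (block_mx (0 : 'M[R]_n2) 1%:M 0 (0 : 'M[R]_n2)))).
  rewrite (@num_eig_mul _ _ _ _ p (cmx (block_mx _ _ _ _)) (0 : 'M[C]_n2) (0 : 'M[C]_n2)).
    by rewrite num_eig0// !addn0.
  by rewrite /cmx map_block_mx !map_mx0 char_poly_ublock.
rewrite /cmx map_block_mx !map_mx0 char_poly_ublock; congr (char_poly _ * _).
by rewrite map_mxZ rmorphN1.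
Qed.

(** The eigenvalues are the square roots of those of B: they come in opposite pairs and are not
    imaginary, B having its spectrum in the right half-plane. *)
Lemma num_left_block0 :
  num_eig (@left_half R) (cmx (block_mx 0 B 1%:M 0)) = n2 /\
  num_eig (@right_half R) (cmx (block_mx 0 B 1%:M 0)) = n2.
Proof.
set Q := block_mx _ _ _ _.
have sym : num_eig (@left_half R) (cmx Q) = num_eig (@right_half R) (cmx Q).
  rewrite -left_half_opp; pose D : 'M[R]_(n2 + n2) := block_mx 1%:M 0 0 (-1)%:M.
  apply: (@num_eig_sim _ _ _ (cmx D)).
    by rewrite map_unitmx unitmxE det_ublock det1 mul1r det_scalar unitfE expf_neq0// oppr_eq0 oner_eq0.
  rewrite -[-1]/(-1%:C%C) -rmorphN -map_mxZ -!map_mxM; congr map_mx.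
  rewrite /D /Q -scalemxAr !mulmx_block scale_block_mx.
  rewrite !(mul0mx, mulmx0, mul1mx, mulmx1, addr0, add0r, scaler0).
  by rewrite mul_mx_scalar !scaleN1r raddfN opprK.
have : (num_eig (@left_half R) (cmx Q) + num_eig (@right_half R) (cmx Q))%N = (n2 + n2)%N.
  apply: num_left_right => z /eigenvalue_col[v v0 Qv]; apply/eqP => /Re0_imag zE.
  pose x := usubmx v; pose y := dsubmx v.
  have vE : v = col_mx x y by rewrite vsubmxK.
  move: Qv; rewrite vE /cmx /Q map_block_mx !map_mx0 map_mx1 mul_block_col.
  rewrite !mul0mx mul1mx add0r addr0 scale_col_mx => /eq_col_mx[e1 e2].
  have y0 : y != 0.
    by apply: contra v0 => /eqP y0; rewrite vE e2 y0 scaler0 col_mx0.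
  have /B_pos : eigenvalue (cmx B) (z ^+ 2).
    by apply/eigenvalue_col; exists y => //; rewrite e1 e2 scalerA expr2.
  rewrite zE exprMn sqr_i mulN1r -rmorphXn -rmorphN /=.
  by rewrite oppr_gt0 ltNge sqr_ge0.
rewrite sym; lia.
Qed.

Lemma half_not0 : ~~ left_half (0 : C) /\ ~~ right_half (0 : C).
Proof. by rewrite /left_half /right_half /= !ltxx. Qed.

(* The two lower bounds add up to the full number of eigenvalues. *)
Lemma two_scale_left (T : Type) (F : set_system T) (FF : Filter F) n
    (s : T -> R) (S Z : T -> 'M[R]_n) (S0 Z0 : 'M[R]_n) :
  (\forall t \near F, 0 < s t) -> s t @[t --> F] --> 0 ->
  mx_cvg F S S0 -> mx_cvg F Z Z0 ->
  (\forall t \near F, exists2 U, U \in unitmx &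
     exists2 Z', Z t *m U = U *m Z' & Z' *m S t = (s t)%:M) ->
  (num_eig (@left_half R) (cmx S0) + num_eig (@right_half R) (cmx S0) +
   (num_eig (@left_half R) (cmx Z0) + num_eig (@right_half R) (cmx Z0)) = n)%N ->
  (\forall t \near F, forall z, eigenvalue (cmx (S t)) z -> complex.Re z != 0) ->
  \forall t \near F, num_eig (@left_half R) (cmx (S t)) =
    (num_eig (@left_half R) (cmx S0) + num_eig (@left_half R) (cmx Z0))%N.
Proof.
move=> s0 scvg hS hZ hSZ tot hyp.
have [l0 r0] := half_not0.
have hl := two_scale_lsc FF (@open_left_half R) l0 (@left_half_div R) s0 scvg hS hZ hSZ.
have hr := two_scale_lsc FF (@open_right_half R) r0 (@right_half_div R) s0 scvg hS hZ hSZ.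
near=> t.
have /num_left_right e : forall z, eigenvalue (cmx (S t)) z -> complex.Re z != 0.
  by near: t.
have : (num_eig (@left_half R) (cmx S0) + num_eig (@left_half R) (cmx Z0)
   <= num_eig (@left_half R) (cmx (S t)))%N by near: t.
have : (num_eig (@right_half R) (cmx S0) + num_eig (@right_half R) (cmx Z0)
   <= num_eig (@right_half R) (cmx (S t)))%N by near: t.
move: e tot; set a := num_eig _ _; set b := num_eig _ _; set c := num_eig _ _.
set d := num_eig _ _; set e := num_eig _ _; set f := num_eig _ _.
by move=> *; lia.
Unshelve. all: by end_near. Qed.

(** As la tends to 0 the eigenvalues of order 1 approach those of -A, and those of order la behave
    like la divided by the eigenvalues of G. *)
Lemma pencil_left_near0 : \forall la \near 0^'+,
  num_eig (@left_half R) (cmx (pencil 1 la)) = (num_pos A + num_Re_neg G)%N.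
Proof.
have [l0 r0] := half_not0.
have id0 : (la : R) @[la --> 0^'+] --> (0 : R).
  by apply: cvg_at_right_filter; exact: cvg_id.
have sp : \forall la \near (0 : R)^'+, 0 < la by exact: nbhs_right_gt.
have lA : num_eig (@left_half R) (cmx (pencil 1 0)) = num_pos A.
  by rewrite num_eig_pencil10// left_half_opp num_pos_right.
have rA : num_eig (@right_half R) (cmx (pencil 1 0)) = num_eig (@left_half R) (cmx A).
  by rewrite num_eig_pencil10// right_half_opp.
rewrite -lA -[num_Re_neg G]/(num_eig (@left_half R) (cmx G)) -(num_eig_copencil0 l0).
apply: (@two_scale_left _ _ _ _ (fun la => la) _ (fun la => copencil la la 1 1)).
- exact: sp.
- exact: id0.
- apply: pencil_cvg; [exact: cvg_cst|exact: id0].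
- apply: copencil_cvg; [exact: id0|exact: id0|exact: cvg_cst].
- near=> la; have la0 : 0 < la by near: la.
  have [U uU e] := copencil_sim A B la la 1 (lt0r_neq0 la0).
  exists U; first exact: uU.
  exists (copencil la la 1 la); first exact: e.
  by apply: (copencilK A11_unit B_unit (lt0r_neq0 la0));
    rewrite ?mulr1 ?mul1r ?expr2.
- rewrite lA rA num_pos_right// [X in (X + _)%N]addnC num_left_right; last first.
    move=> z zA; have := eigenvalue_neq0 A_unit zA.
    by rewrite eq_complex /= (A_real zA) eqxx andbT.
  rewrite (num_eig_copencil0 l0) (num_eig_copencil0 r0).
  rewrite (num_left_right (fun z => @reduced_hyperbolic _ _ _ _ _ A11_unit B_unit A_unit dissip z)).
  by rewrite addnA.
- near=> la => z; apply: pencil_hyperbolic => //; by near: la.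
Unshelve. all: by end_near. Qed.

(** With la = tau^-2, this replaces the limit of infinite la by that of tau tending to 0. *)
Lemma pencil_rescale (tau : R) : tau != 0 ->
  exists2 U, U \in unitmx & (tau *: pencil 1 (tau ^- 2)) *m U = U *m pencil tau 1.
Proof.
move=> t0; exists (block_mx 1%:M 0 0 (block_mx 1%:M 0 0 tau%:M)).
  by rewrite unitmxE !det_ublock !det1 !mul1r det_scalar unitfE expf_neq0.
rewrite /pencil_mx scale_block_mx scale_row_mx scale_col_mx scale_block_mx.
rewrite !mulmx_block !(mul_row_block, mul_block_col, mulmx0).
rewrite !(mul0mx, mulmx1, mul1mx, mulmx0, addr0, add0r, scaler0).
rewrite !mul_mx_scalar !scalerA !mulrN1 scale1r scalemx1.
by rewrite mulrA -expr2 mulfV ?expf_neq0// scale1r.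
Qed.

Lemma left_half_mul (c : R) (z : C) : 0 < c ->
  left_half (c%:C%C * z) = left_half z.
Proof. by move=> c0; rewrite /left_half inE complex_ReMr pmulr_rlt0. Qed.

Lemma pencil_rescale_left (tau : R) : 0 < tau ->
  num_eig (@left_half R) (cmx (pencil tau 1)) =
  num_eig (@left_half R) (cmx (pencil 1 (tau ^- 2))).
Proof.
move=> t0; have [U uU e] := pencil_rescale (lt0r_neq0 t0).
rewrite -(@num_eig_sim _ _ _ (cmx U) (cmx (tau *: pencil 1 (tau ^- 2)))).
- rewrite /cmx map_mxZ num_eig_scale ?eq_complex /= ?(gt_eqF t0)//.
  apply: eq_count => z; exact: left_half_mul.
- by rewrite map_unitmx.
- by rewrite /cmx -!map_mxM e.
Qed.

Lemma pencil_rescale_hyperbolic (tau : R) z : 0 < tau ->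
  eigenvalue (cmx (pencil tau 1)) z -> complex.Re z != 0.
Proof.
move=> t0; have [U uU e] := pencil_rescale (lt0r_neq0 t0).
rewrite eigenvalue_root_char.
rewrite -(@char_poly_sim _ _ (cmx U) (cmx (tau *: pencil 1 (tau ^- 2)))).
- rewrite -eigenvalue_root_char => /eigenvalueP[v vM v0].
  have ti : (tau^-1)%:C%C * tau%:C%C = 1 :> C by rewrite -rmorphM mulVf ?gt_eqF.
  have /pencil_hyperbolic : eigenvalue (cmx (pencil 1 (tau ^- 2))) ((tau^-1)%:C%C * z).
    apply/eigenvalueP; exists v => //.
    by rewrite -scalerA -vM /cmx map_mxZ -scalemxAr scalerA ti scale1r.
  move=> /(_ A11_unit B_unit dissip); rewrite invr_gt0 exprn_gt0// => /(_ isT).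
  by rewrite complex_ReMr mulf_eq0 negb_or => /andP[].
- by rewrite map_unitmx.
- by rewrite /cmx -!map_mxM e.
Qed.

(** As tau tends to 0 the eigenvalues of order 1 approach the square roots of those of B, [n2] of
    them on the left. Those of order tau behave like - tau times the eigenvalues of [A11]. *)
Lemma pencil_left_nearoo : \forall tau \near 0^'+,
  num_eig (@left_half R) (cmx (pencil tau 1)) = (n2 + num_pos A11)%N.
Proof.
have [l0 r0] := half_not0.
have id0 : (la : R) @[la --> 0^'+] --> (0 : R).
  by apply: cvg_at_right_filter; exact: cvg_id.
have sq0 : (la : R) ^+ 2 @[la --> 0^'+] --> (0 : R).
  by rewrite -[0 in X in _ --> X](mul0r 0); under eq_fun do rewrite expr2; exact: cvgM.
have sp : \forall la \near (0 : R)^'+, 0 < la by exact: nbhs_right_gt.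
have [lB rB] := num_left_block0.
have inv_eig p : (forall (c : R) z, 0 < c -> z != 0 -> p (c%:C%C / z) = p z) ->
    num_eig p (cmx (invmx A11)) = num_eig p (cmx A11).
  move=> hp; have c0 : 1%:C%C != 0 :> C by rewrite eq_complex /= oner_eq0.
  have e : cmx A11 *m cmx (invmx A11) = (1%:C%C)%:M.
    by rewrite /cmx -map_mxM mulmxV// map_mx1.
  rewrite num_eigE (permP (eigvals_inv c0 e)) count_map num_eigE.
  apply: eq_in_count => z; rewrite mem_eigvals => zA /=; apply: hp => //.
  exact: eigenvalue_neq0 zA.
have lI := inv_eig _ (@left_half_div R).
have rI := inv_eig _ (@right_half_div R).
have -> : (n2 + num_pos A11)%N =
    (num_eig (@left_half R) (cmx (pencil 0 1)) +
     num_eig (@left_half R) (cmx (copencil 1 0 0 1)))%N.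
  by rewrite (num_eig_pencil01 l0) lB (num_eig_copencil1 l0) left_half_opp rI num_pos_right.
apply: (@two_scale_left _ _ _ _ (fun la => la) _ (fun la => copencil 1 (la ^+ 2) (la ^+ 2) 1)).
- exact: sp.
- exact: id0.
- apply: pencil_cvg; [exact: id0|exact: cvg_cst].
- apply: copencil_cvg; [exact: cvg_cst|exact: sq0|exact: sq0].
- near=> la; have la0 : 0 < la by near: la.
  have [U uU e] := copencil_sim A B 1 (la ^+ 2) (la ^+ 2) (lt0r_neq0 la0).
  exists U; first exact: uU.
  exists (copencil 1 (la ^+ 2) (la ^+ 2) la); first exact: e.
  by apply: (copencilK A11_unit B_unit (lt0r_neq0 la0)); rewrite ?mulr1 ?mul1r.
- rewrite (num_eig_pencil01 l0) (num_eig_pencil01 r0) lB rB.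
  rewrite (num_eig_copencil1 l0) (num_eig_copencil1 r0) left_half_opp right_half_opp.
  rewrite lI rI [X in (_ + X)%N]addnC num_left_right; first by rewrite addnC.
  move=> z zA; have := eigenvalue_neq0 A11_unit zA.
  by rewrite eq_complex /= (A11_real zA) eqxx andbT.
- by near=> la => z; apply: pencil_rescale_hyperbolic; near: la.
Unshelve. all: by end_near. Qed.

(** Both half-plane counts are lower semicontinuous, and their sum is the size of the pencil. *)
Lemma pencil_left_locally_cst (la0 : R) : 0 < la0 ->
  \forall la \near la0, num_eig (@left_half R) (cmx (pencil 1 la)) =
    num_eig (@left_half R) (cmx (pencil 1 la0)).
Proof.
move=> la00.
have cv : mx_cvg (nbhs la0) (fun la => pencil 1 la) (pencil 1 la0).
  by apply: pencil_cvg; [exact: cvg_cst|exact: cvg_id].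
have hl : \forall la \near la0, (num_eig (@left_half R) (cmx (pencil 1 la0)) <=
    num_eig (@left_half R) (cmx (pencil 1 la)))%N.
  exact: num_eig_lsc (@open_left_half R) cv.
have hr : \forall la \near la0, (num_eig (@right_half R) (cmx (pencil 1 la0)) <=
    num_eig (@right_half R) (cmx (pencil 1 la)))%N.
  exact: num_eig_lsc (@open_right_half R) cv.
have tot la : 0 < la -> (num_eig (@left_half R) (cmx (pencil 1 la)) +
    num_eig (@right_half R) (cmx (pencil 1 la)) = n1 + (n2 + n2))%N.
  by move=> la1; apply: num_left_right => z; exact: pencil_hyperbolic.
near=> la.
have := tot la0 la00; have /tot : 0 < la by near: la; exact: lt_nbhsr.
have : (num_eig (@left_half R) (cmx (pencil 1 la0)) <=
        num_eig (@left_half R) (cmx (pencil 1 la)))%N by near: la.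
have : (num_eig (@right_half R) (cmx (pencil 1 la0)) <=
        num_eig (@right_half R) (cmx (pencil 1 la)))%N by near: la.
set a := num_eig _ _; set b := num_eig _ _; set c := num_eig _ _.
set d := num_eig _ _.
by move=> *; lia.
Unshelve. all: by end_near. Qed.

Lemma locally_cst_pos (L : R -> nat) :
  (forall la0 : R, 0 < la0 -> \forall la \near la0, L la = L la0) ->
  forall a b : R, 0 < a -> 0 < b -> L a = L b.
Proof.
move=> loc a b a0 b0; pose P := [set la : R | 0 < la].
have opL (k : nat -> Prop) : open [set la | P la /\ k (L la)].
  rewrite openE => la [la0 kL]; near=> x; split; first by near: x; exact: lt_nbhsr.
  have Lx : L x = L la by near: x; exact: loc.
  by rewrite Lx.
have cP : connected P.
  apply/connected_intervalP => x y Px Py z /andP[xz _]; exact: lt_le_trans Px xz.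
have : [set la | P la /\ L la = L a] = P.
  apply: cP; first by exists a.
    exists [set la | P la /\ L la = L a]; first exact: (opL (fun k => k = L a)).
    by apply/seteqP; split=> x //= -[].
  exists (~` [set la | P la /\ L la <> L a]).
    by apply: open_closedC; exact: (opL (fun k => k <> L a)).
  apply/seteqP; split=> [x [Px Lx]|x [Px /not_andP[//|/contrapT Lx]]]; split=> //.
  by move=> [].
by move=> /seteqP[_ /(_ b b0)[_]].
Unshelve. all: by end_near. Qed.

(** Both sides count the roots r with Re r < 0 of la + r A - r^2 B, for la small and for la large
    respectively. *)
Lemma index_formula :
  (num_pos A + num_Re_neg G)%N = (n2 + num_pos A11)%N.
Proof.
have [a [a0 ea]] : exists a : R, 0 < a /\
    num_eig (@left_half R) (cmx (pencil 1 a)) = (num_pos A + num_Re_neg G)%N.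
  apply: (@filter_ex _ (0 : R)^'+ _).
  by apply: filterI; [exact: nbhs_right_gt|exact: pencil_left_near0].
have [b [b0 eb]] : exists b : R, 0 < b /\
    num_eig (@left_half R) (cmx (pencil b 1)) = (n2 + num_pos A11)%N.
  apply: (@filter_ex _ (0 : R)^'+ _).
  by apply: filterI; [exact: nbhs_right_gt|exact: pencil_left_nearoo].
rewrite -ea -eb (pencil_rescale_left b0).
apply: (locally_cst_pos pencil_left_locally_cst a0).
by rewrite invr_gt0 exprn_gt0.
Qed.

End IndexCount.

(** * Lyapunov forms for a spectrum in the right half-plane *)

Section Lyapunov.
Variable R : realType.
Local Notation C := R[i].

Definition dotv n (u v : 'cV[R]_n) : R := \sum_i u i 0 * v i 0.
Definition sqv n (u : 'cV[R]_n) : R := dotv u u.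

Local Notation sqC z := (complex.Re z ^+ 2 + complex.Im z ^+ 2).

Lemma Re_conjM (a c : C) : complex.Re (a^*%C * c) =
  complex.Re a * complex.Re c + complex.Im a * complex.Im c.
Proof. by case: a => a1 a2; case: c => c1 c2 /=; rewrite mulNr opprK. Qed.

Lemma sqC_mul (a c : C) : sqC (a * c) = sqC a * sqC c.
Proof. by case: a => a1 a2; case: c => c1 c2 /=; ring. Qed.

Lemma Re_conj_bound (eta : R) (a s b : C) : 0 < eta -> sqC s <= eta ^+ 2 ->
  - (eta * (sqC a + sqC b) / 2) <= complex.Re (a^*%C * (s * b)).
Proof.
move=> eta0 hs; rewrite Re_conjM.
have : sqC (s * b) <= eta ^+ 2 * sqC b.
  by rewrite sqC_mul ler_wpM2r// addr_ge0// sqr_ge0.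
move: (s * b) => c hc.
set u := complex.Re a in hc *; set v := complex.Im a in hc *.
set p := complex.Re c in hc *; set q := complex.Im c in hc *.
set r := _ + _ in hc; set t := complex.Re b ^+ 2 + complex.Im b ^+ 2 in hc *.
have h : 0 <= (eta * u + p) ^+ 2 + (eta * v + q) ^+ 2.
  by rewrite addr_ge0// sqr_ge0.
have : 0 <= eta * (eta * (u ^+ 2 + v ^+ 2 + t) + 2 * (u * p + v * q)).
  by rewrite /r in hc; nra.
by rewrite pmulr_rge0// => ?; lra.
Qed.

Lemma sum_diag_defect n (N : 'I_n -> R) (tau eta : R) :
  \sum_i \sum_j ((i == j)%:R * (tau * N i) - eta * (N i + N j) / 2) =
  (tau - eta * n%:R) * \sum_i N i.
Proof.
have h i : \sum_j ((i == j)%:R * (tau * N i) - eta * (N i + N j) / 2) =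
    (tau - eta * n%:R / 2) * N i - eta / 2 * \sum_j N j.
  rewrite sumrB (bigD1 i)//= eqxx big1 ?addr0; last first.
    by move=> j /negbTE; rewrite eq_sym => ->; rewrite mul0r.
  rewrite -mulr_suml -mulr_sumr big_split /= sumr_const card_ord.
  by rewrite -mulr_natr; field.
rewrite (eq_bigr _ (fun i _ => h i)) sumrB -mulr_sumr sumr_const card_ord.
by rewrite -[X in _ - X]mulr_natr; field.
Qed.

(** Diagonal dominance: an off-diagonal term costs at most eta (|y_i|^2 + |y_j|^2) / 2 by Young's
    inequality, hence eta n |y|^2 in all. *)
Lemma accretive_trig n (S : 'M[C]_n) (y : 'cV[C]_n) (tau eta : R) : 0 < eta ->
  (forall i, tau <= complex.Re (S i i)) ->
  (forall i j, i != j -> sqC (S i j) <= eta ^+ 2) ->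
  (tau - eta * n%:R) * (\sum_i sqC (y i 0)) <=
  \sum_i complex.Re ((y i 0)^*%C * (S *m y) i 0).
Proof.
move=> eta0 hd ho.
have h1 i j : (i == j)%:R * (tau * sqC (y i 0)) -
    (eta * (sqC (y i 0) + sqC (y j 0)) / 2) <=
    complex.Re ((y i 0)^*%C * (S i j * y j 0)).
  have [<-|ij] := eqVneq i j; last first.
    by rewrite mul0r sub0r; apply: Re_conj_bound => //; exact: ho.
  rewrite mul1r Re_conjM.
  have := hd i; case: (S i i) => s1 s2 /= hs1; case: (y i 0) => y1 y2 /=.
  have : 0 <= (s1 - tau) * (y1 ^+ 2 + y2 ^+ 2).
    by rewrite mulr_ge0 ?subr_ge0// addr_ge0 ?sqr_ge0.
  have : 0 <= eta * (y1 ^+ 2 + y2 ^+ 2).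
    by rewrite mulr_ge0 ?(ltW eta0)// addr_ge0 ?sqr_ge0.
  by nra.
have h2 i : \sum_j ((i == j)%:R * (tau * sqC (y i 0)) -
    (eta * (sqC (y i 0) + sqC (y j 0)) / 2)) <=
    complex.Re ((y i 0)^*%C * (S *m y) i 0).
  rewrite mxE mulr_sumr raddf_sum /=.
  by apply: ler_sum => j _; exact: h1.
apply: le_trans (ler_sum _ (fun i _ => h2 i)).
rewrite (sum_diag_defect (fun i => sqC (y i 0))).
exact: lexx.
Qed.

(** Keeps the Lyapunov form real: on real x, the squared norm of [real_rep L *m x] is that of the
    complex vector L x. *)
Definition real_rep m n (L : 'M[C]_(m, n)) : 'M[R]_(m + m, n) :=
  col_mx (map_mx (@complex.Re R) L) (map_mx (@complex.Im R) L).

Lemma real_rep_mul m n (L : 'M[C]_(m, n)) (x : 'cV[R]_n) :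
  real_rep L *m x = col_mx (map_mx (@complex.Re R) (L *m cmx x))
                           (map_mx (@complex.Im R) (L *m cmx x)).
Proof.
rewrite mul_col_mx; congr col_mx; apply/matrixP => i j;
  rewrite !mxE raddf_sum; apply: eq_bigr => k _; rewrite !mxE /=;
  by case: (L i k) => a b /=; rewrite mulr0 ?subr0 ?add0r.
Qed.

Lemma real_rep_dot m n (L : 'M[C]_(m, n)) (x x' : 'cV[R]_n) :
  dotv (real_rep L *m x) (real_rep L *m x') =
  \sum_i complex.Re (((L *m cmx x) i 0)^*%C * (L *m cmx x') i 0).
Proof.
rewrite !real_rep_mul /dotv big_split_ord /= -big_split /=.
apply: eq_bigr => i _; rewrite Re_conjM !col_mxEu !col_mxEd.
have mE f (M : 'cV[C]_m) : map_mx f M i 0 = f (M i 0) :> R by rewrite mxE.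
by rewrite !mE.
Qed.

Lemma sqv_ge0 n (u : 'cV[R]_n) : 0 <= sqv u.
Proof. by apply: sumr_ge0 => i _; rewrite -expr2 sqr_ge0. Qed.

(* Schur triangularisation, followed by a diagonal scaling which makes the
   off-diagonal entries small compared with the diagonal. *)
Lemma lyapunov n (G : 'M[R]_n) :
  (forall z, eigenvalue (cmx G) z -> 0 < complex.Re z) ->
  exists m (L : 'M[R]_(m, n)) (theta : R), [/\ 0 < theta,
    forall x : 'cV_n, L *m x = 0 -> x = 0 &
    forall x : 'cV_n, theta * sqv (L *m x) <= dotv (L *m x) (L *m (G *m x))].
Proof.
move=> hG; case: n => [|n] in G hG *.
  exists 0%N, 0, 1; split=> // [x _|x]; first by apply/matrixP => -[].
  by rewrite /sqv /dotv !big_ord0 mulr0.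
have [P Pu Ptrig] := Schur (cmx G) isT.
have uP : P \in unitmx by exact: unitarymx_unit.
pose T := P *m cmx G *m invmx P.
have Tt : is_trig_mx T by move: Ptrig; rewrite /similar_to conjumx.
have PG : P *m cmx G = T *m P by rewrite mulmxKV.
have Tpos i : 0 < complex.Re (T i i).
  apply: hG; rewrite eigenvalue_root_char.
  have -> : char_poly (cmx G) = char_poly T.
    by symmetry; apply: (@char_poly_sim _ _ P).
  rewrite char_poly_trig// -(big_map (fun i => T i i) xpredT (fun a => 'X - a%:P)).
  by rewrite root_prod_XsubC; apply/mapP; exists i; rewrite ?mem_index_enum.
(* An explicit positive lower bound for the real parts of all the diagonal entries. *)
pose tau := (\sum_i (complex.Re (T i i))^-1)^-1.
have tau0 : 0 < tau.
  rewrite invr_gt0 (bigD1 ord0)//= ltr_pwDl ?invr_gt0//.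
  by apply: sumr_ge0 => i _; rewrite invr_ge0 ltW.
have tau_le i : tau <= complex.Re (T i i).
  rewrite -[leRHS]invrK lef_pV2 ?posrE ?invr_gt0//; last by rewrite -invr_gt0.
  rewrite (bigD1 i)//= lerDl.
  by apply: sumr_ge0 => j _; rewrite invr_ge0 ltW.
pose K := 1 + \sum_i \sum_j sqC (T i j).
have sqC_ge0 (z : C) : 0 <= sqC z :> R.
  by rewrite addr_ge0 ?sqr_ge0.
have K1 : 1 <= K by rewrite lerDl; do 2![apply: sumr_ge0 => ? _].
have TK i j : sqC (T i j) <= K.
  have le1 (f : 'I_n.+1 -> R) k : (forall l, 0 <= f l) -> f k <= \sum_l f l.
    by move=> f0; rewrite (bigD1 k)//= lerDl sumr_ge0.
  apply: le_trans (le1 (fun j => sqC (T i j)) j _) _ => //.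
  apply: le_trans (le1 (fun i => \sum_j sqC (T i j)) i _) _.
    by move=> k; exact: sumr_ge0.
  by rewrite lerDr.
(* The off-diagonal cost eta (n + 1) is at most tau / 2, which leaves the rate tau / 2. *)
pose eta := Num.min 1 (tau / (2 * n.+1%:R)).
have n0 : 0 < 2 * n.+1%:R :> R by rewrite mulr_gt0 ?ltr0n.
have eta0 : 0 < eta by rewrite lt_min ltr01 divr_gt0.
have eta1 : eta <= 1 by rewrite ge_min lexx.
have etan : eta * n.+1%:R <= tau / 2.
  apply: (@le_trans _ _ (tau / (2 * n.+1%:R) * n.+1%:R)).
    by rewrite ler_wpM2r ?ler0n// ge_min lexx orbT.
  by rewrite invfM mulrA mulfVK// pnatr_eq0.
pose delta := eta / K.
have K0 : 0 < K by exact: lt_le_trans K1.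
have delta0 : 0 < delta by rewrite divr_gt0.
have delta1 : delta <= 1.
  by rewrite ler_pdivrMr// mul1r; apply: le_trans K1.
have deltaK : delta ^+ 2 * K <= eta ^+ 2.
  rewrite expr_div_n -mulrA ler_piMr ?sqr_ge0// mulrC expr2 invfM mulrA.
  by rewrite divff ?gt_eqF// mul1r invf_le1.
(* Conjugation of the lower triangular T by diag (delta^i) multiplies the entry (i, j) by delta^(i -
   j), which is at most delta below the diagonal. *)
pose S : 'M[C]_n.+1 := \matrix_(i, j) ((delta ^+ i / delta ^+ j)%:C%C * T i j).
pose D : 'M[C]_n.+1 := diag_mx (\row_i (delta ^+ i)%:C%C).
have uD : D \in unitmx.
  rewrite unitmxE det_diag unitfE; apply/prodf_neq0 => i _.
  by rewrite mxE eq_complex /= eqxx andbT expf_neq0// gt_eqF.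
have SD : S *m D = D *m T.
  apply/matrixP => i j; rewrite mul_mx_diag mul_diag_mx !mxE.
  rewrite mulrAC -rmorphM /= divfK//.
  by rewrite expf_neq0// gt_eqF.
pose L := D *m P.
have uL : L \in unitmx by rewrite unitmx_mul uD.
have LG : L *m cmx G = S *m L.
  by rewrite /L -mulmxA PG (mulmxA D T) (mulmxA S) SD.
exists (n.+1 + n.+1)%N, (real_rep L), (tau / 2); split.
- by rewrite divr_gt0.
- move=> x; rewrite real_rep_mul -col_mx0 => /eq_col_mx[hr hi].
  have Lx : L *m cmx x = 0.
    apply/matrixP => i j; move/matrixP: hr => /(_ i j); move/matrixP: hi => /(_ i j).
    rewrite !mxE; set z := (X in complex.Im X) => him hre.
    by apply/eqP; rewrite eq_complex him hre !eqxx.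
  have : cmx x = 0 by rewrite -(mulKmx uL (cmx x)) Lx mulmx0.
  move=> /matrixP x0; apply/matrixP => i j; have := x0 i j.
  by rewrite !mxE => -[].
- move=> x; rewrite /sqv !real_rep_dot.
  have -> : L *m cmx (G *m x) = S *m (L *m cmx x).
    by rewrite [cmx (G *m x)]map_mxM (mulmxA L) LG -(mulmxA S).
  set y := L *m cmx x.
  apply: (@le_trans _ _ ((tau - eta * n.+1%:R) * (\sum_i sqC (y i 0))));
    last (apply: accretive_trig; first exact: eta0).
  + rewrite (eq_bigr (fun i => sqC (y i 0))); last first.
      by move=> i _; rewrite Re_conjM -!expr2.
    by rewrite ler_wpM2r ?sumr_ge0//; lra.
  + by move=> i; rewrite mxE divff ?expf_neq0 ?gt_eqF// mul1r.
  + move=> i j ij; rewrite mxE sqC_mul /= expr0n addr0.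
    have [lt_ij|lt_ji|/val_inj eij] := ltngtP i j; last by rewrite eij eqxx in ij.
      move/is_trig_mxP : Tt => ->//=; rewrite expr0n /= addr0 mulr0.
      by rewrite sqr_ge0.
    apply: le_trans deltaK; apply: ler_pM; rewrite ?sqr_ge0//.
    rewrite ler_pXn2r ?nnegrE ?divr_ge0 ?exprn_ge0 ?(ltW delta0)//.
    rewrite -(subnKC (ltnW lt_ji)) exprD mulrAC divff ?expf_neq0 ?gt_eqF// mul1r.
    rewrite -(prednK (n := i - j)) ?subn_gt0// exprS ler_piMr ?(ltW delta0)//.
    by rewrite exprn_ile1// ltW.
+ exact: ltW eta0.
+ exact: ltW K0.
Qed.

End Lyapunov.

(** * Exponential dichotomy of a hyperbolic matrix *)

Section Dichotomy.
Variable R : realType.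
Local Notation C := R[i].
Local Notation rc := (real_complex R).

(** The splitting is given by coordinates instead of subspaces: [projp *m b] and [projm *m b] are
    the expanding and contracting coordinates of b. The squared norms of their images under [formp]
    and [formm] are Lyapunov functions of b' = G b. *)
Record dichotomy n (G : 'M[R]_n) := Dichotomy {
  dimp : nat; dimm : nat;
  projp : 'M[R]_(dimp, n); projm : 'M[R]_(dimm, n);
  szp : nat; szm : nat;
  formp : 'M[R]_(szp, dimp); formm : 'M[R]_(szm, dimm);
  rate : R;
  rate_gt0 : 0 < rate;
  dim_split : (dimp + dimm)%N = n;
  dimm_eig : dimm = num_Re_neg G;
  proj_inj : forall b : 'cV_n, projp *m b = 0 -> projm *m b = 0 -> b = 0;
  formp_inj : forall x : 'cV_dimp, formp *m x = 0 -> x = 0;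
  formm_inj : forall x : 'cV_dimm, formm *m x = 0 -> x = 0;
  proj_expand : forall b : 'cV_n, rate * sqv (formp *m (projp *m b)) <=
    dotv (formp *m (projp *m b)) (formp *m (projp *m (G *m b)));
  proj_contract : forall b : 'cV_n,
    dotv (formm *m (projm *m b)) (formm *m (projm *m (G *m b))) <=
    - (rate * sqv (formm *m (projm *m b)))
}.

Lemma conj_eigvals n (G : 'M[R]_n) :
  perm_eq [seq z^*%C | z <- eigvals (cmx G)] (eigvals (cmx G)).
Proof.
rewrite perm_sym; apply: eigvals_perm.
have Gc : cmx G = map_mx (@conjc R) (cmx G).
  by apply/matrixP => i j; rewrite !mxE conjc_real.
rewrite [in LHS]Gc -map_char_poly char_poly_eigvals rmorph_prod big_map.
by apply: eq_bigr => z _; rewrite /= rmorphB /= map_polyX map_polyC.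
Qed.

(** A factor whose roots are stable under conjugation is itself fixed by conjugation. *)
Lemma real_poly_factor n (G : 'M[R]_n) (s : pred C) :
  (forall z, s z^*%C = s z) ->
  exists p : {poly R}, map_poly rc p =
    \prod_(z <- [seq z <- eigvals (cmx G) | s z]) ('X - z%:P).
Proof.
move=> hs; set pC := \prod_(z <- _) _.
have fixed : map_poly (@conjc R) pC = pC.
  rewrite rmorph_prod /pC.
  rewrite -[RHS](perm_big _ (perm_filter s (conj_eigvals G))) /=.
  rewrite filter_map big_map.
  rewrite (@eq_filter _ (preim [eta (@conjc R)] s) s); last exact: hs.
  by apply: eq_bigr => z _; rewrite /= rmorphB /= map_polyX map_polyC.
exists (map_poly (@complex.Re R) pC); apply/polyP => i.
rewrite coef_map /= coef_map_id0//.
have := congr1 (fun p : {poly C} => p`_i) fixed; rewrite coef_map /=.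
case: (pC`_i) => a b /= /eqP; rewrite eq_complex /= => /andP[_].
by rewrite eqr_oppLR -addr_eq0 -mulr2n mulrn_eq0 /= => /eqP ->.
Qed.

Lemma eigvec_horner (K : fieldType) n (g : 'M[K]_n.+1) (w : 'rV_n.+1) z p :
  w *m g = z *: w -> w *m horner_mx g p = p.[z] *: w.
Proof.
move=> wg; elim/poly_ind: p => [|p c IHp].
  by rewrite rmorph0 mulmx0 horner0 scale0r.
rewrite rmorphD rmorphM /= horner_mx_X horner_mx_C mulmxDr mulmxA IHp.
by rewrite -scalemxAl wg mul_mx_scalar scalerA -scalerDl !hornerE.
Qed.

(** A left eigenvector of [G'] multiplied by V is a left eigenvector of G, on which p (G) acts both
    as p (z) and as 0. *)
Lemma root_of_restriction n k (G : 'M[R]_n.+1) (V : 'M[R]_(k, n.+1))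
    (G' : 'M[R]_k) (p : {poly R}) z :
  row_free V -> (V <= kermxpoly G p)%MS -> V *m G = G' *m V ->
  eigenvalue (cmx G') z -> root (map_poly rc p) z.
Proof.
move=> fV /sub_kermxP Vp VG /eigenvalueP[v vG v0].
pose w := v *m cmx V.
have w0 : w != 0.
  apply: contra v0 => /eqP w0; apply/eqP.
  have fV' : row_free (cmx V) by rewrite /row_free mxrank_map.
  by apply: (row_free_inj fV'); rewrite mul0mx.
have wG : w *m cmx G = z *: w.
  by rewrite /w -mulmxA -map_mxM VG map_mxM mulmxA [v *m _]vG -scalemxAl.
have : w *m horner_mx (cmx G) (map_poly rc p) = 0.
  by rewrite -map_horner_mx /w -mulmxA -map_mxM Vp map_mx0 mulmx0.
rewrite (eigvec_horner _ wG) => /eqP; rewrite scaler_eq0 (negbTE w0) orbF.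
by [].
Qed.

Lemma char_poly_sim_rect m n (e : m = n) (W : 'M[R]_(m, n)) (D : 'M[R]_m) G :
  row_free W -> W *m G = D *m W -> char_poly G = char_poly D.
Proof.
case: n / e in W G *; rewrite row_free_unit => uW WG.
by symmetry; apply: (char_poly_sim uW).
Qed.

(** The characteristic polynomial splits by half-planes into real coprime factors p and q. The left
    kernels of p (G) and q (G) are invariant and complementary, and each restriction of G, up to
    sign, has a Lyapunov form. *)
Lemma dichotomy_exists n (G : 'M[R]_n) :
  (forall z, eigenvalue (cmx G) z -> complex.Re z != 0) ->
  inhabited (dichotomy G).
Proof.
case: n => [|n] in G *.
  move=> _; constructor.
  have nilE k l (M : 'M[R]_(k, l)) (x : 'cV[R]_0) : x = 0.
    by apply/matrixP => -[].
  apply: (@Dichotomy _ _ 0%N 0%N 0 0 0%N 0%N 0 0 1) => //.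
  - by rewrite /num_Re_neg /num_eig; have := size_eigvals (cmx G); case: eigvals.
  - by move=> b _ _; apply/matrixP => -[].
  - by move=> b _; apply/matrixP => -[].
  - by move=> b _; apply/matrixP => -[].
  - by move=> b; rewrite /sqv /dotv !big_ord0 mulr0.
  - by move=> b; rewrite /sqv /dotv !big_ord0 mulr0 oppr0.
move=> hG.
have cl (z : C) : left_half z^*%C = left_half z by case: z.
have cr (z : C) : predC (@left_half R) z^*%C = predC (@left_half R) z by case: z.
have [p pE] := @real_poly_factor _ G _ cl.
have [q qE] := @real_poly_factor _ G _ cr.
have rp z : root (map_poly rc p) z -> complex.Re z < 0.
  by rewrite pE root_prod_XsubC mem_filter => /andP[].
have rq z : root (map_poly rc q) z -> 0 < complex.Re z.
  rewrite qE root_prod_XsubC mem_filter mem_eigvals => /andP[h /hG z0].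
  by rewrite lt_neqAle eq_sym z0 leNgt.
have pq : char_poly G = p * q.
  apply: (map_poly_inj rc); rewrite rmorphM /= pE qE map_char_poly.
  rewrite char_poly_eigvals -big_cat /=; apply: perm_big.
  by rewrite perm_sym perm_filterC.
have cpq : coprimep p q.
  rewrite -(coprimep_map rc); apply/Pdiv.ClosedField.coprimepP => z /rp zn.
  by apply/negP => /rq; rewrite ltNge ltW.
(* Row vectors annihilated by q (G) carry the spectrum with positive real part. A basis of them,
   acting on columns, gives the expanding coordinates. *)
pose Kp := kermxpoly G q; pose Km := kermxpoly G p.
pose Vp := row_base Kp; pose Vm := row_base Km.
have stab r : exists G', row_base (kermxpoly G r) *m G = G' *m row_base (kermxpoly G r).
  apply/submxP; rewrite (eqmxMr _ (eq_row_base _)) eq_row_base.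
  exact: comm_mx_stable_kermxpoly.
have [Gp VGp] : exists G', Vp *m G = G' *m Vp by exact: stab.
have [Gm VGm] : exists G', Vm *m G = G' *m Vm by exact: stab.
have sum1 : (Km + Kp :=: (1%:M : 'M[R]_n.+1))%MS.
  apply: eqmx_trans (eqmx_sym (kermxpolyM G cpq)) _.
  by apply: kermxpoly_min; rewrite -pq mxminpoly_dvd_char.
have dims : (\rank Kp + \rank Km)%N = n.+1.
  rewrite addnC -mxrank_disjoint_sum ?sum1 ?mxrank1//.
  exact: mxdirect_kermxpoly.
have eigm z : eigenvalue (cmx Gm) z -> complex.Re z < 0.
  move=> zG; apply: rp; apply: (root_of_restriction _ _ VGm zG).
    exact: row_base_free.
  by rewrite eq_row_base.
have eigp z : eigenvalue (cmx Gp) z -> 0 < complex.Re z.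
  move=> zG; apply: rq; apply: (root_of_restriction _ _ VGp zG).
    exact: row_base_free.
  by rewrite eq_row_base.
have [mp [Lp [tp [tp0 Lp_inj Lp_form]]]] := lyapunov eigp.
have [mm [Lm [tm [tm0 Lm_inj Lm_form]]]] : exists m (L : 'M[R]_(m, \rank Km)) (theta : R), [/\ 0 < theta,
    forall x : 'cV_(\rank Km), L *m x = 0 -> x = 0 &
    forall x : 'cV_(\rank Km), theta * sqv (L *m x) <= dotv (L *m x) (L *m (- Gm *m x))].
  apply: lyapunov => z /eigenvalueP[v vG v0].
  rewrite -oppr_lt0 -raddfN; apply: eigm; apply/eigenvalueP; exists v => //.
  by rewrite scaleNr -vG /cmx map_mxN mulmxN opprK.
have inj (b : 'cV[R]_n.+1) : Vp *m b = 0 -> Vm *m b = 0 -> b = 0.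
  move=> bp bm; have : (1%:M <= Vm + Vp)%MS.
    by rewrite (adds_eqmx (eq_row_base _) (eq_row_base _)) sum1.
  move=> /sub_addsmxP[[X Y] /= e].
  have := congr1 (mulmx^~ b) e; rewrite mul1mx mulmxDl -(mulmxA X) -(mulmxA Y).
  by rewrite bp bm !mulmx0 addr0.
constructor; apply: (@Dichotomy _ _ _ _ Vp Vm _ _ Lp Lm (Num.min tp tm)) => //.
- by rewrite lt_min tp0.
- pose W := col_mx Vm Vp.
  have fW : row_free W.
    rewrite /row_free -addsmxE (adds_eqmx (eq_row_base _) (eq_row_base _)).
    by rewrite sum1 mxrank1 addnC dims.
  have WG : W *m G = block_mx Gm 0 0 Gp *m W.
    by rewrite /W mul_col_mx VGm VGp mul_block_col !mul0mx addr0 add0r.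
  have dims' : (\rank Km + \rank Kp)%N = n.+1 by rewrite addnC.
  have chE := char_poly_sim_rect dims' fW WG.
  rewrite /num_Re_neg (@num_eig_mul _ _ _ _ _ _ (cmx Gm) (cmx Gp)); last first.
    by rewrite -!map_char_poly chE char_poly_ublock rmorphM.
  rewrite -[LHS]addn0; congr addn.
    rewrite -[LHS](size_eigvals (cmx Gm)); symmetry; apply/eqP.
    rewrite -all_count; apply/allP => z; rewrite mem_eigvals; exact: eigm.
  symmetry; apply/eqP; rewrite -leqn0 leqNgt -has_count; apply/hasPn => z.
  by rewrite mem_eigvals /= => /eigp z0; rewrite -leNgt ltW.
- move=> b; rewrite (mulmxA Vp) VGp -(mulmxA Gp); apply: le_trans (Lp_form _).
  by rewrite ler_wpM2r ?sqv_ge0// ge_min lexx.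
- move=> b; rewrite (mulmxA Vm) VGm -(mulmxA Gm) lerNr.
  apply: (@le_trans _ _ (tm * sqv (Lm *m (Vm *m b)))).
    by rewrite ler_wpM2r ?sqv_ge0// ge_min lexx orbT.
  apply: le_trans (Lm_form _) _; rewrite mulNmx mulmxN /dotv -sumrN.
  by apply: ler_sum => i _; rewrite !mxE mulrN.
Qed.

End Dichotomy.

(** * Gronwall estimates, primitives and one-sided derivatives *)

Section HalfLineCalculus.
Variable R : realType.
Implicit Types (f g df dg : R -> R) (a b k : R).

Lemma is_derive_expRM (k x : R) :
  is_derive x 1 (fun z => expR (k * z)) (k * expR (k * x)).
Proof.
have h : is_derive x 1 (fun z : R => k * z) k.
  have := is_deriveZ k (is_derive_id x (1 : R)).
  by rewrite [_ *: _]mulr1.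
have := is_derive1_comp (is_derive_expR (k * x)) h.
by rewrite mulrC.
Qed.

Lemma is_derive_ndecr f df a b : a <= b -> continuous f ->
  (forall x, a < x -> x < b -> is_derive x 1 f (df x)) ->
  (forall x, a < x -> x < b -> 0 <= df x) -> f a <= f b.
Proof.
move=> ab cf hd hp; move: ab; rewrite le_eqVlt => /predU1P[->//|ab].
have [||c] := @MVT R f df a b ab.
- by move=> x; rewrite in_itv /= => /andP[]; exact: hd.
- exact: continuous_subspaceT.
- rewrite in_itv /= => /andP[ac cb] e.
  by rewrite -subr_ge0 e mulr_ge0 ?subr_ge0 ?hp// ltW.
Qed.

Lemma is_derive_dist f df g dg a b : a <= b -> continuous f -> continuous g ->
  (forall x, a < x -> x < b -> is_derive x 1 f (df x)) ->
  (forall x, a < x -> x < b -> is_derive x 1 g (dg x)) ->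
  (forall x, a < x -> x < b -> `|df x| <= dg x) -> `|f b - f a| <= g b - g a.
Proof.
move=> ab cf cg hf hg hle; rewrite ler_norml; apply/andP; split.
- have : (g \+ f) a <= (g \+ f) b.
    apply: (is_derive_ndecr (df := fun x => dg x + df x)) => //.
    + by move=> x; apply: continuousD; [exact: cg|exact: cf].
    + by move=> x ax xb; apply: is_deriveD; [exact: hg|exact: hf].
    + by move=> x ax xb; have := hle x ax xb; rewrite ler_norml => /andP[]; lra.
  by rewrite /=; lra.
- have : (g \- f) a <= (g \- f) b.
    apply: (is_derive_ndecr (df := fun x => dg x - df x)) => //.
    + by move=> x; apply: continuousB; [exact: cg|exact: cf].
    + by move=> x ax xb; apply: is_deriveB; [exact: hg|exact: hf].
    + by move=> x ax xb; have := hle x ax xb; rewrite ler_norml => /andP[]; lra.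
  by rewrite /=; lra.
Qed.

Lemma continuous_expRM (k : R) : continuous (fun z => expR (k * z)).
Proof.
move=> x; apply: continuous_comp; last exact: continuous_expR.
exact: mulrl_continuous.
Qed.

Lemma gronwall_ge f df (k a b : R) : a <= b -> continuous f ->
  (forall x, a < x -> x < b -> is_derive x 1 f (df x)) ->
  (forall x, a < x -> x < b -> k * f x <= df x) ->
  f a * expR (k * (b - a)) <= f b.
Proof.
move=> ab cf hf hle.
have : f a * expR (- k * a) <= f b * expR (- k * b).
  apply: (@is_derive_ndecr (fun x => f x * expR (- k * x))
    (fun x => (df x - k * f x) * expR (- k * x))) => //.
  - by move=> x; apply: cvgM; [exact: cf|exact: continuous_expRM].
  - move=> x ax xb; have h1 := hf x ax xb; have h2 := is_derive_expRM (- k) x.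
    apply: (is_derive_eq (is_deriveM h1 h2)).
    by rewrite /GRing.scale /=; ring.
  - by move=> x ax xb; rewrite mulr_ge0 ?expR_ge0// subr_ge0 hle.
rewrite -(ler_pM2r (expR_gt0 (k * b))) -!mulrA -!expRD.
have -> : - k * a + k * b = k * (b - a) by ring.
have -> : - k * b + k * b = 0 by ring.
by rewrite expR0 mulr1.
Qed.

Lemma gronwall_le f df (k a b : R) : a <= b -> continuous f ->
  (forall x, a < x -> x < b -> is_derive x 1 f (df x)) ->
  (forall x, a < x -> x < b -> df x <= k * f x) ->
  f b <= f a * expR (k * (b - a)).
Proof.
move=> ab cf hf hle; rewrite -lerN2 -mulNr.
apply: (@gronwall_ge (\- f) (fun x => - df x)) => //.
- by move=> x; apply: continuousN; exact: cf.
- by move=> x ax xb; apply: is_deriveN; exact: hf.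
- by move=> x ax xb; rewrite /= mulrN lerN2; exact: hle.
Qed.

Lemma primitive f : continuous f ->
  exists F : R -> R, [/\ F 0 = 0, continuous F &
    forall z : R, 0 < z -> is_derive z 1 F (f z)].
Proof.
move=> cf.
(* Starting at -1 makes 0 an interior point, where P is continuous; composition with the maximum
   with 0 then freezes the primitive on the negative axis. *)
pose P (x : R) : R := (\int[lebesgue_measure]_(t in `[(-1 : R), x]) f t)%R.
have Pd (x : R) : -1 < x -> is_derive x 1 P (f x).
  move=> x1; have xx : x < x + 1 by rewrite ltrDl.
  have fi : lebesgue_measure.-integrable `[(-1 : R), x + 1] (EFin \o f).
    apply: continuous_compact_integrable; first exact: segment_compact.
    exact: continuous_subspaceT.
  have [d1 d2] := continuous_FTC1_closed xx fi x1 (cf x).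
  by apply: DeriveDef => //; rewrite -derive1E.
exists (fun z => P (Num.max z 0) - P 0); split.
- by rewrite maxxx subrr.
- move=> x; apply: cvgB; last exact: cvg_cst.
  apply: (@cvg_comp _ _ _ (fun z => Num.max z 0) P _ (nbhs (Num.max x 0))).
    by apply: (@continuous_max _ _ id (cst 0)); [exact: cvg_id|exact: cst_continuous].
  have /Pd h : -1 < Num.max x 0 by rewrite lt_max ltrN10 orbT.
  apply: differentiable_continuous; apply/derivable1_diffP.
  exact: (@ex_derive _ _ _ _ _ _ _ h).
- move=> z z0; have z1 : -1 < z by apply: lt_trans z0; rewrite ltrN10.
  have h : is_derive z 1 (P \- cst (P 0)) (f z).
    have := is_deriveB (Pd z z1) (is_derive_cst (P 0) z 1).
    by rewrite subr0.
  apply: near_eq_is_derive h.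
  near=> x; rewrite max_l//; near: x.
  by apply: filterS (lt_nbhsr z0) => x; exact: ltW.
Unshelve. all: by end_near. Qed.

(* A continuous function whose derivative on the open half-line extends
   continuously to 0 has a one-sided derivative at 0. *)
Lemma hl_quotient_cvg f df (z : R) : continuous f -> continuous df ->
  (forall z : R, 0 < z -> is_derive z 1 f (df z)) -> 0 <= z ->
  h^-1 * (f (z + h) - f z) @[h --> within [set h | 0 <= z + h] 0^'] --> df z.
Proof.
move=> cf cdf hf z0; apply/cvgrPdist_lt => e e0.
have /nbhs_ballP[d /= d0 hd] : \forall t \near z, `|df z - df t| < e.
  by have := cdf z => /cvgrPdist_lt/(_ e e0).
have mid a b : 0 <= a -> a < b -> (forall c, a < c -> c < b -> `|df z - df c| < e) ->
    `|df z - (b - a)^-1 * (f b - f a)| < e.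
  move=> a0 ab hc.
  have [||c] := @MVT R f df a b ab.
  - by move=> x; rewrite in_itv /= => /andP[ax _]; apply: hf; exact: le_lt_trans ax.
  - exact: continuous_subspaceT.
  - rewrite in_itv /= => /andP[ac cb] ->.
    by rewrite mulrC mulfK ?subr_eq0 ?gt_eqF//; exact: hc.
rewrite near_withinE; near=> h => zh.
have hlt : `|h| < d by near: h; exact: dnbhs0_lt.
have h0 : h != 0 by near: h; exact: nbhs_dnbhs_neq.
move: h0; rewrite neq_lt => /orP[hneg|hpos].
- rewrite (_ : _ * _ = (z - (z + h))^-1 * (f z - f (z + h))); last first.
    by rewrite opprD addNKr invrN mulNr -mulrN opprB.
  apply: mid => // [|c zc cz]; first by rewrite gtrDl.
  apply: hd; rewrite /ball /= ger0_norm; last by lra.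
  by rewrite ler0_norm ?ltW// in hlt; lra.
- rewrite (_ : _ * _ = (z + h - z)^-1 * (f (z + h) - f z)); last first.
    by rewrite [z + h - z]addrAC subrr add0r.
  apply: mid => // [|c zc cz]; first by rewrite ltrDl.
  apply: hd; rewrite /ball /= distrC ger0_norm; last by lra.
  by rewrite gtr0_norm// in hlt; lra.
Unshelve. all: by end_near. Qed.

End HalfLineCalculus.

(** * Linear initial value problems on the half line *)

Section LinearIVP.
Variable R : realType.

(** The notion of derivative in which all the systems below are written. Functions are total and
    continuous on the whole line, in practice frozen to the left of 0, while the derivative is
    prescribed for z > 0 only. *)
Definition half_deriv k (Y D : R -> 'cV[R]_k) : Prop :=
  (forall i, continuous (fun z => Y z i 0)) /\
  forall (z : R) i, 0 < z -> is_derive z 1 (fun t => Y t i 0) (D z i 0).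

Lemma mulmx_entry_bound m n (M : 'M[R]_(m, n)) (v : 'cV[R]_n) (C b : R) i :
  (forall j, `|M i j| <= C) -> (forall j, `|v j 0| <= b) ->
  `|(M *m v) i 0| <= n%:R * C * b.
Proof.
move=> hM hv; rewrite mxE; apply: le_trans (ler_norm_sum _ _ _) _.
rewrite -mulrA mulr_natl -[in leRHS](card_ord n) -sumr_const.
by apply: ler_sum => j _; rewrite normrM ler_pM.
Qed.

Lemma continuous_mulmx m n (M : R -> 'M[R]_(m, n)) (v : R -> 'cV[R]_n) i :
  (forall i j, continuous (fun z => M z i j)) ->
  (forall j, continuous (fun z => v z j 0)) ->
  continuous (fun z => (M z *m v z) i 0).
Proof.
move=> hM hv x; rewrite /continuous_at mxE; under eq_fun do rewrite mxE.
by apply: cvg_sum => j _; apply: cvgM; [exact: hM|exact: hv].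
Qed.

Lemma eq_of_geometric_bound (x y b : R) :
  (forall n, `|x - y| <= b * 2^-1 ^+ n) -> x = y.
Proof.
move=> h; apply/eqP; rewrite -subr_eq0 -normr_le0.
have b0 : b * 2^-1 ^+ n @[n --> \oo] --> (0 : R).
  rewrite -[0 in X in _ --> X](mulr0 b); apply: cvgMl_tmp.
  by apply: cvg_expr; rewrite ger0_norm ?invr_ge0// invf_lt1// ltr1n.
have := cvgP _ b0; move=> /limr_ge; move/cvg_lim : b0 => ->//.
by apply; exact: nearW.
Qed.

(* Picard iteration: with K >= 2 |M| the n-th correction is at most
   2^-n B exp (K z). *)
Lemma linear_ivp k (M : R -> 'M[R]_k) (C : R) (y0 : 'cV[R]_k) :
  (forall i j, continuous (fun z => M z i j)) ->
  (forall z i j, 0 <= z -> `|M z i j| <= C) ->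
  exists2 Y, Y 0 = y0 & half_deriv Y (fun z => M z *m Y z).
Proof.
move=> cM bM.
(* A choice of primitives for all functions at once, with the dummy value 0 for discontinuous
   ones. *)
have [Prim hPrim] : exists P : (R -> R) -> R -> R, forall f, continuous f ->
    [/\ P f 0 = 0, continuous (P f) & forall z : R, 0 < z -> is_derive z 1 (P f) (f z)].
  have : forall f : R -> R, exists F : R -> R, continuous f ->
      [/\ F 0 = 0, continuous F & forall z : R, 0 < z -> is_derive z 1 F (f z)].
    move=> f; have [cf|ncf] := pselect (continuous f).
      by have [F hF] := primitive cf; exists F.
    by exists (fun=> 0) => /ncf.
  by move=> /choice[P hP]; exists P.
(* [D n] is the n-th correction of the Picard scheme; the iterates are the partial sums [S]
   below. *)
pose D := fix D n : R -> 'cV[R]_k := if n is m.+1 then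
  fun z => \col_i Prim (fun t => (M t *m D m t) i 0) z else fun=> y0.
have cD n i : continuous (fun z => D n z i 0).
  elim: n i => [|n IHn] i; first by move=> x; exact: cvg_cst.
  have [_ h _] := hPrim _ (continuous_mulmx (i := i) cM IHn).
  by move=> x; rewrite /continuous_at /= mxE; under eq_fun do rewrite mxE; exact: h.
have dD n i (z : R) : 0 < z ->
    is_derive z 1 (fun t => D n.+1 t i 0) ((M z *m D n z) i 0).
  move=> z0; have [_ _ /(_ z z0)] := hPrim _ (continuous_mulmx (i := i) cM (cD n)).
  have -> // : (fun t => D n.+1 t i 0) = Prim (fun t => (M t *m D n t) i 0).
  by apply/funext => t; rewrite mxE.
have D0 n i : D n.+1 0 i 0 = 0.
  by have [+ _ _] := hPrim _ (continuous_mulmx (i := i) cM (cD n)); rewrite /= mxE.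
pose C' := `|C| + 1.
have C'0 : 0 <= C' by rewrite addr_ge0.
have bM' z i j : 0 <= z -> `|M z i j| <= C'.
  move=> z0; apply: le_trans (bM z i j z0) _.
  by rewrite (le_trans (ler_norm _))// lerDl.
pose K := 2 * (k%:R * C').
have K0 : 0 <= K by rewrite !mulr_ge0// ler0n.
pose B := \sum_i `|y0 i 0|.
have B0 : 0 <= B by exact: sumr_ge0.
pose bnd n (z : R) := 2^-1 ^+ n * B * expR (K * z).
have bndS n z : bnd n.+1 z = 2^-1 * bnd n z by rewrite /bnd exprS -!mulrA.
have bnd0 n z : 0 <= bnd n z.
  by rewrite !mulr_ge0 ?expR_ge0// exprn_ge0// invr_ge0.
have cbnd n : continuous (bnd n).
  by move=> x; apply: cvgMl_tmp; exact: continuous_expRM.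
have dbnd n (x : R) : is_derive x 1 (bnd n) (K * bnd n x).
  have := is_deriveZ (2^-1 ^+ n * B) (is_derive_expRM K x).
  by rewrite /bnd mulrCA.
(* integrating a right-hand side bounded by [bnd n] gains a factor 1/2 *)
have gain n (f df : R -> R) : continuous f -> f 0 = 0 ->
    (forall z : R, 0 < z -> is_derive z 1 f (df z)) ->
    (forall z : R, 0 < z -> `|df z| <= k%:R * C' * bnd n z) ->
    forall z, 0 <= z -> `|f z| <= bnd n.+1 z.
  move=> cf f0 hf hdf z z0.
  have h1 x : 0 < x -> x < z -> is_derive x 1 f (df x) by move=> x0 _; exact: hf.
  have h2 x : 0 < x -> x < z -> is_derive x 1 (bnd n.+1) (K * bnd n.+1 x).
    by move=> _ _; exact: dbnd.
  have h3 x : 0 < x -> x < z -> `|df x| <= K * bnd n.+1 x.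
    move=> x0 _; apply: le_trans (hdf x x0) _.
    by rewrite /bnd exprS /K le_eqVlt; apply/orP; left; apply/eqP; field.
  have := is_derive_dist z0 cf (cbnd _) h1 h2 h3.
  by rewrite f0 subr0 => h; apply: le_trans h _; rewrite gerBl.
have bD n i z : 0 <= z -> `|D n z i 0| <= bnd n z.
  elim: n i z => [|n IHn] i z z0.
    rewrite /bnd expr0 mul1r /=; apply: (@le_trans _ _ B).
      by rewrite /B (bigD1 i)//= lerDl sumr_ge0.
    by rewrite ler_peMr// -expR0 ler_expR mulr_ge0.
  apply: (gain n (fun z => D n.+1 z i 0) (fun z => (M z *m D n z) i 0)) => //.
  move=> x /ltW x0; apply: mulmx_entry_bound => j; first exact: bM'.
  exact: IHn.
pose S n z := \sum_(j < n) D j z.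
have SE n z i : S n z i 0 = \sum_(j < n) D j z i 0 by rewrite summxE.
have tail n m i z : 0 <= z ->
    `|S (n + m)%N z i 0 - S n z i 0| <= 2 * (bnd n z - bnd (n + m)%N z).
  move=> z0; elim: m => [|m IHm]; first by rewrite addn0 !subrr normr0 mulr0.
  rewrite addnS !SE big_ord_recr /= -!SE addrAC.
  apply: le_trans (ler_normD _ _) _.
  apply: le_trans (lerD IHm (bD (n + m)%N i z z0)) _.
  by rewrite bndS; lra.
have cvgS i z : 0 <= z -> cvgn (fun n => S n z i 0).
  move=> z0.
  have -> : (fun n => S n z i 0) = series (fun n => D n z i 0).
    by apply/funext => n; rewrite SE /series /= big_mkord.
  apply: normed_cvg; apply: (@series_le_cvg _ _ (geometric (bnd 0 z) 2^-1)).
  - by move=> n; exact: normr_ge0.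
  - by move=> n; rewrite /geometric /= mulr_ge0// exprn_ge0// invr_ge0.
  - move=> n; apply: le_trans (bD n i z z0) _.
    by rewrite /geometric /= /bnd expr0 mul1r -mulrA mulrC.
  - by apply: is_cvg_geometric_series; rewrite ger0_norm ?invr_ge0// invf_lt1// ltr1n.
(* The series is controlled for z >= 0 only, so Y is frozen to the left of 0. *)
pose Y z : 'cV[R]_k := \col_i limn (fun n => S n (Num.max z 0) i 0).
have YS n i z : 0 <= z -> `|Y z i 0 - S n z i 0| <= 2 * bnd n z.
  move=> z0; rewrite mxE max_l//.
  have cv : `|S m z i 0 - S n z i 0| @[m --> \oo] -->
      `|limn (fun n => S n z i 0) - S n z i 0|.
    by apply: cvg_norm; apply: cvgB; [exact: cvgS|exact: cvg_cst].
  have := cvgP _ cv; move=> /limr_le; move/cvg_lim : cv => ->//.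
  apply; exists n => // m /= nm; rewrite -(subnKC nm).
  by apply: le_trans (tail _ _ _ _ z0) _; rewrite ler_pM2l// gerBl.
have Ymax z : Y (Num.max z 0) = Y z.
  by apply/matrixP => i j; rewrite !mxE [Num.max (Num.max z 0) 0]max_l// le_max lexx orbT.
have cS n i : continuous (fun z => S n z i 0).
  by move=> x; rewrite /continuous_at SE; under eq_fun do rewrite SE; apply: cvg_sum => j _; exact: cD.
have cY i : continuous (fun z => Y z i 0).
  move=> x; apply/cvgrPdist_le => e e0.
  pose T := Num.max x 0 + 1.
  have bT n z : z <= T -> bnd n z <= bnd n T.
    move=> zT; rewrite ler_wpM2l ?ler_expR ?ler_wpM2l//.
    by rewrite mulr_ge0// exprn_ge0// invr_ge0.
  have [n hn] : exists n, bnd n T <= e / 8.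
    have : bnd n T @[n --> \oo] --> (0 : R).
      have -> : (fun n => bnd n T) = (fun n => (B * expR (K * T)) * 2^-1 ^+ n).
        by apply/funext => n; rewrite /bnd -mulrA mulrC.
      rewrite -[0 in X in _ --> X](mulr0 (B * expR (K * T))); apply: cvgMl_tmp.
      by apply: cvg_expr; rewrite ger0_norm ?invr_ge0// invf_lt1// ltr1n.
    move=> /cvgrPdist_le/(_ (e / 8)); rewrite divr_gt0// => /(_ isT)[n _ /(_ n (leqnn n))].
    by rewrite sub0r normrN => h; exists n; apply: le_trans h; exact: ler_norm.
  have cm : (fun z => Num.max z 0) @ x --> Num.max x 0.
    by apply: (@continuous_max _ _ id (cst 0)); [exact: cvg_id|exact: cst_continuous].
  have h1 : \forall y \near x, `|S n (Num.max x 0) i 0 - S n (Num.max y 0) i 0| <= e / 2.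
    have := cvg_comp _ _ cm (cS n i (Num.max x 0)).
    by move=> /cvgrPdist_le/(_ (e / 2)); rewrite divr_gt0// => /(_ isT).
  have h2 : \forall y \near x, `|Num.max x 0 - Num.max y 0| <= 1.
    by move: cm => /cvgrPdist_le/(_ 1 ltr01).
  near=> y.
  have e1 : `|S n (Num.max x 0) i 0 - S n (Num.max y 0) i 0| <= e / 2 by near: y.
  have e2 : `|Num.max x 0 - Num.max y 0| <= 1 by near: y.
  rewrite -(Ymax x) -(Ymax y).
  have yT : Num.max y 0 <= T by rewrite /T; move: e2; rewrite ler_norml; lra.
  have xT : Num.max x 0 <= T by rewrite /T lerDl.
  have m0 z : 0 <= Num.max z (0 : R) by rewrite le_max lexx orbT.
  have := YS n i _ (m0 x); have := YS n i _ (m0 y).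
  have := bT n _ yT; have := bT n _ xT.
  move: e1; rewrite !ler_norml; lra.
(* W is the right-hand side of the integral equation. It equals Y because both lie within a
   geometrically small distance of the same partial sums. *)
have [W hW] : exists W : 'I_k -> R -> R, forall i,
    [/\ W i 0 = y0 i 0, continuous (W i) &
     forall z : R, 0 < z -> is_derive z 1 (W i) ((M z *m Y z) i 0)].
  exists (fun i z => y0 i 0 + Prim (fun t => (M t *m Y t) i 0) z) => i.
  have [p0 pc pd] := hPrim _ (continuous_mulmx (i := i) cM cY); split.
  - by rewrite p0 addr0.
  - by move=> x; apply: cvgD; [exact: cvg_cst|exact: pc].
  - move=> z z0; apply: (is_derive_eq (is_deriveD (is_derive_cst (y0 i 0) z 1) (pd z z0))).
    by rewrite add0r.
have SS n z : S n.+1 z = S n z + D n z by rewrite /S big_ord_recr.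
have S0 n i : S n.+1 0 i 0 = y0 i 0.
  by elim: n => [|n IHn]; rewrite SS mxE ?IHn ?D0 ?addr0// /S big_ord0 mxE add0r.
have dS n i (z : R) : 0 < z ->
    is_derive z 1 (fun t => S n.+1 t i 0) ((M z *m S n z) i 0).
  move=> z0; elim: n => [|n IHn].
    have -> : (fun t => S 1%N t i 0) = cst (y0 i 0).
      by apply/funext => t; rewrite SS /S big_ord0 add0r.
    by rewrite /S big_ord0 mulmx0 mxE; exact: is_derive_cst.
  have -> : (fun t => S n.+2 t i 0) = (fun t => S n.+1 t i 0) \+ (fun t => D n.+1 t i 0).
    by apply/funext => t; rewrite [S n.+2 t]SS [LHS]mxE.
  by apply: (is_derive_eq (is_deriveD IHn (dD n i z z0))); rewrite SS mulmxDr [in RHS]mxE.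
have WS n i z : 0 <= z -> `|W i z - S n.+1 z i 0| <= 2 * bnd n.+1 z.
  move=> z0; have [w0 wc wd] := hW i.
  have c1 : continuous (W i \- (fun z => S n.+1 z i 0)).
    by move=> x; apply: cvgB; [exact: wc|exact: cS].
  have c2 : continuous (fun z => 2 * bnd n.+1 z).
    by move=> x; apply: cvgMl_tmp; exact: cbnd.
  have h1 (x : R) : 0 < x -> x < z -> is_derive x 1 (W i \- (fun z => S n.+1 z i 0))
      ((M x *m (Y x - S n x)) i 0).
    move=> x0 _; apply: (is_derive_eq (is_deriveB (wd x x0) (dS n i x x0))).
    by rewrite mulmxBr [in RHS]mxE [X in _ = _ + X]mxE.
  have h2 (x : R) : 0 < x -> x < z ->
      is_derive x 1 (fun z => 2 * bnd n.+1 z) (2 * (K * bnd n.+1 x)).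
    by move=> _ _; exact: (is_deriveZ 2 (dbnd n.+1 x)).
  have h3 (x : R) : 0 < x -> x < z ->
      `|(M x *m (Y x - S n x)) i 0| <= 2 * (K * bnd n.+1 x).
    move=> x0 _.
    apply: (@le_trans _ _ (k%:R * C' * (2 * bnd n x))).
      apply: mulmx_entry_bound => j; first by apply: bM'; exact: ltW.
      by rewrite !mxE -[- _]/(- (S n x j 0)); have := YS n j x (ltW x0); rewrite mxE.
    by rewrite bndS /K le_eqVlt; apply/orP; left; apply/eqP; field.
  have := is_derive_dist z0 c1 c2 h1 h2 h3.
  rewrite /= w0 S0 subrr subr0 => h; apply: le_trans h _.
  by rewrite gerBl mulr_ge0.
have YW i z : 0 <= z -> Y z i 0 = W i z.
  move=> z0; apply: (@eq_of_geometric_bound _ _ (2 * (B * expR (K * z)))) => n.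
  have -> : 2 * (B * expR (K * z)) * 2^-1 ^+ n = 2 * bnd n.+1 z + 2 * bnd n.+1 z.
    by rewrite bndS /bnd; field.
  have := YS n.+1 i z z0; have := WS n i z z0.
  by rewrite !ler_norml => /andP[? ?] /andP[? ?]; apply/andP; split; lra.
exists Y; first by apply/matrixP => i j; rewrite (ord1 j) YW//; have [] := hW i.
split=> // z i z0; have [_ _ /(_ z z0)] := hW i.
apply: near_eq_is_derive; near=> x; rewrite YW//; near: x.
by apply: filterS (lt_nbhsr z0) => x; exact: ltW.
Unshelve. all: by end_near. Qed.

End LinearIVP.

(** * Comparison of the maximum norm with Euclidean forms *)

Section VectorNorms.
Variable R : realType.

Lemma mx_norm_le m n (M : 'M[R]_(m, n)) (b : R) :
  0 <= b -> (forall i j, `|M i j| <= b) -> `|M| <= b.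
Proof.
move=> b0 h; rewrite [`|M|]/Num.norm /= mx_normrE.
by apply/bigmax_leP; split=> // i _; exact: h.
Qed.

Lemma entry_le_norm m n (M : 'M[R]_(m, n)) i j : `|M i j| <= `|M|.
Proof.
rewrite [`|M|]/Num.norm /= mx_normrE.
by apply/bigmax_geP; right => /=; exists (i, j).
Qed.

Lemma mulmx_norm m n (M : 'M[R]_(m, n)) (v : 'cV[R]_n) :
  `|M *m v| <= n%:R * `|M| * `|v|.
Proof.
apply: mx_norm_le => [|i j]; first by rewrite !mulr_ge0.
by rewrite (ord1 j); apply: mulmx_entry_bound => k; exact: entry_le_norm.
Qed.

Lemma dotv_norm n (u v : 'cV[R]_n) : `|dotv u v| <= n%:R * `|u| * `|v|.
Proof.
rewrite /dotv; apply: le_trans (ler_norm_sum _ _ _) _.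
apply: (@le_trans _ _ (\sum_(i < n) `|u| * `|v|)).
  by apply: ler_sum => j _; rewrite normrM ler_pM// entry_le_norm.
by rewrite sumr_const card_ord -mulrA mulr_natl.
Qed.

Lemma sqv_norm n (u : 'cV[R]_n) : sqv u <= n%:R * `|u| ^+ 2.
Proof.
apply: le_trans (ler_norm _) _; rewrite expr2 mulrA; exact: dotv_norm.
Qed.

Lemma norm_sqv n (u : 'cV[R]_n) : `|u| ^+ 2 <= sqv u.
Proof.
rewrite -[leRHS]sqr_sqrtr ?sqv_ge0// ler_pXn2r ?nnegrE ?sqrtr_ge0//.
apply: mx_norm_le => [|i j]; first exact: sqrtr_ge0.
rewrite (ord1 j) -(@ler_pXn2r _ 2) ?nnegrE ?sqrtr_ge0// sqr_sqrtr ?sqv_ge0//.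
rewrite /sqv /dotv (bigD1 i)//= real_normK ?num_real// expr2 lerDl.
by apply: sumr_ge0 => k _; rewrite -expr2 sqr_ge0.
Qed.

Lemma injective_linv m n (K : 'M[R]_(m, n)) :
  (forall b : 'cV_n, K *m b = 0 -> b = 0) -> exists L, L *m K = 1%:M.
Proof.
move=> h; apply/row_fullP; rewrite /row_full -mxrank_tr.
rewrite -[_ == _]/(row_free K^T) -kermx_eq0; apply/rowV0P => v /sub_kermxP vK.
by apply: trmx_inj; rewrite trmx0; apply: h; rewrite -(trmxK K) -trmx_mul vK trmx0.
Qed.

Lemma injective_coercive m n (K : 'M[R]_(m, n)) :
  (forall b : 'cV_n, K *m b = 0 -> b = 0) ->
  exists2 c : R, 0 < c & forall b : 'cV_n, c * `|b| ^+ 2 <= sqv (K *m b).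
Proof.
move=> /injective_linv[L LK]; pose A := 1 + m%:R * `|L|.
have A0 : 0 < A by rewrite ltr_pwDl// mulr_ge0.
exists (A ^- 2); first by rewrite invr_gt0 exprn_gt0.
move=> b; rewrite ler_pdivrMl ?exprn_gt0//.
apply: (@le_trans _ _ (A ^+ 2 * `|K *m b| ^+ 2)); last first.
  by rewrite ler_pM2l ?exprn_gt0// norm_sqv.
rewrite -exprMn ler_pXn2r ?nnegrE ?mulr_ge0 ?(ltW A0)//.
rewrite -[in leLHS](mul1mx b) -LK -mulmxA; apply: le_trans (mulmx_norm _ _) _.
by rewrite ler_wpM2r// /A lerDr.
Qed.

Lemma sqv_col m n (u : 'cV[R]_m) (v : 'cV[R]_n) : sqv (col_mx u v) = sqv u + sqv v.
Proof.
rewrite /sqv /dotv big_split_ord /=; congr (_ + _); apply: eq_bigr => i _.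
  by rewrite !col_mxEu.
by rewrite !col_mxEd.
Qed.

Lemma dotvC n (u v : 'cV[R]_n) : dotv u v = dotv v u.
Proof. by apply: eq_bigr => i _; rewrite mulrC. Qed.

Lemma dotvDr n (u v w : 'cV[R]_n) : dotv u (v + w) = dotv u v + dotv u w.
Proof. by rewrite /dotv -big_split; apply: eq_bigr => i _; rewrite mxE mulrDr. Qed.

Lemma half_deriv_mul m n (C : 'M[R]_(m, n)) b db :
  half_deriv b db -> half_deriv (fun z => C *m b z) (fun z => C *m db z).
Proof.
move=> [cb hb]; split=> [i|z i z0].
  by apply: (@continuous_mulmx _ _ _ (fun=> C)) => // j k x; exact: cvg_cst.
have -> : (fun t => (C *m b t) i 0) = \sum_j (C i j *: (fun t => b t j 0)).
  by apply/funext => t; rewrite mxE fct_sumE.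
rewrite mxE.
apply: is_derive_sum => j; exact: (is_deriveZ (C i j) (hb z j z0)).
Qed.

Lemma half_derivD n (a b da db : R -> 'cV[R]_n) : half_deriv a da -> half_deriv b db ->
  half_deriv (fun z => a z + b z) (fun z => da z + db z).
Proof.
move=> [ca ha] [cb hb]; split=> [i x|z i z0].
  by rewrite /continuous_at mxE; under eq_fun do rewrite mxE; apply: cvgD; [exact: ca|exact: cb].
have -> : (fun t => (a t + b t) i 0) = (fun t => a t i 0) \+ (fun t => b t i 0).
  by apply/funext => t; rewrite mxE.
by rewrite mxE; exact: is_deriveD (ha z i z0) (hb z i z0).
Qed.

Lemma half_derivN n (a da : R -> 'cV[R]_n) : half_deriv a da ->
  half_deriv (fun z => - a z) (fun z => - da z).
Proof.
move=> [ca ha]; split=> [i x|z i z0].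
  by rewrite /continuous_at mxE; under eq_fun do rewrite mxE; apply: cvgN; exact: ca.
have -> : (fun t => (- a t) i 0) = \- (fun t => a t i 0).
  by apply/funext => t; rewrite mxE.
by rewrite mxE; exact: is_deriveN (ha z i z0).
Qed.

Lemma sqv_continuous n (b db : R -> 'cV[R]_n) : half_deriv b db ->
  continuous (fun z => sqv (b z)).
Proof.
move=> [cb _] x; rewrite /sqv /dotv; apply: cvg_sum => i _.
by apply: cvgM; exact: cb.
Qed.

Lemma sqv_derive n (b db : R -> 'cV[R]_n) (z : R) : half_deriv b db -> 0 < z ->
  is_derive z 1 (fun t => sqv (b t)) (2 * dotv (b z) (db z)).
Proof.
move=> [_ hb] z0.
have -> : (fun t => sqv (b t)) = \sum_i ((fun t => b t i 0) * (fun t => b t i 0)).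
  by apply/funext => t; rewrite fct_sumE.
have -> : 2 * dotv (b z) (db z) = \sum_i (b z i 0 *: db z i 0 + b z i 0 *: db z i 0).
  rewrite /dotv mulr_sumr; apply: eq_bigr => i _; rewrite /GRing.scale /=; ring.
by apply: is_derive_sum => i; exact: (is_deriveM (hb z i z0) (hb z i z0)).
Qed.

End VectorNorms.

(** * The expanding and contracting forms of a dichotomy under forcing *)

Section DichotomyForms.
Variables (R : realType) (n : nat) (G0 : 'M[R]_n) (D : dichotomy G0).

Definition Cplus := formp D *m projp D.
Definition Cminus := formm D *m projm D.
Definition qplus (b : 'cV[R]_n) := sqv (Cplus *m b).
Definition qminus (b : 'cV[R]_n) := sqv (Cminus *m b).
Local Notation theta := (rate D).

Lemma forms_coercive :
  exists2 c : R, 0 < c & forall b, c * `|b| ^+ 2 <= qplus b + qminus b.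
Proof.
have [b|c c0 hc] := @injective_coercive R _ _ (col_mx Cplus Cminus).
  rewrite mul_col_mx -col_mx0 => /eq_col_mx[hp hm].
  apply: (proj_inj (d := D)); first by apply: (formp_inj (d := D)); rewrite mulmxA.
  by apply: (formm_inj (d := D)); rewrite mulmxA.
by exists c => // b; have := hc b; rewrite mul_col_mx sqv_col.
Qed.

Lemma qplus_ge0 b : 0 <= qplus b. Proof. exact: sqv_ge0. Qed.
Lemma qminus_ge0 b : 0 <= qminus b. Proof. exact: sqv_ge0. Qed.

(* A forcing f with |f| <= e |b| + phi, e small, does not destroy the
   exponential dichotomy of b' = G0 b. *)
Lemma forms_ineq : exists2 e : R, 0 < e & exists2 C : R, 0 < C &
  forall (b f : 'cV[R]_n) (phi : R), 0 <= phi -> `|f| <= e * `|b| + phi ->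
  2 * theta * qplus b - theta / 4 * (qplus b + qminus b) - C * phi ^+ 2 <=
    2 * dotv (Cplus *m b) (Cplus *m (G0 *m b + f)) /\
  2 * dotv (Cminus *m b) (Cminus *m (G0 *m b + f)) <=
    - (2 * theta * qminus b) + theta / 4 * (qplus b + qminus b) + C * phi ^+ 2.
Proof.
have [c c0 hc] := forms_coercive.
have th0 := rate_gt0 D.
have cross m (X : 'M[R]_(m, n)) : exists2 K : R, 0 < K & forall b f : 'cV[R]_n,
    `|2 * dotv (X *m b) (X *m f)| <= K * `|b| * `|f|.
  exists (1 + 2 * m%:R * (n%:R * `|X|) ^+ 2).
    by rewrite ltr_pwDl// !mulr_ge0// ?exprn_ge0// ?mulr_ge0.
  move=> b f; rewrite normrM ger0_norm//.
  apply: (@le_trans _ _ (2 * (m%:R * (n%:R * `|X| * `|b|) * (n%:R * `|X| * `|f|)))).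
    rewrite ler_pM2l//; apply: le_trans (dotv_norm _ _) _.
    rewrite ler_pM// ?mulr_ge0// ?mulmx_norm// ler_wpM2l// mulmx_norm//.
  have : 0 <= `|b| * `|f| by rewrite mulr_ge0.
  by set u := n%:R * `|X|; move=> h; nra.
have [Kp Kp0 hKp] := cross _ Cplus; have [Km Km0 hKm] := cross _ Cminus.
pose K := Kp + Km; have K0 : 0 < K by rewrite addr_gt0.
(* Young's inequality: the parts K e |b|^2 and K |b| phi of the forcing each cost c theta |b|^2 / 8,
   together at most a quarter of theta times the sum of the forms, plus C phi^2. *)
pose e := c * theta / (8 * K); pose C := 2 * K ^+ 2 / (c * theta).
have ct0 : 0 < c * theta by rewrite mulr_gt0.
have e0 : 0 < e by rewrite divr_gt0// mulr_gt0.
exists e => //; exists C; first by rewrite divr_gt0// mulr_gt0// exprn_gt0.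
move=> b f phi phi0 hf.
have key : K * `|b| * `|f| <= theta / 4 * (qplus b + qminus b) + C * phi ^+ 2.
  apply: (@le_trans _ _ (K * `|b| * (e * `|b| + phi))).
    by rewrite ler_wpM2l// mulr_ge0// ltW.
  have h1 : K * e * `|b| ^+ 2 = c * theta / 8 * `|b| ^+ 2.
    by rewrite /e; field; rewrite gt_eqF.
  have h2 : K * `|b| * phi <= c * theta / 8 * `|b| ^+ 2 + C * phi ^+ 2.
    have : 0 <= (c * theta * `|b| / 2 - 2 * K * phi) ^+ 2 / (2 * (c * theta)).
      by rewrite divr_ge0 ?sqr_ge0// mulr_ge0// ltW.
    have -> : (c * theta * `|b| / 2 - 2 * K * phi) ^+ 2 / (2 * (c * theta)) =
       c * theta / 8 * `|b| ^+ 2 + C * phi ^+ 2 - K * `|b| * phi.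
      by rewrite /C; field; rewrite !gt_eqF.
    by lra.
  have h3 : c * theta / 4 * `|b| ^+ 2 <= theta / 4 * (qplus b + qminus b).
    have := hc b; rewrite -(ler_pM2l th0) => ?; lra.
  have -> : K * `|b| * (e * `|b| + phi) = K * e * `|b| ^+ 2 + K * `|b| * phi by ring.
  lra.
have bf0 : 0 <= `|b| * `|f| by rewrite mulr_ge0.
have kp : Kp * `|b| * `|f| <= K * `|b| * `|f| by rewrite /K; nra.
have km : Km * `|b| * `|f| <= K * `|b| * `|f| by rewrite /K; nra.
have xp := hKp b f; have xm := hKm b f.
have ep := proj_expand D b; have em := proj_contract D b.
rewrite !mulmxDr !dotvDr -!mulmxA.
rewrite /qplus /qminus /Cplus /Cminus -!mulmxA in xp xm key *.
split.
- by move: xp; rewrite ler_norml => /andP[]; lra.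
- by move: xm; rewrite ler_norml => /andP[]; lra.
Qed.

End DichotomyForms.

(** * Exponential decay inside the cone *)

Section Decay.
Variables (R : realType) (n : nat) (G0 : 'M[R]_n) (D : dichotomy G0).
Local Notation theta := (rate D).

Definition decay_rate : R := theta / 4.
Local Notation kappa := decay_rate.

Lemma decay_rate_gt0 : 0 < kappa.
Proof. by rewrite divr_gt0// rate_gt0. Qed.

(** Nonpositive on the contracting cone, widened by an allowance for a forcing of size eta exp (-
    kappa z). *)
Definition coneF (m eta : R) (b : R -> 'cV[R]_n) (z : R) : R :=
  qplus D (b z) - qminus D (b z) - m * eta ^+ 2 * expR (- (2 * kappa) * z).

Lemma expR_sqr (k z : R) : expR (k * z) ^+ 2 = expR (2 * k * z).
Proof. by rewrite expr2 -expRD; congr expR; ring. Qed.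

(* [coneF] grows like exp (theta z) as soon as it is positive; where it stays
   nonpositive, the contracting part controls everything. *)
Lemma decay_core : exists e m C : R, [/\ 0 < e, 0 < m, 0 < C &
  forall (b db : R -> 'cV[R]_n) (eta T : R), half_deriv b db -> 0 <= eta ->
  (forall z : R, 0 < z -> z < T ->
     `|db z - G0 *m b z| <= e * `|b z| + eta * expR (- kappa * z)) ->
  (forall z0 z1 : R, 0 <= z0 -> z0 <= z1 -> z1 <= T ->
     coneF m eta b z0 * expR (theta * (z1 - z0)) <= coneF m eta b z1) /\
  ((forall z : R, 0 <= z -> z <= T -> coneF m eta b z <= 0) ->
   forall z : R, 0 <= z -> z <= T ->
     `|b z| <= C * (`|projm D *m b 0| + eta) * expR (- kappa * z))].
Proof.
have [e e0 [C0 C00 hform]] := forms_ineq D.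
have [c c0 hc] := forms_coercive D.
have th0 := rate_gt0 D.
(* With this m, 2 kappa m = 2 C0, so the derivative of the allowance cancels the two forcing terms
   in that of [coneF]; and theta m = 4 C0 closes the estimate of the contracting form. *)
pose m := 4 * C0 / theta.
have m0 : 0 < m by rewrite divr_gt0// mulr_gt0.
have [Kq Kq0 hKq] : exists2 K : R, 0 < K & forall b : 'cV[R]_n,
    qminus D b <= K * `|projm D *m b| ^+ 2.
  exists (1 + (szm D)%:R * ((dimm D)%:R * `|formm D|) ^+ 2).
    by rewrite ltr_pwDl// mulr_ge0// exprn_ge0// mulr_ge0.
  move=> b; apply: le_trans (sqv_norm _) _.
  apply: (@le_trans _ _ ((szm D)%:R * ((dimm D)%:R * `|formm D| * `|projm D *m b|) ^+ 2)).
    rewrite ler_wpM2l// ler_pXn2r ?nnegrE ?mulr_ge0//.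
    by rewrite /Cminus -mulmxA mulmx_norm.
  by rewrite exprMn mulrA ler_wpM2r ?sqr_ge0// lerDr.
(* At least 1, so that C may be replaced by its square, and C c dominates the coefficient 2 Kq + 3 m
   of the final estimate. *)
pose C := 1 + (2 * Kq + 3 * m) / c.
have C_c : 2 * Kq + 3 * m <= C * c.
  by rewrite /C [leRHS]mulrDl mul1r divfK ?gt_eqF// lerDr ltW.
have C1 : 1 <= C by rewrite /C lerDl divr_ge0 ?(ltW c0)// addr_ge0// mulr_ge0// ltW.
exists e, m, C; split=> //; first exact: lt_le_trans C1.
move=> b db eta T hb eta0 hdb.
pose E z := expR (- (2 * kappa) * z).
have E0 z : 0 < E z by exact: expR_gt0.
have km : 2 * kappa * m = 2 * C0 by rewrite /kappa /m; field; rewrite gt_eqF.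
have tm : theta * m = 4 * C0 by rewrite /m; field; rewrite gt_eqF.
have hbp := half_deriv_mul (Cplus D) hb; have hbm := half_deriv_mul (Cminus D) hb.
have ineqs z : 0 < z -> z < T ->
    2 * theta * qplus D (b z) - theta / 4 * (qplus D (b z) + qminus D (b z)) - C0 * eta ^+ 2 * E z <=
    2 * dotv (Cplus D *m b z) (Cplus D *m db z) /\
    2 * dotv (Cminus D *m b z) (Cminus D *m db z) <=
    - (2 * theta * qminus D (b z)) + theta / 4 * (qplus D (b z) + qminus D (b z)) + C0 * eta ^+ 2 * E z.
  move=> z0 zT.
  have phi0 : 0 <= eta * expR (- kappa * z) by rewrite mulr_ge0// expR_ge0.
  have := hform (b z) (db z - G0 *m b z) _ phi0 (hdb z z0 zT).
  have -> : G0 *m b z + (db z - G0 *m b z) = db z by rewrite addrC subrK.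
  rewrite exprMn expR_sqr mulrA.
  by rewrite (_ : 2 * - kappa * z = - (2 * kappa) * z)//; ring.
have dE (z : R) : is_derive z 1 (fun t => m * eta ^+ 2 * E t)
    (m * eta ^+ 2 * (- (2 * kappa) * E z)).
  exact: (is_deriveZ (m * eta ^+ 2) (is_derive_expRM _ z)).
have cE : continuous (fun t => m * eta ^+ 2 * E t).
  by move=> x; apply: cvgMl_tmp; exact: continuous_expRM.
have eta20 z : 0 <= eta ^+ 2 * E z by rewrite mulr_ge0 ?sqr_ge0// ltW.
split.
- move=> z0 z1 z00 z01 z1T.
  apply: (@gronwall_ge _ _ (fun z => 2 * dotv (Cplus D *m b z) (Cplus D *m db z)
     - 2 * dotv (Cminus D *m b z) (Cminus D *m db z)
     - m * eta ^+ 2 * (- (2 * kappa) * E z))) => //.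
  + move=> x; apply: cvgB; last exact: cE.
    by apply: cvgB; [exact: (sqv_continuous hbp)|exact: (sqv_continuous hbm)].
  + move=> x z0x xz1; have x0 : 0 < x by exact: le_lt_trans z0x.
    apply: is_deriveB (dE x).
    exact: is_deriveB (sqv_derive hbp x0) (sqv_derive hbm x0).
  + move=> x z0x xz1; have x0 : 0 < x by exact: le_lt_trans z0x.
    have [h1 h2] := ineqs x x0 (lt_le_trans xz1 z1T).
    rewrite /coneF -/(E x).
    have := eta20 x; have := qplus_ge0 D (b x); have := qminus_ge0 D (b x).
    set qp := qplus _ _ in h1 h2 *; set qm := qminus _ _ in h1 h2 *.
    move: h1 h2; rewrite -![_ * eta ^+ 2 * E x]mulrA.
    have -> : m * eta ^+ 2 * (- (2 * kappa) * E x) = - (2 * C0) * (eta ^+ 2 * E x).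
      by rewrite -km; ring.
    set w := eta ^+ 2 * E x => h1 h2 qm0 qp0 w0.
    have tqm : 0 <= theta * qm by rewrite mulr_ge0// ltW.
    have tqp : 0 <= theta * qp by rewrite mulr_ge0// ltW.
    have tmw : 0 <= theta * (m * w) by rewrite mulr_ge0 ?(ltW th0)// mulr_ge0 ?(ltW m0).
    by lra.
- move=> hF z z0 zT.
  have q0 := qminus_ge0 D (b 0).
  (* In the cone the expanding form is bounded by the contracting one plus the allowance, so the
     contracting form satisfies a differential inequality of its own. *)
  have X : qminus D (b z) - m * eta ^+ 2 * E z <=
      (qminus D (b 0) - m * eta ^+ 2 * E 0) * expR (- theta * (z - 0)).
    apply: (@gronwall_le _ (fun z => qminus D (b z) - m * eta ^+ 2 * E z)
       (fun z => 2 * dotv (Cminus D *m b z) (Cminus D *m db z)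
     - m * eta ^+ 2 * (- (2 * kappa) * E z))) => //.
    + by move=> x; apply: cvgB; [exact: (sqv_continuous hbm)|exact: cE].
    + move=> x x0 xz; exact: is_deriveB (sqv_derive hbm x0) (dE x).
    + move=> x x0 xz; have xT := lt_le_trans xz zT.
      have [h1 h2] := ineqs x x0 xT.
      have := hF x (ltW x0) (ltW xT); rewrite /coneF -/(E x).
      have := eta20 x; have := qplus_ge0 D (b x); have := qminus_ge0 D (b x).
      set qp := qplus _ _ in h1 h2 *; set qm := qminus _ _ in h1 h2 *.
      move: h1 h2; rewrite -![_ * eta ^+ 2 * E x]mulrA.
      have -> : m * eta ^+ 2 * (- (2 * kappa) * E x) = - (2 * C0) * (eta ^+ 2 * E x).
        by rewrite -km; ring.
      set w := eta ^+ 2 * E x => h1 h2 qm0 qp0 w0 hF'.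
      have hF2 : theta * qp <= theta * (qm + m * w) by rewrite ler_pM2l//; lra.
      have tmw : theta * (m * w) = 4 * C0 * w by rewrite mulrA tm.
      have : 0 <= theta * qm by rewrite mulr_ge0// ltW.
      have : 0 <= C0 * w by rewrite mulr_ge0// ltW.
      by rewrite mulrDr tmw in hF2; rewrite mulrBr !mulNr tmw; lra.
  have E1 : E 0 = 1 by rewrite /E mulr0 expR0.
  have eE : expR (- theta * (z - 0)) <= E z.
    rewrite /E ler_expR subr0 ler_wpM2r// lerN2 /kappa.
    by have := th0; lra.
  have X2 : qminus D (b z) <= (qminus D (b 0) + m * eta ^+ 2) * E z.
    have h1 : (qminus D (b 0) - m * eta ^+ 2 * E 0) * expR (- theta * (z - 0)) <=
        qminus D (b 0) * E z.
      apply: (@le_trans _ _ (qminus D (b 0) * expR (- theta * (z - 0)))).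
        rewrite ler_wpM2r ?expR_ge0// gerBl E1 mulr1 mulr_ge0 ?sqr_ge0//; exact: ltW.
      by rewrite ler_wpM2l.
    by rewrite mulrDl; lra.
  have hFz := hF z z0 zT; rewrite /coneF -/(E z) in hFz.
  have tot : c * `|b z| ^+ 2 <= (2 * qminus D (b 0) + 3 * m * eta ^+ 2) * E z.
    apply: le_trans (hc _) _; move: hFz X2.
    rewrite -[m * eta ^+ 2 * E z]mulrA; have := eta20 z.
    set w := eta ^+ 2 * E z => w0 hFz X2.
    have -> : (2 * qminus D (b 0) + 3 * m * eta ^+ 2) * E z =
       2 * (qminus D (b 0) * E z) + 3 * (m * w) by rewrite /w; ring.
    have e1 : (qminus D (b 0) + m * eta ^+ 2) * E z = qminus D (b 0) * E z + m * w.
      by rewrite /w; ring.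
    by rewrite e1 in X2; lra.
  set be := `|projm D *m b 0|.
  have be0 : 0 <= be by exact: normr_ge0.
  have hb0 : qminus D (b 0) <= Kq * be ^+ 2 by exact: hKq.
  have sq : `|b z| ^+ 2 <= (C * (be + eta)) ^+ 2 * E z.
    rewrite -(ler_pM2l c0); apply: le_trans tot _.
    rewrite [leRHS]mulrA ler_wpM2r ?(ltW (E0 z))//.
    apply: (@le_trans _ _ ((2 * Kq + 3 * m) * (be + eta) ^+ 2)).
      have : 0 <= Kq * (be * eta) by rewrite mulr_ge0 ?(ltW Kq0)// mulr_ge0.
      have : 0 <= m * (be * eta) by rewrite mulr_ge0 ?(ltW m0)// mulr_ge0.
      have : 0 <= Kq * eta ^+ 2 by rewrite mulr_ge0 ?sqr_ge0 ?(ltW m0) ?(ltW Kq0).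
      have : 0 <= m * be ^+ 2 by rewrite mulr_ge0 ?sqr_ge0 ?(ltW m0) ?(ltW Kq0).
      by move=> *; lra.
    rewrite exprMn [leRHS]mulrA ler_wpM2r ?sqr_ge0//; apply: le_trans C_c _.
    by rewrite mulrC ler_pM2l// ler_eXnr.
  have rhs0 : 0 <= C * (be + eta) * expR (- kappa * z).
    apply: mulr_ge0 (expR_ge0 _); apply: mulr_ge0 (addr_ge0 be0 eta0).
    exact: le_trans C1.
  rewrite -(@ler_pXn2r _ 2) ?nnegrE//.
  rewrite [leRHS]exprMn expR_sqr.
  by rewrite (_ : 2 * - kappa * z = - (2 * kappa) * z)//; ring.
Qed.

(** A vanishing expanding part at T places b(T) in the cone, and a solution that has left the cone
    cannot return; hence b stays in it on [0, T]. *)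
Lemma decay_fin : exists e C : R, [/\ 0 < e, 0 < C &
  forall (b db : R -> 'cV[R]_n) (eta T : R), half_deriv b db -> 0 <= eta -> 0 <= T ->
  projp D *m b T = 0 ->
  (forall z : R, 0 < z -> z < T ->
     `|db z - G0 *m b z| <= e * `|b z| + eta * expR (- kappa * z)) ->
   forall z : R, 0 <= z -> z <= T ->
     `|b z| <= C * (`|projm D *m b 0| + eta) * expR (- kappa * z)].
Proof.
have [e [m [C [e0 m0 C0 core]]]] := decay_core.
exists e, C; split=> // b db eta T hb eta0 T0 bT hdb.
have [grow dec] := core b db eta T hb eta0 hdb.
apply: dec => z z0 zT; rewrite leNgt; apply/negP => Fz.
have := grow z T z0 zT (lexx T); apply/negP; rewrite -ltNge.
apply: (@le_lt_trans _ _ 0); last by rewrite mulr_gt0// expR_gt0.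
have qp0 : qplus D (b T) = 0.
  by rewrite /qplus /Cplus -mulmxA bT mulmx0 /sqv /dotv big1// => i _; rewrite mxE mul0r.
rewrite /coneF qp0 sub0r -opprD oppr_le0 addr_ge0 ?qminus_ge0// !mulr_ge0 ?expR_ge0 ?sqr_ge0//.
exact: ltW.
Qed.

Lemma exp_dominates (A B k z0 : R) : 0 < A -> 0 < k ->
  ~ (forall z, z0 <= z -> A * expR (2 * k * z) <= B * expR (k * z)).
Proof.
move=> A0 k0 h.
(* At this z the bound exp (k z) >= 1 + k z already exceeds B / A. *)
pose z := Num.max z0 (B / (A * k)).
have := h z; rewrite le_max lexx => /(_ isT).
have -> : 2 * k * z = k * z + k * z by ring.
rewrite expRD mulrA ler_pM2r ?expR_gt0//; apply/negP; rewrite -ltNge.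
have : 1 + k * z <= expR (k * z) by exact: expR_ge1Dx.
have : B / (A * k) <= z by rewrite le_max lexx orbT.
rewrite ler_pdivrMr ?mulr_gt0// => h1 h2.
apply: (@lt_le_trans _ _ (A * (1 + k * z))); last by rewrite ler_pM2l.
by rewrite mulrDr mulr1; lra.
Qed.

(** Out of the cone [coneF] would grow like exp (theta z), faster than the assumed growth exp (theta
    z / 2) of |b|^2. *)
Lemma decay_inf : exists e C : R, [/\ 0 < e, 0 < C &
  forall (b db : R -> 'cV[R]_n) (eta B : R), half_deriv b db -> 0 <= eta ->
  (forall z : R, 0 <= z -> `|b z| ^+ 2 <= B * expR (theta / 2 * z)) ->
  (forall z : R, 0 < z ->
     `|db z - G0 *m b z| <= e * `|b z| + eta * expR (- kappa * z)) ->
   forall z : R, 0 <= z ->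
     `|b z| <= C * (`|projm D *m b 0| + eta) * expR (- kappa * z)].
Proof.
have [e [m [C [e0 m0 C0 core]]]] := decay_core.
exists e, C; split=> // b db eta B hb eta0 bB hdb.
have hdbT T (z : R) : 0 < z -> z < T ->
     `|db z - G0 *m b z| <= e * `|b z| + eta * expR (- kappa * z).
  by move=> z0 _; exact: hdb.
have cone z : 0 <= z -> coneF m eta b z <= 0.
  move=> z0; rewrite leNgt; apply/negP => Fz.
  have [Kq Kq0 hKq] : exists2 K : R, 0 <= K & forall b : 'cV[R]_n,
      qplus D b <= K * `|b| ^+ 2.
    exists ((szp D)%:R * (n%:R * `|Cplus D|) ^+ 2).
      by rewrite mulr_ge0// exprn_ge0// mulr_ge0.
    move=> b'; apply: le_trans (sqv_norm _) _.
    rewrite -mulrA -exprMn ler_wpM2l// ler_pXn2r ?nnegrE ?mulr_ge0//.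
    exact: mulmx_norm.
  have th0 := rate_gt0 D.
  apply: (@exp_dominates (coneF m eta b z * expR (- theta * z)) (Kq * B) (theta / 2) z).
  - by rewrite mulr_gt0// expR_gt0.
  - by rewrite divr_gt0.
  - move=> z1 zz1; have [grow _] := core b db eta z1 hb eta0 (hdbT z1).
    have := grow z z1 z0 zz1 (lexx _).
    have -> : theta * (z1 - z) = - theta * z + 2 * (theta / 2) * z1 by field.
    rewrite expRD mulrA => /le_trans; apply.
    apply: (@le_trans _ _ (qplus D (b z1))).
      rewrite /coneF -addrA gerDl -opprD oppr_le0 addr_ge0 ?qminus_ge0//.
      by rewrite !mulr_ge0 ?expR_ge0 ?sqr_ge0// ltW.
    apply: le_trans (hKq _) _; rewrite -mulrA ler_wpM2l// bB//.
    exact: le_trans zz1.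
move=> z z0; have [_ dec] := core b db eta z hb eta0 (hdbT z).
by apply: dec => // x x0 _; exact: cone.
Qed.

End Decay.

(** * The perturbed system in a and b, and its slow variable *)

Section System.
Variables (R : realType) (N n : nat) (G0 : 'M[R]_n) (D : dichotomy G0).
Variable H0 : 'M[R]_(N, n).
Hypothesis G0_unit : G0 \in unitmx.
Local Notation theta := (rate D).
Local Notation kappa := (decay_rate D).

(** For a' = H0 b and b' = G0 b the combination a - H0 G0^-1 b is conserved; it is the slow variable
    below. *)
Definition slow_mx : 'M[R]_(N, n) := H0 *m invmx G0.
Local Notation E0 := slow_mx.

Record coefs := Coefs {
  cHb : R -> 'M[R]_(N, n); cHa : R -> 'M[R]_(N, N);
  cGb : R -> 'M[R]_(n, n); cGa : R -> 'M[R]_(n, N)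
}.

Definition perturbed (eps : R) (X : coefs) : Prop := forall z, 0 <= z ->
  [/\ `|cHb X z - H0| <= eps, `|cGb X z - G0| <= eps,
      `|cHa X z| <= eps * expR (- kappa * z) &
      `|cGa X z| <= eps * expR (- kappa * z)].

Definition sys (X : coefs) (a : R -> 'cV[R]_N) (b : R -> 'cV[R]_n) : Prop :=
  half_deriv a (fun z => cHb X z *m b z + cHa X z *m a z) /\
  half_deriv b (fun z => cGb X z *m b z + cGa X z *m a z).

Definition slow_var (a : R -> 'cV[R]_N) (b : R -> 'cV[R]_n) z := a z - E0 *m b z.

Lemma forcing_b (eps : R) X (a : R -> 'cV[R]_N) (b : R -> 'cV[R]_n) (m z : R) :
  perturbed eps X -> 0 <= z -> `|a z| <= m ->
  `|cGb X z *m b z + cGa X z *m a z - G0 *m b z| <=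
  n%:R * eps * `|b z| + (N%:R * eps * m) * expR (- kappa * z).
Proof.
move=> hX z0 am; have [_ h2 _ h4] := hX z z0.
have -> : cGb X z *m b z + cGa X z *m a z - G0 *m b z =
    (cGb X z - G0) *m b z + cGa X z *m a z by rewrite mulmxBl addrAC.
apply: le_trans (ler_normD _ _) _; apply: lerD.
  by apply: le_trans (mulmx_norm _ _) _; rewrite ler_wpM2r// ler_wpM2l.
apply: le_trans (mulmx_norm _ _) _.
have -> : N%:R * eps * m * expR (- kappa * z) =
    N%:R * (eps * expR (- kappa * z) * m) by ring.
by rewrite -mulrA ler_wpM2l// ler_pM.
Qed.

Lemma slow_var_deriv X a b : sys X a b ->
  half_deriv (slow_var a b) (fun z => cHb X z *m b z + cHa X z *m a z
     - E0 *m (cGb X z *m b z + cGa X z *m a z)).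
Proof.
by move=> [ha hb]; exact: half_derivD ha (half_derivN (half_deriv_mul E0 hb)).
Qed.

Definition slow_cst : R := (n%:R + N%:R) * (1 + n%:R * `|E0|).

Lemma slow_cst_ge0 : 0 <= slow_cst.
Proof. by rewrite mulr_ge0// addr_ge0// mulr_ge0. Qed.

(** The leading terms H0 b and E0 G0 b cancel, which leaves coefficients of size eps. *)
Lemma slow_var_dbound (eps : R) X (a : R -> 'cV[R]_N) (b : R -> 'cV[R]_n) (z : R) :
  perturbed eps X -> 0 <= z ->
  `|cHb X z *m b z + cHa X z *m a z - E0 *m (cGb X z *m b z + cGa X z *m a z)|
  <= slow_cst * eps * (`|b z| + expR (- kappa * z) * `|a z|).
Proof.
move=> hX z0; have [h1 h2 h3 h4] := hX z z0.
have eps0 : 0 <= eps by apply: le_trans h1.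
set E := expR _ in h3 h4 *; have Ege0 : 0 <= E by exact: expR_ge0.
have -> : cHb X z *m b z + cHa X z *m a z - E0 *m (cGb X z *m b z + cGa X z *m a z)
   = ((cHb X z - H0) *m b z + cHa X z *m a z) -
     E0 *m ((cGb X z - G0) *m b z + cGa X z *m a z).
  have EG : E0 *m (G0 *m b z) = H0 *m b z by rewrite mulmxA mulmxKV.
  rewrite !mulmxBl !mulmxDr mulmxN EG.
  by apply/matrixP => i j; rewrite !mxE; ring.
have part m (M : 'M[R]_(m, n)) (M' : 'M[R]_(m, N)) : `|M| <= eps -> `|M'| <= eps * E ->
    `|M *m b z + M' *m a z| <= (n%:R + N%:R) * eps * (`|b z| + E * `|a z|).
  move=> hM hM'; apply: le_trans (ler_normD _ _) _.
  apply: (@le_trans _ _ (n%:R * eps * `|b z| + N%:R * (eps * E) * `|a z|)).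
    apply: lerD; apply: le_trans (mulmx_norm _ _) _; by rewrite ler_wpM2r// ler_wpM2l.
  have w1 : 0 <= N%:R * (eps * `|b z|) by rewrite !mulr_ge0.
  have w2 : 0 <= n%:R * (eps * (E * `|a z|)).
    by rewrite mulr_ge0// mulr_ge0// mulr_ge0.
  have -> : (n%:R + N%:R) * eps * (`|b z| + E * `|a z|) =
     n%:R * eps * `|b z| + N%:R * (eps * E) * `|a z| + (N%:R * (eps * `|b z|) +
       n%:R * (eps * (E * `|a z|))) by ring.
  by rewrite lerDl addr_ge0.
have p1 := part _ _ _ h1 h3; have p2 := part _ _ _ h2 h4.
apply: le_trans (ler_normB _ _) _.
apply: (@le_trans _ _ ((n%:R + N%:R) * eps * (`|b z| + E * `|a z|) +
   n%:R * `|E0| * ((n%:R + N%:R) * eps * (`|b z| + E * `|a z|)))).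
  apply: lerD => //; apply: le_trans (mulmx_norm _ _) _.
  by rewrite ler_wpM2l// mulr_ge0.
by rewrite /slow_cst le_eqVlt; apply/orP; left; apply/eqP; ring.
Qed.

(** Every term of the derivative carries the factor exp (- kappa z), whose integral is at most 1 /
    kappa. *)
Lemma slow_var_osc (eps : R) X a b (B m T : R) : sys X a b -> perturbed eps X ->
  (forall z, 0 <= z -> z <= T -> `|a z| <= m) ->
  (forall z, 0 <= z -> z <= T -> `|b z| <= B * expR (- kappa * z)) ->
  forall z z', 0 <= z -> z <= z' -> z' <= T ->
  `|slow_var a b z' - slow_var a b z| <= slow_cst * eps / kappa * (B + m).
Proof.
move=> hs hX am bB z z' z0 zz' z'T.
have k0 := decay_rate_gt0 D.
have [h1 _ _ _] := hX 0 (lexx _); have eps0 : 0 <= eps by apply: le_trans h1.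
have m0 : 0 <= m by apply: le_trans (am z z0 (le_trans zz' z'T)).
have B0 : 0 <= B.
  have := bB z z0 (le_trans zz' z'T) => /(le_trans (normr_ge0 _)).
  by rewrite pmulr_lge0// expR_gt0.
have [cc dc] := slow_var_deriv hs.
pose A := slow_cst * eps / kappa * (B + m).
have A0 : 0 <= A.
  by rewrite mulr_ge0 ?addr_ge0// divr_ge0 ?(ltW k0)// mulr_ge0// slow_cst_ge0.
apply: mx_norm_le => // i j; rewrite (ord1 j) !mxE.
have cg : continuous (fun t => - A * expR (- kappa * t)).
  by move=> x; apply: cvgMl_tmp; exact: continuous_expRM.
have dg (x : R) : z < x -> x < z' -> is_derive x 1 (fun t => - A * expR (- kappa * t))
    (- A * (- kappa * expR (- kappa * x))).
  by move=> _ _; exact: (is_deriveZ (- A) (is_derive_expRM _ x)).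
have df (x : R) : z < x -> x < z' -> is_derive x 1 (fun t => slow_var a b t i 0)
   ((cHb X x *m b x + cHa X x *m a x - E0 *m (cGb X x *m b x + cGa X x *m a x)) i 0).
  by move=> zx _; apply: dc; exact: le_lt_trans zx.
have dle (x : R) : z < x -> x < z' -> `|(cHb X x *m b x + cHa X x *m a x
    - E0 *m (cGb X x *m b x + cGa X x *m a x)) i 0| <= - A * (- kappa * expR (- kappa * x)).
  move=> zx xz'; have x0 : 0 <= x by exact: le_trans (ltW zx).
  have xT : x <= T by exact: le_trans (ltW xz') z'T.
  apply: le_trans (entry_le_norm _ _ _) _.
  apply: le_trans (slow_var_dbound a b hX x0) _.
  have -> : - A * (- kappa * expR (- kappa * x)) =
      slow_cst * eps * (B * expR (- kappa * x) + expR (- kappa * x) * m).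
    by rewrite /A; field; rewrite gt_eqF.
  rewrite ler_wpM2l ?mulr_ge0 ?slow_cst_ge0// lerD ?bB//.
  by rewrite ler_wpM2l ?expR_ge0// am.
have := is_derive_dist zz' (cc i) cg df dg dle.
rewrite /slow_var !mxE => h; apply: le_trans h _.
rewrite -mulrBr mulNr -mulrN opprB ler_piMr// lerBlDr.
apply: (@le_trans _ _ 1); last by rewrite lerDl expR_ge0.
by rewrite -expR0 ler_expR mulNr oppr_le0 mulr_ge0// ltW.
Qed.

(** Iterates the improvement of a bound m into A + m / 2, whose fixed point is 2 A. *)
Lemma halving_bound (m A : R) (P : R -> Prop) :
  P m -> (forall m, P m -> P (A + m / 2)) -> forall k, P (2 * A + (m - 2 * A) * 2^-1 ^+ k).
Proof.
move=> Pm hP; elim=> [|k IHk]; first by rewrite expr0 mulr1 addrC subrK.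
have := hP _ IHk; rewrite exprS.
by rewrite (_ : A + _ / 2 = 2 * A + (m - 2 * A) * (2^-1 * 2^-1 ^+ k))//; field.
Qed.

Lemma le_geometric (x A B : R) : (forall k, x <= A + B * 2^-1 ^+ k) -> x <= A.
Proof.
move=> h.
have c : A + B * 2^-1 ^+ k @[k --> \oo] --> A.
  rewrite -[X in _ --> X](addr0 A) -[X in _ --> _ + X](mulr0 B).
  apply: cvgD; first exact: cvg_cst.
  apply: cvgMl_tmp; apply: cvg_expr.
  by rewrite ger0_norm ?invr_ge0// invf_lt1// ltr1n.
by have := cvgP _ c => /limr_ge; move/cvg_lim : c => ->//; apply; exact: nearW.
Qed.

Lemma continuous_bounded_itv k (a : R -> 'cV[R]_k) (T : R) :
  (forall i, continuous (fun z => a z i 0)) ->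
  exists m : R, forall z, 0 <= z -> z <= T -> `|a z| <= m.
Proof.
move=> ca; have [T0|T0] := ltP T 0.
  by exists 0 => z z0 /(le_trans z0); rewrite leNgt T0.
have h i : exists m : R, forall z, 0 <= z -> z <= T -> `|a z i 0| <= m.
  have cn : {within `[0, T], continuous (fun z => `|a z i 0|)}.
    apply: continuous_subspaceT => x; apply: cvg_norm; exact: ca.
  have [c _ hc] := EVT_max T0 cn.
  by exists `|a c i 0| => z z0 zT; apply: hc; rewrite in_itv /= z0.
have [m hm] := choice h.
exists (\sum_i `|m i|) => z z0 zT; apply: mx_norm_le => [|i j].
  by apply: sumr_ge0.
rewrite (ord1 j); apply: le_trans (hm i z z0 zT) _.
apply: le_trans (ler_norm _) _; rewrite (bigD1 i)//= lerDl.
exact: sumr_ge0.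
Qed.

(** The constants do not depend on T. A bound m on a makes b decay, so the slow variable varies
    little, and a satisfies a better bound of the form A + m / 2; iteration eliminates m. *)
Lemma bvp_bound : exists eps0 C : R, [/\ 0 < eps0, 0 < C &
  forall (eps : R) X a b (T : R), eps <= eps0 -> perturbed eps X -> sys X a b ->
  0 <= T -> projp D *m b T = 0 ->
  forall z, 0 <= z -> z <= T ->
    `|a z| <= C * (`|a 0| + `|projm D *m b 0|) /\
    `|b z| <= C * (`|a 0| + `|projm D *m b 0|) * expR (- kappa * z)].
Proof.
have [e [Cd [e0 Cd0 dec]]] := decay_fin D.
have k0 := decay_rate_gt0 D.
pose e1 := n%:R * `|E0|; have e10 : 0 <= e1 by rewrite mulr_ge0.
pose e2 := slow_cst / kappa.
have e20 : 0 <= e2 by rewrite divr_ge0 ?slow_cst_ge0// ltW.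
(* [K2] and [K3] collect the coefficients of eps m and of [be] in the bound on |a z| of [step]. The
   choice of [eps0] below gives eps K2 <= 1/2 and n eps <= e. *)
pose K2 := 2 * e1 * Cd * N%:R + e2 * (Cd * N%:R + 1).
pose K3 := 2 * e1 * Cd + e2 * Cd.
have CN0 : 0 <= Cd * N%:R by rewrite mulr_ge0// ltW.
have K20 : 0 <= K2.
  by rewrite /K2; do ?[exact: e10 | exact: e20 | exact: (ltW Cd0) | apply: addr_ge0 | apply: mulr_ge0].
have K30 : 0 <= K3.
  by rewrite /K3; do ?[exact: e10 | exact: e20 | exact: (ltW Cd0) | apply: addr_ge0 | apply: mulr_ge0].
pose eps0 := Num.min 1 (Num.min (e / (n%:R + 1)) (1 / (2 * (K2 + 1)))).
have n1 : 0 < n%:R + 1 :> R by rewrite ltr_wpDl.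
have K21 : 0 < 2 * (K2 + 1) by rewrite mulr_gt0// ltr_wpDl.
pose A1 := 2 * (1 + K3).
have A10 : 0 < A1 by rewrite mulr_gt0// ltr_pwDl.
pose C := A1 + Cd * (1 + N%:R * A1).
have C0 : 0 < C by rewrite ltr_pwDl// mulr_ge0 ?(ltW Cd0)// addr_ge0// mulr_ge0// ltW.
exists eps0, C; split => //.
  by rewrite !lt_min ltr01 !divr_gt0.
move=> eps X a b T; rewrite !le_min => /andP[eps1 /andP[epse epsK]] hX hs T0 bT.
have [h1 _ _ _] := hX 0 (lexx _); have epsge0 : 0 <= eps by apply: le_trans h1.
have epsK2 : eps * K2 <= 1 / 2.
  rewrite ler_pdivlMr// in epsK; lra.
have nee : n%:R * eps <= e.
  rewrite ler_pdivlMr// in epse; lra.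
set be := `|projm D *m b 0|; have be0 : 0 <= be by exact: normr_ge0.
have [ha hb] := hs.
have bbound m : (forall z, 0 <= z -> z <= T -> `|a z| <= m) ->
    forall z, 0 <= z -> z <= T -> `|b z| <= Cd * (be + N%:R * eps * m) * expR (- kappa * z).
  move=> am; apply: (dec b _ (N%:R * eps * m) T hb) => //.
    by rewrite !mulr_ge0//; apply: le_trans (am 0 (lexx _) T0).
  move=> z z0 zT; apply: le_trans (forcing_b b hX (ltW z0) (am z (ltW z0) (ltW zT))) _.
  by rewrite lerD2r ler_wpM2r.
have E1 z : 0 <= z -> expR (- kappa * z) <= 1.
  by move=> z0; rewrite -expR0 ler_expR mulNr oppr_le0 mulr_ge0// ltW.
have step m : (forall z, 0 <= z -> z <= T -> `|a z| <= m) ->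
    forall z, 0 <= z -> z <= T -> `|a z| <= (1 + K3) * (`|a 0| + be) + m / 2.
  move=> am z z0 zT; have bb := bbound m am.
  have m0 : 0 <= m by apply: le_trans (am 0 (lexx _) T0).
  pose B := Cd * (be + N%:R * eps * m).
  have B0 : 0 <= B by rewrite mulr_ge0 ?(ltW Cd0)// addr_ge0// !mulr_ge0.
  have bB x : 0 <= x -> x <= T -> `|b x| <= B.
    move=> x0 xT; apply: le_trans (bb x x0 xT) _; rewrite ler_piMr//; exact: E1.
  have osc := slow_var_osc hs hX am bb (lexx 0) z0 zT.
  have az : a z = (slow_var a b z - slow_var a b 0) + (a 0 - E0 *m b 0) + E0 *m b z.
    by rewrite /slow_var; apply/matrixP => i j; rewrite !mxE; ring.
  have E0b x : 0 <= x -> x <= T -> `|E0 *m b x| <= e1 * B.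
    move=> x0 xT; apply: le_trans (mulmx_norm _ _) _.
    by rewrite ler_wpM2l// bB.
  have h3 : `|a z| <= e2 * eps * (B + m) + (`|a 0| + e1 * B) + e1 * B.
    rewrite {1}az; apply: le_trans (ler_normD _ _) _; apply: lerD; last exact: E0b.
    apply: le_trans (ler_normD _ _) _; apply: lerD.
      by rewrite (_ : e2 * eps = slow_cst * eps / kappa)// /e2 mulrAC.
    by apply: le_trans (ler_normB _ _) _; rewrite lerD2l; exact: E0b.
  apply: le_trans h3 _.
  have -> : e2 * eps * (B + m) + (`|a 0| + e1 * B) + e1 * B =
     `|a 0| + (2 * e1 * Cd + eps * (e2 * Cd)) * be +
     eps * m * (2 * e1 * Cd * N%:R + e2 * (eps * (Cd * N%:R) + 1)).
    by rewrite /B; ring.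
  have w1 : eps * (e2 * Cd) <= e2 * Cd by rewrite ler_piMl// mulr_ge0// ltW.
  have w2 : eps * (Cd * N%:R) <= Cd * N%:R by rewrite ler_piMl.
  have w3 : (2 * e1 * Cd + eps * (e2 * Cd)) * be <= K3 * be.
    by rewrite ler_wpM2r// lerD2l.
  have w4 : eps * m * (2 * e1 * Cd * N%:R + e2 * (eps * (Cd * N%:R) + 1)) <= eps * m * K2.
    by rewrite ler_wpM2l ?mulr_ge0// lerD2l ler_wpM2l// lerD2r.
  have w5 : eps * m * K2 <= m / 2.
    by rewrite mulrAC mulrC; have := ler_wpM2l m0 epsK2; lra.
  have w6 : 0 <= K3 * `|a 0| by rewrite mulr_ge0.
  lra.
have [m0 hm0] := continuous_bounded_itv T (ha.1).
have aA z : 0 <= z -> z <= T -> `|a z| <= A1 * (`|a 0| + be).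
  move=> z0 zT.
  apply: (@le_geometric _ _ (m0 - 2 * ((1 + K3) * (`|a 0| + be)))) => k.
  have := @halving_bound m0 ((1 + K3) * (`|a 0| + be))
    (fun m => forall z, 0 <= z -> z <= T -> `|a z| <= m) hm0 step k z z0 zT.
  by rewrite /A1 -[in X in _ -> X]mulrA.
have S0 : 0 <= `|a 0| + be by rewrite addr_ge0.
move=> z z0 zT; split.
- apply: le_trans (aA z z0 zT) _; rewrite ler_wpM2r// /C lerDl mulr_ge0 ?(ltW Cd0)//.
  by rewrite addr_ge0// mulr_ge0// ltW.
- apply: le_trans (bbound _ aA z z0 zT) _; rewrite ler_wpM2r ?expR_ge0//.
  have w1 : N%:R * eps * (A1 * (`|a 0| + be)) <= N%:R * (A1 * (`|a 0| + be)).
    rewrite -mulrA ler_wpM2l// ler_piMl// mulr_ge0//; exact: ltW.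
  have w2 : Cd * (be + N%:R * eps * (A1 * (`|a 0| + be))) <=
     Cd * ((1 + N%:R * A1) * (`|a 0| + be)).
    rewrite ler_pM2l//; have := normr_ge0 (a 0); lra.
  apply: le_trans w2 _; rewrite mulrA ler_wpM2r// /C lerDr; exact: ltW.
Qed.

End System.

(** * Uniqueness of solutions tending to zero *)

Section DecayingSolutions.
Variables (R : realType) (N n : nat) (G0 : 'M[R]_n) (D : dichotomy G0).
Variable H0 : 'M[R]_(N, n).
Hypothesis G0_unit : G0 \in unitmx.
Local Notation theta := (rate D).
Local Notation kappa := (decay_rate D).
Local Notation E0 := (slow_mx G0 H0).

Lemma mulmx_linv (m k : nat) (A : 'M[R]_(m, k)) (B : 'M[R]_(k, m)) :
  m = k -> B *m A = 1%:M -> A *m B = 1%:M.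
Proof. by move=> e; case: k / e A B => A B; exact: mulmx1C. Qed.

Lemma bounded_seq_cluster k (u : nat -> 'rV[R]_k) (C : R) :
  (forall i, `|u i| <= C) ->
  exists x, forall i0 (d : R), 0 < d -> exists2 i, (i0 <= i)%N & `|x - u i| < d.
Proof.
move=> hu; pose A : set 'rV[R]_k := [set x | `|x| <= C].
have cA : compact A.
  apply: bounded_closed_compact.
    exists C; split; first exact: num_real.
    by move=> M CM x /= xC; apply: le_trans xC _; exact: ltW.
  have -> : A = (fun x : 'rV[R]_k => `|x|) @^-1` [set y | y <= C] by [].
  by apply: closed_comp; [move=> x _; exact: norm_continuous|exact: closed_le].
have [x [_ cx]] : A `&` cluster (u i @[i --> \oo]) !=set0.
  apply: cA; exists 0%N => // i _; exact: hu.
exists x => i0 d d0.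
have [y [[i /= i0i <-] yd]] : [set u i | i in [set i | (i0 <= i)%N]] `&` ball x d !=set0.
  apply: cx; last exact: nbhsx_ballx.
  by exists i0 => // i /= i0i; exists i.
exists i => //.
by move: yd; rewrite -ball_normE.
Qed.

Lemma norm_trmx (m k : nat) (A : 'M[R]_(m, k)) : `|A^T| = `|A|.
Proof.
apply/eqP; rewrite eq_le; apply/andP; split; apply: mx_norm_le => // i j.
  by rewrite mxE entry_le_norm.
by have := entry_le_norm A^T j i; rewrite mxE.
Qed.

(** Since a and b tend to 0, so does the slow variable c, which is therefore bounded by its
    oscillation, of order eps. The condition at 0 bounds b(0) by c(0). As a = c + E0 b, a bound m on
    a improves to m / 2, and a = 0. *)
Lemma decaying_unique (Q : 'M[R]_(n, N)) (C3 : R) : Q *m E0 = 1%:M -> 0 <= C3 ->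
  exists2 eps0 : R, 0 < eps0 & forall (eps : R) X a b, eps <= eps0 ->
  perturbed D H0 eps X -> sys X a b ->
  (forall e : R, 0 < e -> exists Z, forall z, Z <= z -> `|a z| <= e) ->
  `|b 0| <= C3 * `|slow_var G0 H0 a b 0| -> forall z, 0 <= z -> a z = 0.
Proof.
move=> QE C30.
have [e [Cd [e0 Cd0 dec]]] := decay_inf D.
have k0 := decay_rate_gt0 D.
have th0 := rate_gt0 D.
have K0 : 0 <= slow_cst G0 H0 by exact: slow_cst_ge0.
set K := slow_cst G0 H0 in K0.
have [q [q0 hq]] : exists q : R, 0 <= q /\ forall v : 'cV_N, `|Q *m v| <= q * `|v|.
  by exists (N%:R * `|Q|); split=> [|v]; [rewrite mulr_ge0|exact: mulmx_norm].
have [e1 [e10 he1]] : exists q : R, 0 <= q /\ forall v : 'cV_n, `|E0 *m v| <= q * `|v|.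
  by exists (n%:R * `|E0|); split=> [|v]; [rewrite mulr_ge0|exact: mulmx_norm].
have [P1 [P10 hP1]] : exists q : R, 0 <= q /\ forall v : 'cV_n, `|projm D *m v| <= q * `|v|.
  by exists (n%:R * `|projm D|); split=> [|v]; [rewrite mulr_ge0|exact: mulmx_norm].
(* [K4] governs the growth rate of |c|^2 + m^2, [K5] the oscillation of c and [K6] the resulting
   bound on a. Each is multiplied by eps, and eps is chosen to make the products small. *)
pose K4 := 4 * N%:R * K * (q + 1).
have K40 : 0 <= K4 by do ?[exact: K0 | exact: q0 | apply: addr_ge0 | apply: mulr_ge0].
have [e2 [e20 e2E]] : exists e2, 0 <= e2 /\ K / kappa = e2.
  by exists (K / kappa); rewrite divr_ge0// ltW.
have CN0 : 0 <= Cd * N%:R by rewrite mulr_ge0// ltW.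
pose K5 := e2 * (Cd + Cd * N%:R + 1).
have K50 : 0 <= K5.
  by do ?[exact: e20 | exact: CN0 | exact: (ltW Cd0) | apply: addr_ge0 | apply: mulr_ge0].
pose K6 := 2 * K5 * (1 + e1 * Cd * P1 * C3) + e1 * Cd * N%:R.
have K60 : 0 <= K6.
  by do ?[exact: e10 | exact: K50 | exact: P10 | exact: C30 | exact: (ltW Cd0)
         | apply: addr_ge0 | apply: mulr_ge0].
have n1 : 0 < n%:R + 1 :> R by rewrite ltr_wpDl.
have K51 : 0 < 2 * (K5 * P1 * C3 + 1) by rewrite mulr_gt0// ltr_wpDl//; exact: (mulr_ge0 (mulr_ge0 K50 P10) C30).
have K41 : 0 < 2 * (K4 + 1) by rewrite mulr_gt0// ltr_wpDl.
have K61 : 0 < 2 * (K6 + 1) by rewrite mulr_gt0// ltr_wpDl.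
exists (Num.min 1 (Num.min (e / (n%:R + 1)) (Num.min (theta / (2 * (K4 + 1)))
  (Num.min (1 / (2 * (K5 * P1 * C3 + 1))) (1 / (2 * (K6 + 1))))))).
  by rewrite !lt_min ltr01 !divr_gt0.
move=> eps X a b; rewrite !le_min => /andP[eps1 /andP[epse /andP[eps4 /andP[eps5 eps6]]]].
rewrite ler_pdivlMr// in epse; rewrite ler_pdivlMr// in eps4.
rewrite ler_pdivlMr// in eps5; rewrite ler_pdivlMr// in eps6.
move=> hX hs alim bc0.
have [h1 _ _ _] := hX 0 (lexx _); have epsge0 : 0 <= eps by apply: le_trans h1.
have nee : n%:R * eps <= e by lra.
have e4 : eps * K4 <= theta / 2 by lra.
have e5 : eps * (K5 * P1 * C3) <= 1 / 2 by lra.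
have e6 : eps * K6 <= 1 / 2 by lra.
have [ha hb] := hs; have hc := slow_var_deriv G0 H0 hs.
set c := slow_var G0 H0 a b in hc bc0.
have bE z : b z = Q *m (a z - c z).
  by rewrite /c /slow_var opprB addrCA subrr addr0 mulmxA QE mul1mx.
have E1 z : 0 <= z -> expR (- kappa * z) <= 1.
  by move=> z0; rewrite -expR0 ler_expR mulNr oppr_le0 mulr_ge0// ltW.
set be := `|projm D *m b 0|; have be0 : 0 <= be by exact: normr_ge0.
(* a bounded forces b to grow slower than the cone *)
have bbound m : (forall z, 0 <= z -> `|a z| <= m) ->
    forall z, 0 <= z -> `|b z| <= Cd * (be + N%:R * eps * m) * expR (- kappa * z).
  move=> am; have m0 : 0 <= m by apply: le_trans (am 0 (lexx _)).
  (* Adding m^2 closes the differential inequality: the derivative is at most eps K4 (|c|^2 + m^2),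
     and eps K4 <= theta / 2 is the growth allowed by [decay_inf]. *)
  pose s z := sqv (c z) + m ^+ 2.
  have bz z : 0 <= z -> `|b z| <= q * (m + `|c z|).
    move=> z0; rewrite bE; apply: le_trans (hq _) _; rewrite ler_wpM2l//.
    by apply: le_trans (ler_normB _ _) _; rewrite lerD2r am.
  have sgrow z : 0 <= z -> s z <= s 0 * expR (theta / 2 * z).
    move=> z0.
    have := @gronwall_le R s (fun z => 2 * dotv (c z) (cHb X z *m b z + cHa X z *m a z
     - E0 *m (cGb X z *m b z + cGa X z *m a z)) + 0) (theta / 2) 0 z z0.
    rewrite subr0; apply.
    - by move=> x; apply: cvgD; [exact: (sqv_continuous hc)|exact: cvg_cst].
    - by move=> x x0 _; exact: is_deriveD (sqv_derive hc x0) (is_derive_cst _ _ _).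
    - move=> x /ltW x0 _; rewrite addr0.
      set dc := _ - _.
      have dcb : `|dc| <= K * eps * (`|b x| + m).
        apply: le_trans (slow_var_dbound G0_unit a b hX x0) _.
        rewrite ler_wpM2l ?mulr_ge0// lerD2l.
        by rewrite -[leRHS]mul1r ler_pM ?expR_ge0 ?E1 ?am.
      have d1 : dotv (c x) dc <= N%:R * `|c x| * (K * eps * (q * (m + `|c x|) + m)).
        apply: le_trans (ler_norm _) _; apply: le_trans (dotv_norm _ _) _.
        rewrite ler_wpM2l ?mulr_ge0//; apply: le_trans dcb _.
        by rewrite ler_wpM2l ?mulr_ge0// lerD2r bz.
      have nc0 : 0 <= `|c x| by [].
      have d2 : `|c x| * (q * (m + `|c x|) + m) <= 2 * (q + 1) * (`|c x| ^+ 2 + m ^+ 2).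
        have : 0 <= (`|c x| - m) ^+ 2 by exact: sqr_ge0.
        have : 0 <= q * (`|c x| - m) ^+ 2 by rewrite mulr_ge0// sqr_ge0.
        have : 0 <= q * `|c x| ^+ 2 by rewrite mulr_ge0// sqr_ge0.
        have : 0 <= q * m ^+ 2 by rewrite mulr_ge0// sqr_ge0.
        have : 0 <= m ^+ 2 by exact: sqr_ge0.
        have : 0 <= `|c x| ^+ 2 by exact: sqr_ge0.
        by move: (`|c x|) => y *; lra.
      have d3 : `|c x| ^+ 2 + m ^+ 2 <= s x by rewrite /s lerD2r norm_sqv.
      have d4 : 2 * dotv (c x) dc <= eps * K4 * (`|c x| ^+ 2 + m ^+ 2).
        have := ler_wpM2l (mulr_ge0 (mulr_ge0 (ler0n R N) K0) epsge0) d2.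
        by rewrite /K4; lra.
      apply: le_trans d4 _; apply: ler_pM => //.
        by rewrite mulr_ge0.
      by rewrite addr_ge0// sqr_ge0.
  apply: (dec b _ (N%:R * eps * m) (4 * q ^+ 2 * s 0) hb) => //.
  - by rewrite !mulr_ge0.
  - move=> z z0; rewrite -mulrA; apply: le_trans (ler_wpM2l _ (sgrow z z0)); last first.
      by rewrite mulr_ge0// sqr_ge0.
    apply: (@le_trans _ _ ((q * (m + `|c z|)) ^+ 2)).
      by rewrite ler_pXn2r ?nnegrE ?mulr_ge0 ?addr_ge0// bz.
    rewrite exprMn -[leRHS]mulrA [leRHS]mulrCA ler_wpM2l ?sqr_ge0//.
    have := norm_sqv (c z); rewrite /s.
    have : 0 <= (`|c z| - m) ^+ 2 by exact: sqr_ge0.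
    have : 0 <= `|c z| ^+ 2 by exact: sqr_ge0.
    have : 0 <= m ^+ 2 by exact: sqr_ge0.
    by lra.
  - move=> z z0; apply: le_trans (forcing_b b hX (ltW z0) (am z (ltW z0))) _.
    by rewrite lerD2r ler_wpM2r.
have step m : (forall z, 0 <= z -> `|a z| <= m) -> forall z, 0 <= z -> `|a z| <= 0 + m / 2.
  move=> am; have bb := bbound m am.
  have m0 : 0 <= m by apply: le_trans (am 0 (lexx _)).
  set B := Cd * (be + N%:R * eps * m) in bb.
  have B0 : 0 <= B by rewrite mulr_ge0 ?(ltW Cd0)// addr_ge0// !mulr_ge0.
  have bB x : 0 <= x -> `|b x| <= B.
    by move=> x0; apply: le_trans (bb x x0) _; rewrite ler_piMr//; exact: E1.
  pose J := e2 * eps * (B + m).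
  have J0 : 0 <= J by rewrite !mulr_ge0// addr_ge0.
  have cJ z : 0 <= z -> `|c z| <= J.
    move=> z0; apply/ler_addgt0Pr => d d0.
    have d20 : 0 < d / 2 by rewrite divr_gt0.
    have [Z1 hZ1] := alim _ d20.
    have [Z2 hZ2] : exists Z, forall z, Z <= z -> e1 * B * expR (- kappa * z) <= d / 2.
      exists (e1 * B / (d / 2 * kappa)) => x; rewrite ler_pdivrMr ?mulr_gt0// => hx.
      rewrite mulNr expRN ler_pdivrMr ?expR_gt0//.
      have : 1 + kappa * x <= expR (kappa * x) by exact: expR_ge1Dx.
      rewrite -(ler_pM2l d20) => h; apply: le_trans h.
      by rewrite mulrDr; lra.
    (* At a distant z' the slow variable is below d, and the oscillation bound carries this back to
       z. *)
    pose z' := Num.max z (Num.max Z1 Z2).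
    have zz' : z <= z' by rewrite le_max lexx.
    have Z1z : Z1 <= z' by rewrite !le_max lexx orbT.
    have Z2z : Z2 <= z' by rewrite !le_max lexx !orbT.
    have osc := slow_var_osc G0_unit hs hX (fun x x0 _ => am x x0)
      (fun x x0 _ => bb x x0) z0 zz' (lexx _).
    have z'0 : 0 <= z' by exact: le_trans zz'.
    have cz' : `|c z'| <= d.
      apply: le_trans (ler_normB _ _) _; rewrite [leRHS](splitr d); apply: lerD.
        exact: hZ1.
      apply: le_trans (he1 _) _; apply: le_trans (hZ2 z' Z2z).
      by rewrite -mulrA ler_wpM2l// bb.
    rewrite -(subrK (c z') (c z)); apply: le_trans (ler_normD _ _) _.
    apply: lerD => //; rewrite distrC; apply: le_trans osc _.
    by rewrite /J (_ : e2 * eps = K * eps / kappa)// -e2E mulrAC.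
  have beJ : be <= P1 * C3 * J.
    apply: le_trans (hP1 _) _; rewrite -mulrA ler_wpM2l//; apply: le_trans bc0 _.
    by rewrite ler_wpM2l// cJ.
  have w1 : eps * (Cd * N%:R) * m <= Cd * N%:R * m.
    by rewrite ler_wpM2r// ler_piMl.
  have w0 : 0 <= Cd * N%:R * m by rewrite mulr_ge0.
  have w2 : 0 <= Cd * m by rewrite mulr_ge0// ltW.
  have w3 : 0 <= Cd * N%:R * be by rewrite mulr_ge0.
  have JK5 : J <= eps * K5 * (be + m).
    have -> : J = eps * (e2 * (Cd * be + eps * (Cd * N%:R) * m + m)).
      by rewrite /J /B; ring.
    have -> : eps * K5 * (be + m) = eps * (e2 * ((Cd + Cd * N%:R + 1) * (be + m))).
      by rewrite /K5; ring.
    by rewrite ler_wpM2l// ler_wpM2l//; lra.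
  have JK : J <= 2 * (eps * K5 * m).
    have h2 : eps * K5 * be <= eps * K5 * (P1 * C3 * J).
      by rewrite ler_wpM2l// mulr_ge0.
    have h3 : eps * (K5 * P1 * C3) * J <= 1 / 2 * J by rewrite ler_wpM2r.
    have h4 : eps * K5 * (P1 * C3 * J) = eps * (K5 * P1 * C3) * J by ring.
    by rewrite mulrDr in JK5; lra.
  move=> z z0; rewrite add0r.
  have az : a z = c z + E0 *m b z by rewrite /c /slow_var subrK.
  have h5 : `|a z| <= J + e1 * B.
    rewrite az; apply: le_trans (ler_normD _ _) _; apply: lerD; first exact: cJ.
    by apply: le_trans (he1 _) _; rewrite ler_wpM2l// bB.
  apply: le_trans h5 _.
  have h6 : e1 * B <= e1 * (Cd * (P1 * C3 * J + N%:R * eps * m)).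
    by rewrite ler_wpM2l// /B ler_wpM2l ?(ltW Cd0)// lerD2r.
  have h7 : (1 + e1 * Cd * P1 * C3) * J <= (1 + e1 * Cd * P1 * C3) * (2 * (eps * K5 * m)).
    rewrite ler_wpM2l// addr_ge0//.
    by do ?[exact: e10 | exact: P10 | exact: C30 | exact: (ltW Cd0) | apply: mulr_ge0].
  have h8 : eps * K6 * m <= 1 / 2 * m by rewrite ler_wpM2r.
  have h9 : eps * K6 * m = (1 + e1 * Cd * P1 * C3) * (2 * (eps * K5 * m)) +
     e1 * (Cd * (N%:R * eps * m)) by rewrite /K6; ring.
  have h10 : (1 + e1 * Cd * P1 * C3) * J + e1 * (Cd * (N%:R * eps * m)) =
     J + e1 * (Cd * (P1 * C3 * J + N%:R * eps * m)) by ring.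
  lra.
have [Z hZ] := alim 1 ltr01.
have [m1 hm1] := continuous_bounded_itv Z ha.1.
pose m := Num.max 1 m1.
have am z : 0 <= z -> `|a z| <= m.
  move=> z0; rewrite le_max; have [Zz|zZ] := leP Z z; first by rewrite hZ.
  by rewrite hm1 ?orbT// ltW.
move=> z z0; apply/eqP; rewrite -normr_le0.
apply: (@le_geometric _ _ 0 m) => k.
have := @halving_bound _ m 0 (fun m => forall z, 0 <= z -> `|a z| <= m) am step k z z0.
by rewrite mulr0 subr0 add0r.
Qed.

End DecayingSolutions.

(** * Fundamental matrices *)

Section FundamentalMatrix.
Variables (R : realType) (k : nat).

Lemma fundamental_mx (M : R -> 'M[R]_k) (C : R) :
  (forall i j, continuous (fun z => M z i j)) ->
  (forall z i j, 0 <= z -> `|M z i j| <= C) ->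
  exists2 Psi : R -> 'M[R]_k, Psi 0 = 1%:M &
    forall x : 'cV_k, half_deriv (fun z => Psi z *m x) (fun z => M z *m (Psi z *m x)).
Proof.
move=> cM bM.
have h (j : 'I_k) : exists Yj : R -> 'cV[R]_k, Yj 0 = delta_mx j 0 /\
    half_deriv Yj (fun z => M z *m Yj z).
  by have [Yj e h] := linear_ivp (delta_mx j 0) cM bM; exists Yj.
have [Y hY] := choice h.
exists (fun z => \matrix_(i, j) Y j z i 0).
  apply/matrixP => i j; rewrite mxE (hY j).1 !mxE eqxx andbT.
  by [].
move=> x.
have PsiE z i : ((\matrix_(i, j) Y j z i 0) *m x) i 0 = \sum_j x j 0 * Y j z i 0.
  by rewrite mxE; apply: eq_bigr => j _; rewrite mxE mulrC.
split=> [i z|z i z0].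
  rewrite /continuous_at PsiE; under eq_fun do rewrite PsiE.
  by apply: cvg_sum => j _; apply: cvgMl_tmp; exact: (hY j).2.1.
have -> : (fun t => ((\matrix_(i, j) Y j t i 0) *m x) i 0) =
    \sum_j (x j 0 *: (fun t => Y j t i 0)).
  by apply/funext => t; rewrite PsiE fct_sumE.
have -> : (M z *m (\matrix_(i, j) Y j z i 0 *m x)) i 0 =
    \sum_j (x j 0 *: (M z *m Y j z) i 0).
  rewrite mxE (eq_bigr (fun l => \sum_j x j 0 * (M z i l * Y j z l 0))); last first.
    by move=> l _; rewrite PsiE mulr_sumr; apply: eq_bigr => j _; rewrite mulrCA.
  rewrite exchange_big /=; apply: eq_bigr => j _.
  by rewrite mxE -mulr_sumr.
apply: is_derive_sum => j; exact: (is_deriveZ (x j 0) ((hY j).2.2 z i z0)).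
Qed.

End FundamentalMatrix.

(** * Existence of bounded solutions with prescribed data *)

Section DecayingExists.
Variables (R : realType) (N n : nat) (G0 : 'M[R]_n) (D : dichotomy G0).
Variable H0 : 'M[R]_(N, n).
Hypothesis G0_unit : G0 \in unitmx.
Local Notation kappa := (decay_rate D).

Definition coefs_continuous (X : coefs R N n) : Prop :=
  [/\ forall i j, continuous (fun z => cHb X z i j),
      forall i j, continuous (fun z => cHa X z i j),
      forall i j, continuous (fun z => cGb X z i j) &
      forall i j, continuous (fun z => cGa X z i j)].

Lemma sys_of_block (X : coefs R N n) (y : R -> 'cV[R]_(N + n)) :
  half_deriv y (fun z => block_mx (cHa X z) (cHb X z) (cGa X z) (cGb X z) *m y z) ->
  sys X (fun z => usubmx (y z)) (fun z => dsubmx (y z)).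
Proof.
move=> [cy hy]; split; split.
- by move=> i x; rewrite /continuous_at mxE; under eq_fun do rewrite mxE; exact: cy.
- move=> z i z0.
  have -> : (fun t => usubmx (y t) i 0) = (fun t => y t (lshift n i) 0).
    by apply/funext => t; rewrite mxE.
  apply: (is_derive_eq (hy z (lshift n i) z0)).
  by rewrite -[in LHS](vsubmxK (y z)) mul_block_col col_mxEu addrC.
- by move=> i x; rewrite /continuous_at mxE; under eq_fun do rewrite mxE; exact: cy.
- move=> z i z0.
  have -> : (fun t => dsubmx (y t) i 0) = (fun t => y t (rshift N i) 0).
    by apply/funext => t; rewrite mxE.
  apply: (is_derive_eq (hy z (rshift N i) z0)).
  by rewrite -[in LHS](vsubmxK (y z)) mul_block_col col_mxEd addrC.
Qed.

(* Shooting: on [0, T] impose a 0, the contracting part of b 0 and the vanishing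
   of the expanding part of b T; let T tend to infinity by compactness. *)
Lemma decaying_exists : exists eps0 C : R, [/\ 0 < eps0, 0 < C &
  forall (eps : R) X, eps <= eps0 -> perturbed D H0 eps X -> coefs_continuous X ->
  forall (al : 'cV[R]_N) (be : 'cV[R]_(dimm D)), exists a b,
  [/\ sys X a b, a 0 = al, projm D *m b 0 = be &
    forall z, 0 <= z -> `|a z| <= C * (`|al| + `|be|) /\
      `|b z| <= C * (`|al| + `|be|) * expR (- kappa * z)]].
Proof.
have [eps0 [C [eps00 C0 bvp]]] := bvp_bound D H0 G0_unit.
have k0 := decay_rate_gt0 D.
exists eps0, C; split=> // eps X hle hX [cHb' cHa' cGb' cGa'] al be.
have [h1 _ _ _] := hX 0 (lexx _); have epsge0 : 0 <= eps by apply: le_trans h1.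
pose M z := block_mx (cHa X z) (cHb X z) (cGa X z) (cGb X z).
have cM i j : continuous (fun z => M z i j).
  by move=> x; apply: mx_cvg_block => ? ?; [exact: cHa'|exact: cHb'|exact: cGa'|exact: cGb'].
have E1 z : 0 <= z -> expR (- kappa * z) <= 1.
  by move=> z0; rewrite -expR0 ler_expR mulNr oppr_le0 mulr_ge0// ltW.
have bM z i j : 0 <= z -> `|M z i j| <= `|H0| + `|G0| + eps.
  move=> z0; have [e1 e2 e3 e4] := hX z z0.
  have eE : eps * expR (- kappa * z) <= eps by rewrite ler_piMr// E1.
  have b1 : `|cHb X z| <= `|H0| + eps.
    by rewrite -(subrK H0 (cHb X z)) addrC (le_trans (ler_normD _ _))// lerD2l.
  have b2 : `|cGb X z| <= `|G0| + eps.
    by rewrite -(subrK G0 (cGb X z)) addrC (le_trans (ler_normD _ _))// lerD2l.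
  have n1 := normr_ge0 H0; have n2 := normr_ge0 G0.
  rewrite /M /block_mx mxE; case: fintype.split => i'; rewrite mxE;
    case: fintype.split => j'; apply: le_trans (entry_le_norm _ _ _) _; lra.
have [Psi Psi0 hPsi] := fundamental_mx cM bM.
pose a (x : 'cV[R]_(N + n)) z := usubmx (Psi z *m x); pose b (x : 'cV[R]_(N + n)) z := dsubmx (Psi z *m x).
have hs x : sys X (a x) (b x) by exact: sys_of_block (hPsi x).
have a0 x : a x 0 = usubmx x by rewrite /a Psi0 mul1mx.
have b0 x : b x 0 = dsubmx x by rewrite /b Psi0 mul1mx.
(* The boundary map of the shooting problem on [0, T]. It is injective by [bvp_bound], and square
   because the two parts of the dichotomy have dimensions adding up to n. *)
pose L T : 'M[R]_(N + (dimm D + dimp D), N + n) :=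
  col_mx (usubmx 1%:M) (col_mx (projm D *m dsubmx 1%:M) (projp D *m dsubmx (Psi T))).
have LE T x : L T *m x = col_mx (usubmx x)
    (col_mx (projm D *m dsubmx x) (projp D *m b x T)).
  by rewrite /L !mul_col_mx -!mulmxA !mul_dsub_mx mul_usub_mx !mul1mx.
have solve T : 0 <= T -> exists x, [/\ a x 0 = al, projm D *m b x 0 = be &
    projp D *m b x T = 0].
  move=> T0.
  have [|L' L'K] := @injective_linv R _ _ (L T).
    move=> x.
    rewrite LE -!col_mx0 => /eq_col_mx[ux /eq_col_mx[mx px]].
    have := bvp eps X (a x) (b x) T hle hX (hs x) T0 px 0 (lexx _) T0.
    rewrite a0 b0 ux mx !normr0 addr0 mulr0 mul0r => -[_].
    rewrite normr_le0 => /eqP dx.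
    by rewrite -(vsubmxK x) ux dx col_mx0.
  have dims : (N + (dimm D + dimp D) = N + n)%N by rewrite [(dimm D + _)%N]addnC dim_split.
  have LK := mulmx_linv dims L'K.
  pose x := L' *m col_mx al (col_mx be 0).
  have : L T *m x = col_mx al (col_mx be 0) by rewrite mulmxA LK mul1mx.
  rewrite LE => /eq_col_mx[ux /eq_col_mx[mx px]].
  by exists x; rewrite a0 b0.
have hsol (i : nat) : exists x, [/\ a x 0 = al, projm D *m b x 0 = be &
    projp D *m b x i%:R = 0] by exact: solve.
have [x hx] := choice hsol.
set S := `|al| + `|be|.
have bnd i z : 0 <= z -> z <= i%:R -> `|a (x i) z| <= C * S /\
    `|b (x i) z| <= C * S * expR (- kappa * z).
  have [e1 e2 e3] := hx i.
  have := bvp eps X (a (x i)) (b (x i)) i%:R hle hX (hs _) (ler0n _ _) e3.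
  by rewrite e1 e2; apply.
have CS0 : 0 <= C * S by rewrite mulr_ge0 ?(ltW C0)// addr_ge0.
have xb i : `|(x i)^T| <= C * S.
  rewrite norm_trmx -(vsubmxK (x i)) -a0 -b0.
  have [h2 h3] := bnd i 0 (lexx _) (ler0n _ _).
  rewrite mulr0 expR0 mulr1 in h3.
  apply: mx_norm_le => // l j; rewrite mxE; case: fintype.split => l'.
    exact: le_trans (entry_le_norm _ _ _) h2.
  exact: le_trans (entry_le_norm _ _ _) h3.
have [yT hy] := bounded_seq_cluster xb.
pose y := yT^T.
have near_y i0 (d : R) : 0 < d -> exists2 i, (i0 <= i)%N & `|y - x i| < d.
  move=> /(hy i0)[i i0i h]; exists i => //.
  by rewrite -norm_trmx linearB /= trmxK.
(* a closed inequality satisfied by all x i, i large, is satisfied by y *)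
have closed_ineq m (K : 'M[R]_(m, N + n)) (v : 'cV[R]_m) (B : R) (i0 : nat) :
    (forall i, (i0 <= i)%N -> `|K *m x i - v| <= B) -> `|K *m y - v| <= B.
  move=> hK; apply/ler_addgt0Pr => d d0.
  have A0 : 0 < (N + n)%:R * `|K| + 1 by rewrite ltr_wpDl// mulr_ge0.
  have [i i0i hi] := near_y i0 (d / ((N + n)%:R * `|K| + 1)) (divr_gt0 d0 A0).
  rewrite (_ : K *m y - v = (K *m x i - v) + K *m (y - x i)); last first.
    by rewrite mulmxBr [RHS]addrC addrA subrK.
  apply: le_trans (ler_normD _ _) _; apply: lerD; first exact: hK.
  apply: le_trans (mulmx_norm _ _) _.
  rewrite ltr_pdivlMr// in hi.
  have : 0 <= `|y - x i| by [].
  lra.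
exists (a y), (b y); split.
- exact: hs.
- apply/eqP; rewrite -subr_eq0 -normr_le0 a0 -[y]mul1mx -mul_usub_mx.
  apply: (closed_ineq _ _ _ _ 0%N) => i _.
  by rewrite mul_usub_mx mul1mx -a0; have [-> _ _] := hx i; rewrite subrr normr0.
- apply/eqP; rewrite -subr_eq0 -normr_le0 b0 -[y]mul1mx -mul_dsub_mx mulmxA.
  apply: (closed_ineq _ _ _ _ 0%N) => i _.
  rewrite -mulmxA mul_dsub_mx mul1mx -b0; have [_ -> _] := hx i.
  by rewrite subrr normr0.
- move=> z z0.
  have [i0 zi0] : exists i0 : nat, z <= i0%:R.
    by exists (Num.truncn z).+1; apply: ltW; exact: truncnS_gt.
  have zi i : (i0 <= i)%N -> z <= i%:R.
    by move=> i0i; apply: le_trans zi0 _; rewrite ler_nat.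
  split.
  + rewrite -[a y z]subr0 /a -mul_usub_mx; apply: (closed_ineq _ _ _ _ i0) => i i0i.
    by rewrite subr0 mul_usub_mx; have [] := bnd i z z0 (zi i i0i).
  + rewrite -[b y z]subr0 /b -mul_dsub_mx; apply: (closed_ineq _ _ _ _ i0) => i i0i.
    by rewrite subr0 mul_dsub_mx; have [] := bnd i z z0 (zi i i0i).
Qed.

End DecayingExists.

(** * Convergence in matrix norm, determinants and inverses *)

Section MatrixTopology.
Variables (R : realType) (T : Type) (F : set_system T).
Context {FF : Filter F}.

Lemma mx_cvgP m n (M : T -> 'M[R]_(m, n)) (M0 : 'M[R]_(m, n)) :
  M t @[t --> F] --> M0 <-> mx_cvg F M M0.
Proof.
split=> [h i j|h].
  apply/cvgrPdist_le => e e0; move/cvgrPdist_le : h => /(_ e e0).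
  apply: filterS => t; apply: le_trans.
  by have := entry_le_norm (M0 - M t) i j; rewrite !mxE.
apply/cvgrPdist_le => e e0.
have : \forall t \near F, forall ij : 'I_m * 'I_n, `|M0 ij.1 ij.2 - M t ij.1 ij.2| <= e.
  by apply: filter_forall => -[i j]; have /cvgrPdist_le := h i j; exact.
apply: filterS => t ht; apply: mx_norm_le; first exact: ltW.
by move=> i j; rewrite !mxE; exact: (ht (i, j)).
Qed.

Lemma mx_cvg_sub m n m' n' (f : 'I_m' -> 'I_m) (g : 'I_n' -> 'I_n)
    (M : T -> 'M[R]_(m, n)) M0 :
  mx_cvg F M M0 -> mx_cvg F (fun t => mxsub f g (M t)) (mxsub f g M0).
Proof. by move=> h i j; rewrite mxE; under eq_fun do rewrite mxE; exact: h. Qed.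

Lemma mx_cvg_det n (M : T -> 'M[R]_n) M0 :
  mx_cvg F M M0 -> \det (M t) @[t --> F] --> \det M0.
Proof.
move=> h; rewrite /determinant; apply: cvg_sum => s _; apply: cvgM; first exact: cvg_cst.
elim: (index_enum _) => [|i r IH].
  by rewrite big_nil; under eq_fun do rewrite big_nil; exact: cvg_cst.
rewrite big_cons; under eq_fun do rewrite big_cons.
by apply: cvgM; first exact: h.
Qed.

Lemma mx_cvg_inv n (M : T -> 'M[R]_n) M0 :
  mx_cvg F M M0 -> M0 \in unitmx -> mx_cvg F (fun t => invmx (M t)) (invmx M0).
Proof.
move=> h u i j.
have d0 : \det M0 != 0 by rewrite -unitfE -unitmxE.
have hd := mx_cvg_det h.
have near0 : \forall t \near F, \det (M t) != 0.
  have /cvgrPdist_lt/(_ `|\det M0|) := hd; rewrite normr_gt0 => /(_ d0).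
  apply: filterS => t; apply: contraTneq => ->; by rewrite subr0 ltxx.
have adjE (A : 'M[R]_n) : \det A != 0 -> invmx A i j = (\det A)^-1 * cofactor A j i.
  by move=> A0; rewrite /invmx unitmxE unitfE A0 !mxE.
rewrite adjE//; apply: cvg_trans (near_eq_cvg _) _.
  by apply: filterS near0 => t /adjE ->; reflexivity.
apply: cvgM; first exact: cvgV.
apply: cvgM; first exact: cvg_cst.
apply: mx_cvg_det => k l; rewrite !mxE; under eq_fun do rewrite !mxE.
exact: h.
Qed.

End MatrixTopology.

(** * One-sided derivatives on the closed half line *)

Section HalfLine.
Variable R : realType.

Definition hl_filter (z : R) : set_system R := within [set h | 0 <= z + h] 0^'.

Lemma hl_filter_proper (z : R) : 0 <= z -> ProperFilter (hl_filter z).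
Proof.
move=> z0; apply: Build_ProperFilter_ex => /= A hA.
have /nbhs_ballP[e /= e0 he] := hA.
have e20 : 0 < e / 2 by rewrite divr_gt0.
exists (e / 2); apply: (he (e / 2)) => /=.
- by rewrite /ball/= sub0r normrN gtr0_norm// ltr_pdivrMr// ltr_pMr// ltr1n.
- by rewrite gt_eqF.
- by rewrite addr_ge0// ltW.
Qed.

Definition hl_is_deriv n (f : R -> 'cV[R]_n) (z : R) (df : 'cV[R]_n) : Prop :=
  hl_quotient f z h @[h --> hl_filter z] --> df.

Lemma hl_is_derivE n (f : R -> 'cV[R]_n) (z : R) df :
  0 <= z -> hl_is_deriv f z df -> hl_deriv f z = df.
Proof.
by move=> z0 h; have pF := hl_filter_proper z0; apply: cvg_lim => //; exact: norm_hausdorff.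
Qed.

Lemma hl_derivableP n (f : R -> 'cV[R]_n) (z : R) :
  hl_derivable f -> 0 <= z -> hl_is_deriv f z (hl_deriv f z).
Proof. by move=> h z0; exact: h. Qed.

Lemma hl_is_deriv_derivable n (f df : R -> 'cV[R]_n) :
  (forall z, 0 <= z -> hl_is_deriv f z (df z)) -> hl_derivable f.
Proof. by move=> h z z0; apply/cvg_ex; exists (df z); exact: h. Qed.

Lemma hl_is_deriv_entry n (f : R -> 'cV[R]_n) (z : R) df : hl_is_deriv f z df <->
  forall i, h^-1 * (f (z + h) i 0 - f z i 0) @[h --> hl_filter z] --> df i 0.
Proof.
have E i j h : hl_quotient f z h i j = h^-1 * (f (z + h) i 0 - f z i 0).
  by rewrite /hl_quotient !mxE (ord1 j).
rewrite /hl_is_deriv mx_cvgP; split=> [h i|h i j].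
  by have := h i 0; under eq_fun do rewrite E.
by rewrite (ord1 j); under eq_fun do rewrite E; exact: h.
Qed.

Lemma hl_is_deriv_congr n (f g : R -> 'cV[R]_n) (z : R) df : 0 <= z ->
  (forall t, 0 <= t -> f t = g t) -> hl_is_deriv f z df -> hl_is_deriv g z df.
Proof.
move=> z0 fg; apply: cvg_trans; apply: near_eq_cvg.
rewrite /hl_filter; near=> h; rewrite /hl_quotient !fg//.
by near: h; exact: withinT.
Unshelve. all: by end_near. Qed.

Lemma hl_is_deriv_dsub m n (f : R -> 'cV[R]_(m + n)) (z : R) df :
  hl_is_deriv f z df -> hl_is_deriv (fun t => dsubmx (f t)) z (dsubmx df).
Proof.
move=> /hl_is_deriv_entry h; apply/hl_is_deriv_entry => i.
by rewrite !mxE; under eq_fun do rewrite !mxE; exact: h.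
Qed.

Lemma hl_is_deriv_cvg n (f : R -> 'cV[R]_n) (z : R) df i : 0 <= z -> hl_is_deriv f z df ->
  f t i 0 @[t --> within [set t | 0 <= t] (nbhs z)] --> f z i 0.
Proof.
move=> z0 /hl_is_deriv_entry/(_ i) /cvgrPdist_le/(_ 1 ltr01).
rewrite /hl_filter => /nbhs_ballP[e /= e0 he].
apply/cvgrPdist_le => d d0.
set K := `|df i 0| + 1.
have K0 : 0 < K by rewrite ltr_wpDl.
rewrite near_withinE; apply/nbhs_ballP.
exists (Num.min e (d / K)) => /=; first by rewrite lt_min e0 divr_gt0.
move=> t; rewrite /ball/= lt_min => /andP[te td] t0.
have [->|tz] := eqVneq t z; first by rewrite subrr normr0 ltW.
have h0 : t - z != 0 by rewrite subr_eq0.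
have := he (t - z); rewrite /ball/= sub0r normrN distrC => /(_ te h0).
rewrite addrC subrK => /(_ t0) hq.
rewrite distrC in td.
have : `|(t - z)^-1 * (f t i 0 - f z i 0)| <= K.
  rewrite -[X in `|X|](subKr (df i 0)); apply: le_trans (ler_normB _ _) _.
  by rewrite lerD2l.
rewrite normrM normrV ?unitfE// mulrC ler_pdivrMr ?normr_gt0// distrC => hk.
apply: le_trans hk _; rewrite mulrC -ler_pdivlMr//; exact: ltW.
Qed.

Lemma max0_continuous : continuous (fun z : R => Num.max z 0).
Proof. by move=> z; apply: continuous_max; [exact: cvg_id|exact: cvg_cst]. Qed.

Lemma max0_ge0 (z : R) : 0 <= Num.max z 0.
Proof. by rewrite le_max lexx orbT. Qed.

(** Freezing f to the left of 0 passes from derivatives relative to the closed half line to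
    [half_deriv]. *)
Lemma hl_half_deriv n (f : R -> 'cV[R]_n) : hl_derivable f ->
  half_deriv (fun z => f (Num.max z 0)) (fun z => hl_deriv f (Num.max z 0)).
Proof.
move=> hf; split=> [i z|z i z0].
  have m0 := max0_ge0 z.
  rewrite /continuous_at.
  apply: (cvg_comp (fun z : R => Num.max z 0) (fun t => f t i 0)); last first.
    exact: hl_is_deriv_cvg m0 (hl_derivableP hf m0).
  move=> A /= hA; have := @max0_continuous z _ hA.
  move=> hA'.
  have {}hA' : \forall t \near z, 0 <= Num.max t 0 -> A (Num.max t 0) by exact: hA'.
  by apply: filterS hA' => t; apply; exact: max0_ge0.
have z0' := ltW z0.
have /hl_is_deriv_entry/(_ i) h := hl_derivableP hf z0'.
rewrite (max_idPl z0').
suff hq : h^-1 *: (f (Num.max (h *: (1 : R) + z) 0) i 0 - f (Num.max z 0) i 0)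
    @[h --> 0^'] --> hl_deriv f z i 0.
  by apply: DeriveDef; [apply/cvg_ex; eexists; exact: hq|exact: cvg_lim hq].
apply: cvg_trans h.
have near_pos : \forall h \near (0 : R)^', 0 <= z + h.
  apply: nbhs_dnbhs; apply/nbhs_ballP; exists z => //= h; rewrite /ball/= sub0r normrN.
  by rewrite ltr_norml => /andP[]; lra.
move=> A; rewrite /hl_filter /= => hA.
have : \forall h \near (0 : R)^', 0 <= z + h ->
  A (h^-1 * (f (z + h) i 0 - f z i 0)) by exact: hA.
move=> hA'.
apply: filterS2 hA' near_pos => h hA' zh.
by rewrite /= [h *: 1]mulr1 [h + z]addrC (max_idPl zh) (max_idPl z0'); exact: hA'.
Qed.

(** The converse passage; at z = 0 it rests on the continuity of df. *)
Lemma half_deriv_hl n (f df : R -> 'cV[R]_n) (z : R) :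
  half_deriv f df -> (forall i, continuous (fun z => df z i 0)) -> 0 <= z ->
  hl_is_deriv f z (df z).
Proof.
move=> [cf hf] cdf z0; apply/hl_is_deriv_entry => i.
by apply: (@hl_quotient_cvg R (fun t => f t i 0) (fun t => df t i 0)) => // t t0; exact: hf.
Qed.

End HalfLine.

(** * Essential bounds and limits at infinity *)

Section HalfLineLimits.
Variable R : realType.

Lemma enorm_continuous n (g : R -> 'cV[R]_n) :
  (forall i, continuous (fun z => g z i 0)) -> continuous (fun z => enorm (g z)).
Proof.
move=> cg z; rewrite /enorm; apply: continuous_comp; last exact: sqrt_continuous.
by apply: cvg_sum => i _; rewrite expr2; under eq_fun do rewrite expr2; apply: cvgM; exact: cg.
Qed.

(** If the norm of the continuous g exceeded eps at z, it would do so on an interval to the right of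
    z, which has positive measure. *)
Lemma Linf_norm_pointwise n (f g : R -> 'cV[R]_n) (eps : R) :
  (forall i, continuous (fun z => g z i 0)) -> (forall z, 0 < z -> f z = g z) ->
  (Linf_norm f <= eps%:E)%E -> forall z, 0 <= z -> enorm (g z) <= eps.
Proof.
move=> cg fg; rewrite /Linf_norm unlock /=.
have -> : mrestr (@lebesgue_measure R) (measurable_itv `]0, +oo[) setT = +oo%E.
  by rewrite /mrestr setTI lebesgue_measure_itv /= ltry.
rewrite ltry => /ess_sup_inf.ess_supP[N [mN N0 hN]] z z0.
rewrite leNgt; apply/negP => hz.
have cE := enorm_continuous cg.
have : \forall t \near z, eps < enorm (g t).
  have /cvgrPdist_lt/(_ (enorm (g z) - eps)) := cE z; rewrite subr_gt0 => /(_ hz).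
  by apply: filterS => t; rewrite ltr_norml => /andP[]; lra.
move=> /nbhs_ballP[d /= d0 hd].
have sub : `]z, (z + d)[%classic `<=` N `&` `]0, +oo[%classic.
  move=> t /=; rewrite in_itv /= => /andP[zt td]; split; last first.
    by rewrite /= in_itv /= andbT (le_lt_trans z0).
  apply: hN => /=; rewrite fg ?(le_lt_trans z0)// lee_fin.
  apply/negP; rewrite -ltNge ger0_norm; last exact: sqrtr_ge0.
  by apply: hd; rewrite /ball/= ltr_norml; lra.
pose I : set R := `]z, (z + d)[%classic.
have : (lebesgue_measure I <= 0)%E.
  rewrite -N0; apply: (le_measure (@lebesgue_measure R)) sub; rewrite inE.
    exact: measurable_itv.
  by apply: measurableI => //; exact: measurable_itv.
rewrite /I lebesgue_measure_itv /= lte_fin ltrDl d0 -EFinB lee_fin.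
by rewrite addrAC subrr add0r leNgt d0.
Qed.

Lemma exp_rate_cvg (f df : R -> R) (C k : R) : 0 < k -> 0 <= C -> continuous f ->
  (forall z : R, 0 < z -> is_derive z 1 f (df z)) ->
  (forall z : R, 0 < z -> `|df z| <= C * expR (- k * z)) -> cvg (f z @[z --> +oo]).
Proof.
move=> k0 C0 cf hf hdf; apply: cauchy_cvg; apply: cauchy_exP => e e0.
(* By exp x >= 1 + x, the tail integral (C / k) exp (- k Z) is then smaller than e. *)
pose Z := C / k / (e * k).
have Z0 : 0 <= Z by rewrite !divr_ge0// ?mulr_ge0// ltW.
have hZ : C / k * expR (- k * Z) < e.
  rewrite mulNr expRN ltr_pdivrMr ?expR_gt0//.
  apply: lt_le_trans (_ : e * (1 + k * Z) <= _); last first.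
    by rewrite ler_pM2l// expR_ge1Dx.
  rewrite mulrDr mulr1 mulrA; have -> : e * k * Z = C / k.
    by rewrite /Z mulrC divfK// mulf_neq0 ?gt_eqF.
  by rewrite ltrDr.
exists (f Z); exists Z; split; first exact: num_real.
move=> z Zz; rewrite /ball/= distrC.
have g' (x : R) : is_derive x 1 (fun x => - (C / k) * expR (- k * x)) (C * expR (- k * x)).
  apply: (is_derive_eq (is_deriveZ (- (C / k)) (is_derive_expRM (- k) x))).
  by rewrite /GRing.scale /= mulrA mulrNN divfK// gt_eqF.
have := @is_derive_dist R f df (fun x => - (C / k) * expR (- k * x))
  (fun x => C * expR (- k * x)) Z z (ltW Zz) cf.
have cg : continuous (fun x => - (C / k) * expR (- k * x)).
  by move=> x; apply: cvgMl_tmp; exact: continuous_expRM.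
move=> /(_ cg) h.
have h' : `|f z - f Z| <= - (C / k) * expR (- k * z) - - (C / k) * expR (- k * Z).
  by apply: h => x Zx _; [apply: hf|apply: hdf]; exact: le_lt_trans Zx.
apply: le_lt_trans h' _; apply: le_lt_trans hZ.
have : 0 <= C / k * expR (- k * z) by rewrite mulr_ge0 ?expR_ge0 ?divr_ge0// ltW.
by lra.
Qed.

Lemma half_deriv_cvg n (a da : R -> 'cV[R]_n) (C k : R) : 0 < k -> 0 <= C ->
  half_deriv a da -> (forall z : R, 0 < z -> `|da z| <= C * expR (- k * z)) ->
  cvg (a z @[z --> +oo]).
Proof.
move=> k0 C0 [ca ha] hda.
have h i : cvg (a z i 0 @[z --> +oo]).
  apply: (exp_rate_cvg k0 C0 (ca i) (fun z => ha z i)) => z z0.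
  by apply: le_trans (hda z z0); exact: entry_le_norm.
apply/cvg_ex; exists (\col_i lim (a z i 0 @[z --> +oo])).
by apply/mx_cvgP => i j; rewrite (ord1 j) mxE; exact: h.
Qed.

End HalfLineLimits.

(** * Block structure of the symbols on the state sets *)

Section Structure.
Variables (R : realType) (d n1 n2 n3 N1p r : nat) (P : bvp R d n1 n2 n3 N1p r).
Hypotheses (hset : setting P) (hstr : structural_hypotheses P).

Lemma Ubd_Ustar p : Ubd_nu P p -> Ustar_nu P p.
Proof.
move=> [t [x0 [ht hx hu hn]]]; exists t, x0; split => //.
exact: (Ost_sub_Ostar hset ht hx).
Qed.

Lemma Ubd_piU u nu : Ubd_nu P (u, nu) -> piU P u.
Proof. by move=> [t [x0 [ht [hx _] hu _]]]; exists t, x0. Qed.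

Lemma Ustar_piUstar u nu : Ustar_nu P (u, nu) -> piUstar P u.
Proof. by move=> [t [x0 [ht hx hu _]]]; exists t, x0. Qed.

Lemma states_open : open (states P).
Proof.
apply: openU; rewrite openE => u [t [x [ht hx hu]]].
  have [hO _ _] := Ost_continuous hset.
  have : nbhs u (Ost P (t, x)) by apply: open_nbhs_nbhs; split => //; exact: hO.
  by apply: filterS => v hv; exists t, x.
have [hO _ _] := Ostar_continuous hset.
have : nbhs u (Ostar P (t, x)) by apply: open_nbhs_nbhs; split => //; exact: hO.
by apply: filterS => v hv; exists t, x.
Qed.

Lemma enorm_gt0 n (v : 'cV[R]_n) : v != 0 -> 0 < enorm v.
Proof.
move=> v0; rewrite sqrtr_gt0 lt0r sumr_ge0 ?andbT => [|i _]; last exact: sqr_ge0.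
apply: contra v0 => /eqP e; apply/eqP/matrixP => i j; rewrite (ord1 j) mxE.
have /(_ i isT)/eqP : forall i, true -> v i 0 ^+ 2 = 0.
  by apply/psumr_eq0P => // k _; exact: sqr_ge0.
by rewrite sqrf_eq0 => /eqP.
Qed.

Lemma normal_neq0 x0 : bdry (Omega P) x0 -> inner_normal P x0 != 0.
Proof.
move=> /(Defs.normalE hset)[W [phi [[_ _ _ g0 _] ->]]].
by rewrite scaler_eq0 negb_or g0 invr_eq0 gt_eqF// enorm_gt0.
Qed.

Lemma Ustar_normal u nu : Ustar_nu P (u, nu) -> nu != 0.
Proof. by move=> [t [x0 [_ hx _ /= ->]]]; exact: normal_neq0. Qed.

Lemma AbarE u xi : Abar P u xi = invmx (coefA0 P u) *m Asym P xi u.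
Proof. by rewrite /Abar /Asym mulmx_sumr; apply: eq_bigr => j _; rewrite scalemxAr. Qed.

Lemma BbarE u xi : Bbar P u xi = invmx (coefA0 P u) *m Bsym P xi u.
Proof.
rewrite /Bbar /Bsym mulmx_sumr; apply: eq_bigr => j _; rewrite mulmx_sumr.
by apply: eq_bigr => k _; rewrite scalemxAr.
Qed.

Lemma Bsym_block u xi : states P u ->
  Bsym P xi u = block_mx 0 0 0 (drsubmx (Bsym P xi u)).
Proof.
move=> hu; pose Q (M : 'M[R]_(n1 + n2)) := exists X, M = block_mx 0 0 0 X.
have Q0 : Q 0 by exists 0; rewrite block_mx0.
have QD M M' : Q M -> Q M' -> Q (M + M').
  by move=> [X ->] [Y ->]; exists (X + Y); rewrite add_block_mx !addr0.
suff [X ->] : Q (Bsym P xi u) by rewrite block_mxKdr.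
apply: (big_ind Q) => // j _; apply: (big_ind Q) => // k _.
exists ((xi j 0 * xi k 0) *: drsubmx (Defs.coefB P j k u)).
by rewrite {1}(B_block hset j k hu) scale_block_mx !scaler0.
Qed.

Lemma A0_unit u : states P u -> coefA0 P u \in unitmx.
Proof. by move=> hu; rewrite unitmxE unitfE; exact: (A0_det hstr). Qed.

Lemma A0_blocks u : states P u -> exists a c e,
  [/\ coefA0 P u = block_mx a 0 c e, a \in unitmx & e \in unitmx].
Proof.
move=> hu; exists (ulsubmx (coefA0 P u)), (dlsubmx (coefA0 P u)), (drsubmx (coefA0 P u)).
have E : coefA0 P u = block_mx (ulsubmx (coefA0 P u)) 0 (dlsubmx (coefA0 P u))
    (drsubmx (coefA0 P u)) by rewrite -(A0_block hset hu) submxK.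
have : \det (ulsubmx (coefA0 P u)) * \det (drsubmx (coefA0 P u)) != 0.
  by rewrite -(det_lblock _ (dlsubmx (coefA0 P u))) -E; exact: (A0_det hstr).
by rewrite mulf_eq0 negb_or => /andP[h1 h2]; rewrite !unitmxE !unitfE.
Qed.

Lemma Bbar_block u xi : states P u -> Bbar P u xi = block_mx 0 0 0 (Bbar22 P u xi).
Proof.
move=> hu; have [a [c [e [A0E ua ue]]]] := A0_blocks hu.
have h : coefA0 P u *m block_mx 0 0 0 (invmx e *m drsubmx (Bsym P xi u)) = Bsym P xi u.
  by rewrite A0E mulmx_block !mul0mx !mulmx0 !add0r (mulKVmx ue) -Bsym_block.
have BE : Bbar P u xi = block_mx 0 0 0 (invmx e *m drsubmx (Bsym P xi u)).
  by rewrite BbarE -[in LHS]h (mulKmx (A0_unit hu)).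
by rewrite /Bbar22 {1}BE BE block_mxKdr.
Qed.

Lemma Bbar22_pos u xi (z : R[i]) : states P u -> xi != 0 ->
  eigenvalue (cmx (Bbar22 P u xi)) z -> 0 < complex.Re z.
Proof.
move=> hu hx; have [c c0 hc] := B22_parabolic hstr => /(hc u xi z hu).
by apply: lt_le_trans; rewrite mulr_gt0// exprn_gt0// enorm_gt0.
Qed.

Lemma unitmx_eigenvalue n (M : 'M[R]_n) : ~ eigenvalue (cmx M) 0 -> M \in unitmx.
Proof.
move=> h; apply/negPn/negP => hM; apply: h.
rewrite eigenvalue_root_char; apply/rootP; rewrite horner_char_poly -scalemx1 scale0r sub0r.
rewrite -scaleN1r detZ det_map_mx.
by move: hM; rewrite unitmxE unitfE negbK => /eqP ->; rewrite rmorph0 mulr0.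
Qed.

Lemma Bbar22_unit u xi : states P u -> xi != 0 -> Bbar22 P u xi \in unitmx.
Proof.
move=> hu hx; apply: unitmx_eigenvalue => /(Bbar22_pos hu hx).
by rewrite /= ltxx.
Qed.

Lemma Abar11_unit u nu : Ustar_nu P (u, nu) -> Abar11 P u nu \in unitmx.
Proof.
by move=> hu; apply: unitmx_eigenvalue; have [h /h|h /h] := A11_sign hstr hu; rewrite ltxx.
Qed.

Lemma invmx_mul n (A B : 'M[R]_n) : A \in unitmx -> B \in unitmx ->
  invmx (A *m B) = invmx B *m invmx A.
Proof.
move=> uA uB; have uAB : A *m B \in unitmx by rewrite unitmx_mul uA.
by rewrite -[RHS](mulKmx uAB) -[A *m B *m (_ *m _)]mulmxA (mulKVmx uB) mulmxV// mulmx1.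
Qed.

(** [coefA0] is block lower triangular: its block c cancels in the Schur complement, a in the
    product with the inverse of [A11], and e against that of B. *)
Lemma reduced_bar u xi : states P u -> xi != 0 -> Abar11 P u xi \in unitmx ->
  [/\ ulsubmx (Asym P xi u) \in unitmx, drsubmx (Bsym P xi u) \in unitmx &
      reduced_mx (Abar P u xi) (Bbar22 P u xi) = Gnu P xi u].
Proof.
move=> hu hx uA; have [a [c [e [A0E ua ue]]]] := A0_blocks hu.
have uB := Bbar22_unit hu hx.
have AE : Asym P xi u = coefA0 P u *m Abar P u xi.
  by rewrite AbarE mulKVmx// A0_unit.
have BE : Bsym P xi u = coefA0 P u *m Bbar P u xi.
  by rewrite BbarE mulKVmx// A0_unit.
move: AE BE; rewrite (Bbar_block xi hu) A0E -{1}(submxK (Abar P u xi)) !mulmx_block.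
rewrite !mul0mx !mulmx0 !addr0 !add0r -/(Abar11 P u xi) => AE BE.
have BdE : drsubmx (Bsym P xi u) = e *m Bbar22 P u xi by rewrite BE block_mxKdr.
have AulE : ulsubmx (Asym P xi u) = a *m Abar11 P u xi by rewrite AE block_mxKul.
split; rewrite ?AulE ?BdE ?unitmx_mul ?ua ?ue//.
rewrite /Gnu AulE BdE AE block_mxKdr block_mxKdl block_mxKur.
rewrite !invmx_mul//.
rewrite /reduced_mx -/(Abar11 P u xi) -!mulmxA; congr (_ *m _).
rewrite (mulKmx ua) mulmxDl -[c *m _ *m _]mulmxA (mulKVmx uA) -[e *m _ *m _]mulmxA.
by rewrite opprD addrACA subrr add0r -mulmxBr (mulKmx ue).
Qed.

End Structure.

(** * Hyperbolicity of [Gnu] and the index formula at the boundary *)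

Section Index.
Variables (R : realType) (d n1 n2 n3 N1p r : nat) (P : bvp R d n1 n2 n3 N1p r).
Hypotheses (hset : setting P) (hstr : structural_hypotheses P).

Lemma AbarZ u eta xi : Abar P u (eta *: xi) = eta *: Abar P u xi.
Proof. by rewrite /Abar scaler_sumr; apply: eq_bigr => j _; rewrite mxE scalerA. Qed.

Lemma BbarZ u eta xi : Bbar P u (eta *: xi) = eta ^+ 2 *: Bbar P u xi.
Proof.
rewrite /Bbar scaler_sumr; apply: eq_bigr => j _; rewrite scaler_sumr.
by apply: eq_bigr => k _; rewrite !mxE scalerA; congr (_ *: _); ring.
Qed.

Lemma dissipative_scaled u nu (eta : R) (z : R[i]) : Ubd_nu P (u, nu) -> eta != 0 ->
  eigenvalue ('i%C *: cmx (eta *: Abar P u nu) +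
              cmx (eta ^+ 2 *: block_mx 0 0 0 (Bbar22 P u nu))) z ->
  0 < complex.Re z.
Proof.
move=> hu eta0; have hp := Ubd_piU hu; have hs : states P u by left.
have nu0 := Ustar_normal hset (Ubd_Ustar hset hu).
rewrite -(Bbar_block hset hstr nu hs) -AbarZ -BbarZ.
have [c c0 hc] := dissipative hstr => /(hc u _ z hp); apply: lt_le_trans.
have en : 0 < enorm (eta *: nu) by apply: enorm_gt0; rewrite scaler_eq0 negb_or eta0.
by rewrite divr_gt0 ?mulr_gt0 ?addr_gt0 ?exprn_gt0.
Qed.

Lemma Abar_unit u nu : Ubd_nu P (u, nu) -> Abar P u nu \in unitmx.
Proof. by move=> hu; rewrite unitmxE unitfE; exact: (A_noncharacteristic hstr hu). Qed.

Lemma Gnu_hyperbolic u nu (z : R[i]) : Ubd_nu P (u, nu) ->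
  eigenvalue (cmx (Gnu P nu u)) z -> complex.Re z != 0.
Proof.
move=> hu; have hs : states P u by left; exact: Ubd_piU hu.
have uA := Abar11_unit hstr (Ubd_Ustar hset hu).
have nu0 := Ustar_normal hset (Ubd_Ustar hset hu).
have [_ _ <-] := reduced_bar hset hstr hs nu0 uA.
apply: (reduced_hyperbolic uA (Bbar22_unit hstr hs nu0) (Abar_unit hu)) => eta w.
exact: dissipative_scaled.
Qed.

Lemma boundary_index u nu : Ubd_nu P (u, nu) ->
  (num_pos (Abar P u nu) + num_Re_neg (Gnu P nu u))%N =
  (n2 + num_pos (Abar11 P u nu))%N.
Proof.
move=> hu; have hp := Ubd_piU hu; have hs : states P u by left.
have uA := Abar11_unit hstr (Ubd_Ustar hset hu).
have nu0 := Ustar_normal hset (Ubd_Ustar hset hu).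
have [_ _ <-] := reduced_bar hset hstr hs nu0 uA.
apply: (index_formula uA (Bbar22_unit hstr hs nu0)).
- by move=> z; exact: (A11_real hstr hs nu0).
- by move=> z; exact: (A_real hstr hp nu0).
- exact: Abar_unit.
- by move=> z; exact: (Bbar22_pos hstr hs nu0).
- by move=> eta w; exact: dissipative_scaled.
Qed.

End Index.

(** * Directional derivatives of matrix-valued maps *)

Section DirectionalDerivative.
Variables (R : realType) (m n k : nat).
Implicit Types (F : 'cV[R]_n -> 'M[R]_(m, k)) (u : 'cV[R]_n).

(** The matrix of the linear map sending a direction a to (D_a F (u)) p: in the linearized equation
    the unknown is the direction of differentiation. *)
Definition dmx F u (p : 'cV[R]_k) : 'M[R]_(m, n) :=
  \matrix_(i, j) ('D_(delta_mx j 0) F u *m p) i 0.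

Lemma derive_delta_sum F u (a : 'cV[R]_n) : differentiable F u ->
  'D_a F u = \sum_j a j 0 *: 'D_(delta_mx j 0) F u.
Proof.
move=> dF; rewrite deriveE//.
have aE : a = \sum_j a j 0 *: delta_mx j 0.
  by rewrite [LHS]matrix_sum_delta; apply: eq_bigr => i _; rewrite big_ord1.
by rewrite {1}aE linear_sum; apply: eq_bigr => j _; rewrite linearZ /= deriveE.
Qed.

Lemma dmx_mul F u (p : 'cV[R]_k) (a : 'cV[R]_n) : differentiable F u ->
  dmx F u p *m a = 'D_a F u *m p.
Proof.
move=> dF; rewrite (derive_delta_sum _ dF) mulmx_suml.
apply/matrixP => i j; rewrite (ord1 j) summxE mxE; apply: eq_bigr => l _.
by rewrite !mxE mulr_suml; apply: eq_bigr => q _; rewrite mxE; ring.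
Qed.

Lemma dmxZ F u (c : R) (p : 'cV[R]_k) : dmx F u (c *: p) = c *: dmx F u p.
Proof. by apply/matrixP => i j; rewrite mxE -scalemxAr !mxE. Qed.

Lemma dmx0 F u : dmx F u 0 = 0.
Proof. by apply/matrixP => i j; rewrite mxE mulmx0 !mxE. Qed.

End DirectionalDerivative.

(** * Regularity of the normal symbols in the state and the normal *)

Section Symbols.
Variables (R : realType) (d n1 n2 n3 N1p r : nat) (P : bvp R d n1 n2 n3 N1p r).
Hypotheses (hset : setting P) (hstr : structural_hypotheses P).
Local Notation N := (n1 + n2)%N.
Local Notation state := 'cV[R]_N.

Lemma Asym_sum nu : Asym P nu = \sum_(j < d) (nu j 0 \*: coefA P j).
Proof. by apply/funext => u; rewrite fct_sumE. Qed.

Lemma Bsym_sum nu :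
  Bsym P nu = \sum_(j < d) \sum_(k < d) ((nu j 0 * nu k 0) \*: Defs.coefB P j k).
Proof.
by apply/funext => u; rewrite fct_sumE; apply: eq_bigr => j _; rewrite fct_sumE.
Qed.

Lemma Asym_differentiable nu u : states P u -> differentiable (Asym P nu) u.
Proof.
move=> hu; rewrite Asym_sum; apply: differentiable_sum => j; apply: differentiableZ.
by have [+ _] := A_smooth hstr j 1%N; exact.
Qed.

Lemma Bsym_differentiable nu u : states P u -> differentiable (Bsym P nu) u.
Proof.
move=> hu; rewrite Bsym_sum; apply: differentiable_sum => j; apply: differentiable_sum => k.
by apply: differentiableZ; have [+ _] := B_smooth hstr j k 1%N; exact.
Qed.

Lemma derive_Asym nu u v : states P u ->
  'D_v (Asym P nu) u = \sum_j nu j 0 *: 'D_v (coefA P j) u.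
Proof.
move=> hu; rewrite Asym_sum.
have dA j : derivable (coefA P j) u v.
  by apply: diff_derivable; have [+ _] := A_smooth hstr j 1%N; exact.
rewrite derive_sum => [|j]; last exact: derivableZ.
by apply: eq_bigr => j _; rewrite deriveZ.
Qed.

Lemma derive_Bsym nu u v : states P u ->
  'D_v (Bsym P nu) u = \sum_j \sum_k (nu j 0 * nu k 0) *: 'D_v (Defs.coefB P j k) u.
Proof.
move=> hu; rewrite Bsym_sum.
have dB j k : derivable (Defs.coefB P j k) u v.
  by apply: diff_derivable; have [+ _] := B_smooth hstr j k 1%N; exact.
rewrite derive_sum => [|j]; last by apply: derivable_sum => k; exact: derivableZ.
apply: eq_bigr => j _; rewrite derive_sum => [|k]; last exact: derivableZ.
by apply: eq_bigr => k _; rewrite deriveZ.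
Qed.

(** The first block of rows of B vanishes on the open set of states, hence so does its
    derivative. *)
Lemma derive_Bsym_top nu u v : states P u -> usubmx ('D_v (Bsym P nu) u) = 0.
Proof.
move=> hu; have dB : derivable (Bsym P nu) u v.
  by apply: diff_derivable; exact: Bsym_differentiable.
rewrite derive_mx//; apply/matrixP => i j; rewrite !mxE.
transitivity ('D_v (cst (0 : R)) u); last by rewrite derive_cst.
apply: near_eq_derive.
have : \forall x \near u, states P x by apply: open_nbhs_nbhs; split => //; exact: states_open.
apply: filterS => x hx; rewrite (Bsym_block hset nu hx) /block_mx mxE.
by case: fintype.splitP => l /= e; rewrite ?row_mx0 ?mxE//; have := ltn_ord i; rewrite e; lia.
Qed.

Section Limits.
Variables (T : Type) (F : set_system T).
Context {FF : Filter F}.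
Variables (u : T -> state) (u0 : state) (nu : T -> 'cV[R]_d) (nu0 : 'cV[R]_d).
Hypotheses (hu0 : states P u0) (hu : mx_cvg F u u0) (hnu : mx_cvg F nu nu0).

Lemma mx_cvg_sum (I : Type) (s : seq I) m n (f : I -> T -> 'M[R]_(m, n)) f0 :
  (forall i, mx_cvg F (f i) (f0 i)) ->
  mx_cvg F (fun t => \sum_(i <- s) f i t) (\sum_(i <- s) f0 i).
Proof.
move=> h i j; rewrite summxE; under eq_fun do rewrite summxE.
by apply: cvg_sum => k _; exact: h.
Qed.

Lemma states_near : \forall t \near F, states P (u t).
Proof.
have /mx_cvgP hu' := hu; apply: hu'.
by apply: open_nbhs_nbhs; split => //; exact: states_open.
Qed.

Lemma mx_cvg_comp m n (f : state -> 'M[R]_(m, n)) : {for u0, continuous f} ->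
  mx_cvg F (fun t => f (u t)) (f u0).
Proof.
move=> cf; apply/mx_cvgP; apply: (cvg_comp u f _ cf).
exact/mx_cvgP.
Qed.

Lemma Asym_cvg : mx_cvg F (fun t => Asym P (nu t) (u t)) (Asym P nu0 u0).
Proof.
apply: mx_cvg_sum => j; apply: mx_cvgZ; first exact: hnu.
apply: mx_cvg_comp; apply: differentiable_continuous.
by have [+ _] := A_smooth hstr j 1%N; exact.
Qed.

Lemma Bsym_cvg : mx_cvg F (fun t => Bsym P (nu t) (u t)) (Bsym P nu0 u0).
Proof.
apply: mx_cvg_sum => j; apply: mx_cvg_sum => k; apply: mx_cvgZ.
  by apply: cvgM; exact: hnu.
apply: mx_cvg_comp; apply: differentiable_continuous.
by have [+ _] := B_smooth hstr j k 1%N; exact.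
Qed.

Lemma mx_cvg_near m n (f g : T -> 'M[R]_(m, n)) f0 :
  (\forall t \near F, f t = g t) -> mx_cvg F f f0 -> mx_cvg F g f0.
Proof.
move=> fg h i j; apply: cvg_trans (h i j); apply: near_eq_cvg.
by apply: filterS fg => t ->.
Qed.

Lemma derive_Asym_cvg v :
  mx_cvg F (fun t => 'D_v (Asym P (nu t)) (u t)) ('D_v (Asym P nu0) u0).
Proof.
rewrite derive_Asym//; apply: mx_cvg_near.
  by apply: filterS states_near => t ht; rewrite [RHS]derive_Asym; first reflexivity.
apply: mx_cvg_sum => j; apply: mx_cvgZ; first exact: hnu.
by apply: (mx_cvg_comp (f := fun x => 'D_v (coefA P j) x)); have [_ /(_ v)] := A_smooth hstr j 1%N; exact.
Qed.

Lemma derive_Bsym_cvg v :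
  mx_cvg F (fun t => 'D_v (Bsym P (nu t)) (u t)) ('D_v (Bsym P nu0) u0).
Proof.
rewrite derive_Bsym//; apply: mx_cvg_near.
  by apply: filterS states_near => t ht; rewrite [RHS]derive_Bsym; first reflexivity.
apply: mx_cvg_sum => j; apply: mx_cvg_sum => k; apply: mx_cvgZ.
  by apply: cvgM; exact: hnu.
apply: (mx_cvg_comp (f := fun x => 'D_v (Defs.coefB P j k) x)).
by have [_ /(_ v)] := B_smooth hstr j k 1%N; exact.
Qed.

Variables (p : T -> state) (p0 : state).
Hypothesis hp : mx_cvg F p p0.

Lemma dmx_Asym_cvg :
  mx_cvg F (fun t => dmx (Asym P (nu t)) (u t) (p t)) (dmx (Asym P nu0) u0 p0).
Proof.
move=> i j; rewrite mxE; under eq_fun do rewrite mxE.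
have /(_ FF i 0) := mx_cvgM (derive_Asym_cvg (v := delta_mx j 0)) hp; exact.
Qed.

Lemma dmx_Bsym_cvg :
  mx_cvg F (fun t => dmx (Bsym P (nu t)) (u t) (p t)) (dmx (Bsym P nu0) u0 p0).
Proof.
move=> i j; rewrite mxE; under eq_fun do rewrite mxE.
have /(_ FF i 0) := mx_cvgM (derive_Bsym_cvg (v := delta_mx j 0)) hp; exact.
Qed.

End Limits.

End Symbols.

(** * Limits of blocks *)

Section BlockLimits.
Variables (R : realType) (T : Type) (F : set_system T).
Context {FF : Filter F}.
Variables (m1 m2 k1 k2 : nat).

Lemma mx_cvg_usub (M : T -> 'M[R]_(m1 + m2, k1)) M0 :
  mx_cvg F M M0 -> mx_cvg F (fun t => usubmx (M t)) (usubmx M0).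
Proof. by move=> h i j; rewrite mxE; under eq_fun do rewrite mxE; exact: h. Qed.

Lemma mx_cvg_dsub (M : T -> 'M[R]_(m1 + m2, k1)) M0 :
  mx_cvg F M M0 -> mx_cvg F (fun t => dsubmx (M t)) (dsubmx M0).
Proof. by move=> h i j; rewrite mxE; under eq_fun do rewrite mxE; exact: h. Qed.

Lemma mx_cvg_lsub (M : T -> 'M[R]_(m1, k1 + k2)) M0 :
  mx_cvg F M M0 -> mx_cvg F (fun t => lsubmx (M t)) (lsubmx M0).
Proof. by move=> h i j; rewrite mxE; under eq_fun do rewrite mxE; exact: h. Qed.

Lemma mx_cvg_rsub (M : T -> 'M[R]_(m1, k1 + k2)) M0 :
  mx_cvg F M M0 -> mx_cvg F (fun t => rsubmx (M t)) (rsubmx M0).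
Proof. by move=> h i j; rewrite mxE; under eq_fun do rewrite mxE; exact: h. Qed.

Lemma mx_cvg_near_le (M : T -> 'M[R]_(m1, k1)) M0 (e : R) : 0 < e ->
  mx_cvg F M M0 -> \forall t \near F, `|M t - M0| <= e.
Proof.
move=> e0 /mx_cvgP/cvgrPdist_le/(_ e e0); apply: filterS => t.
by rewrite distrC.
Qed.

End BlockLimits.

(** * First-order form of the profile equation and of its linearization *)

Section Bulk.
Variables (R : realType) (d n1 n2 n3 N1p r : nat) (P : bvp R d n1 n2 n3 N1p r).
Hypotheses (hset : setting P) (hstr : structural_hypotheses P).
Local Notation N := (n1 + n2)%N.
Local Notation state := 'cV[R]_N.
Implicit Types (u p a : state) (nu : 'cV[R]_d).

(* The first-order form of the profile equation: with v the second component of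
   the flux, it reads [bulk_mx w' = (0, v)], [v' = (A_nu w')^2]. *)
Definition bulk_mx nu u : 'M[R]_N :=
  block_mx (ulsubmx (Asym P nu u)) (ursubmx (Asym P nu u)) 0 (drsubmx (Bsym P nu u)).
(** Along a layer w' = [Hmx] v and v' = [Gmx] v. In the linearized system [Hamx] and [Gamx], linear
    in the slope p, are the coefficients of the perturbation a itself. *)
Definition Hmx nu u : 'M[R]_(N, n2) := invmx (bulk_mx nu u) *m col_mx 0 1%:M.
Definition Gmx nu u : 'M[R]_n2 := dsubmx (Asym P nu u) *m Hmx nu u.
Definition Jmx nu u p : 'M[R]_N :=
  col_mx (usubmx (dmx (Asym P nu) u p)) (dsubmx (dmx (Bsym P nu) u p)).
Definition Hamx nu u p : 'M[R]_N := - (invmx (bulk_mx nu u) *m Jmx nu u p).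
Definition Gamx nu u p : 'M[R]_(n2, N) :=
  dsubmx (Asym P nu u) *m Hamx nu u p + dsubmx (dmx (Asym P nu) u p).

Lemma bulk_unit nu u : ulsubmx (Asym P nu u) \in unitmx ->
  drsubmx (Bsym P nu u) \in unitmx -> bulk_mx nu u \in unitmx.
Proof. by rewrite !unitmxE det_ublock unitrM => -> ->. Qed.

Lemma bulk_mul nu u (x : state) : states P u ->
  bulk_mx nu u *m x = col_mx (usubmx (Asym P nu u *m x)) (dsubmx (Bsym P nu u *m x)).
Proof.
move=> hu; rewrite [in RHS](Bsym_block hset nu hu) -[in RHS](submxK (Asym P nu u)).
rewrite -[in RHS](vsubmxK x) !mul_block_col col_mxKu col_mxKd.
by rewrite -[in LHS](vsubmxK x) mul_block_col !mul0mx.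
Qed.

(** The first block of the equation and the definition of the flux b form together a linear system
    for the derivative x, of matrix [bulk_mx]. *)
Lemma bulk_solve nu u p a (x : state) (b : 'cV[R]_n2) :
  states P u -> bulk_mx nu u \in unitmx ->
  usubmx (Asym P nu u *m x + dmx (Asym P nu) u p *m a) = 0 /\
  dsubmx (Bsym P nu u *m x + dmx (Bsym P nu) u p *m a) = b <->
  x = Hmx nu u *m b + Hamx nu u p *m a.
Proof.
move=> hu uE; have Ex := bulk_mul nu x hu.
have Ja : Jmx nu u p *m a = col_mx (usubmx (dmx (Asym P nu) u p *m a))
    (dsubmx (dmx (Bsym P nu) u p *m a)).
  by rewrite /Jmx mul_col_mx mul_usub_mx mul_dsub_mx.
have key : bulk_mx nu u *m x + Jmx nu u p *m a =
    col_mx (usubmx (Asym P nu u *m x + dmx (Asym P nu) u p *m a))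
      (dsubmx (Bsym P nu u *m x + dmx (Bsym P nu) u p *m a)).
  by rewrite Ex Ja add_col_mx !linearD.
have solE : Hmx nu u *m b + Hamx nu u p *m a =
    invmx (bulk_mx nu u) *m (col_mx 0 b - Jmx nu u p *m a).
  by rewrite /Hmx /Hamx mulNmx mulmxBr -!mulmxA mul_col_mx mul0mx mul1mx.
rewrite solE; split=> [[h1 h2]|xE].
  by move: key; rewrite h1 h2 => <-; rewrite addrK mulKmx.
move: key; rewrite [in LHS]xE mulKVmx// subrK => /eq_col_mx[<- <-].
by [].
Qed.

Lemma JmxZ nu u c p : Jmx nu u (c *: p) = c *: Jmx nu u p.
Proof. by rewrite /Jmx !dmxZ !linearZ /= scale_col_mx. Qed.

Lemma HamxZ nu u c p : Hamx nu u (c *: p) = c *: Hamx nu u p.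
Proof. by rewrite /Hamx JmxZ -scalemxAr scalerN. Qed.

Lemma GamxZ nu u c p : Gamx nu u (c *: p) = c *: Gamx nu u p.
Proof. by rewrite /Gamx HamxZ dmxZ -scalemxAr linearZ /= scalerDr. Qed.

Section BulkLimits.
Variables (T : Type) (F : set_system T).
Context {FF : Filter F}.
Variables (u : T -> state) (u0 : state) (nu : T -> 'cV[R]_d) (nu0 : 'cV[R]_d).
Hypotheses (hu0 : states P u0) (hu : mx_cvg F u u0) (hnu : mx_cvg F nu nu0).
Hypothesis uE : bulk_mx nu0 u0 \in unitmx.

Lemma bulk_cvg : mx_cvg F (fun t => bulk_mx (nu t) (u t)) (bulk_mx nu0 u0).
Proof.
have /(_ FF) hA := Asym_cvg hstr hu0 hu hnu.
have /(_ FF) hB := Bsym_cvg hstr hu0 hu hnu.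
apply: mx_cvg_block; last 2 first.
- exact: mx_cvg_cst.
- exact: mx_cvg_rsub (mx_cvg_dsub hB).
- exact: mx_cvg_lsub (mx_cvg_usub hA).
- exact: mx_cvg_rsub (mx_cvg_usub hA).
Qed.

Lemma Hmx_cvg : mx_cvg F (fun t => Hmx (nu t) (u t)) (Hmx nu0 u0).
Proof. by apply: mx_cvgM; [exact: mx_cvg_inv bulk_cvg uE|exact: mx_cvg_cst]. Qed.

Lemma Gmx_cvg : mx_cvg F (fun t => Gmx (nu t) (u t)) (Gmx nu0 u0).
Proof. by apply: mx_cvgM; [exact: mx_cvg_dsub (Asym_cvg hstr hu0 hu hnu)|exact: Hmx_cvg]. Qed.

Lemma bulk_unit_near : \forall t \near F, bulk_mx (nu t) (u t) \in unitmx.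
Proof.
have d0 : 0 < `|\det (bulk_mx nu0 u0)| by rewrite normr_gt0 -unitfE -unitmxE.
have /cvgrPdist_lt/(_ _ d0) : \det (bulk_mx (nu t) (u t)) @[t --> F] --> \det (bulk_mx nu0 u0).
  exact: mx_cvg_det bulk_cvg.
apply: filterS => t; rewrite unitmxE unitfE; apply: contraTneq => ->.
by rewrite subr0 ltxx.
Qed.

Variables (p : T -> state) (p0 : state).
Hypothesis hp : mx_cvg F p p0.

Lemma Hamx_cvg : mx_cvg F (fun t => Hamx (nu t) (u t) (p t)) (Hamx nu0 u0 p0).
Proof.
apply: mx_cvgN; apply: mx_cvgM; first exact: mx_cvg_inv bulk_cvg uE.
apply: mx_cvg_col; first exact: mx_cvg_usub (dmx_Asym_cvg hset hstr hu0 hu hnu hp).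
exact: mx_cvg_dsub (dmx_Bsym_cvg hset hstr hu0 hu hnu hp).
Qed.

Lemma Gamx_cvg : mx_cvg F (fun t => Gamx (nu t) (u t) (p t)) (Gamx nu0 u0 p0).
Proof.
apply: mx_cvgD; last exact: mx_cvg_dsub (dmx_Asym_cvg hset hstr hu0 hu hnu hp).
by apply: mx_cvgM; [exact: mx_cvg_dsub (Asym_cvg hstr hu0 hu hnu)|exact: Hamx_cvg].
Qed.

End BulkLimits.

(** Rescaling p to norm e / 2 turns a bound near p = 0, which continuity provides, into a linear
    one. *)
Lemma homogeneous_bound m k (f : state -> 'M[R]_(m, k)) (e : R) : 0 < e ->
  (forall c p, f (c *: p) = c *: f p) -> (forall p, `|p| < e -> `|f p| <= 1) ->
  forall p, `|f p| <= 2 / e * `|p|.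
Proof.
move=> e0 fZ hf p; have [->|p0] := eqVneq p 0.
  by have := fZ 0 0; rewrite !scale0r => ->; rewrite !normr0 mulr0.
have np : 0 < `|p| by rewrite normr_gt0.
have [c c0 cp] : exists2 c : R, 0 < c & c * `|p| = e / 2.
  by exists (e / 2 / `|p|); [rewrite !divr_gt0|rewrite divfK// gt_eqF].
have := hf (c *: p); rewrite fZ [`|c *: p|]normrZ [`|c *: f p|]normrZ (gtr0_norm c0) cp.
rewrite ltr_pdivrMr// ltr_pMr// ltr1n => /(_ isT) h.
rewrite mulrAC ler_pdivlMr// -(ler_pM2l c0) mulrA.
have -> : c * (2 * `|p|) = e by rewrite mulrCA cp mulrC divfK.
by rewrite ler_piMl// ltW.
Qed.

End Bulk.

(** * Uniform estimates of the coefficients near a base point *)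

Section BulkNear.
Variables (R : realType) (d n1 n2 n3 N1p r : nat) (P : bvp R d n1 n2 n3 N1p r).
Hypotheses (hset : setting P) (hstr : structural_hypotheses P).
Local Notation N := (n1 + n2)%N.
Local Notation state := 'cV[R]_N.
Implicit Types (u p a : state) (nu : 'cV[R]_d).
Lemma ball_of_norm (V : normedModType R) (x y : V) (e : R) : `|y - x| < e -> ball x e y.
Proof. by rewrite -ball_normE /= distrC. Qed.

(** K is chosen before eps: the coefficients depending on the slope are bounded linearly in p with a
    fixed constant, while the others can be brought as close as desired to their values at the base
    point. *)
Lemma bulk_near u0 nu0 : states P u0 -> bulk_mx P nu0 u0 \in unitmx ->
  exists2 K : R, 0 < K & forall eps : R, 0 < eps -> exists2 rho : R, 0 < rho &
    forall u nu, `|u - u0| <= rho -> `|nu - nu0| <= rho ->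
    [/\ states P u, bulk_mx P nu u \in unitmx, `|Hmx P nu u - Hmx P nu0 u0| <= eps,
        `|Gmx P nu u - Gmx P nu0 u0| <= eps &
        `|drsubmx (Bsym P nu u) - drsubmx (Bsym P nu0 u0)| <= eps] /\
    forall p, [/\ `|Hamx P nu u p| <= K * `|p|, `|Gamx P nu u p| <= K * `|p| &
        `|dsubmx (dmx (Bsym P nu) u p)| <= K * `|p|].
Proof.
move=> hu0 uE.
have fst_cvg (V W : normedModType R) (x : V) (y : W) : (@fst V W) t @[t --> (x, y)] --> x.
  exact: cvg_fst.
have snd_cvg (V W : normedModType R) (x : V) (y : W) : (@snd V W) t @[t --> (x, y)] --> y.
  exact: cvg_snd.
(* Joint continuity at p = 0, where the three matrices vanish; homogeneity in p then extends the
   bound to all p. *)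
have [e e0 he] : exists2 e : R, 0 < e & forall u nu p,
    `|u - u0| < e -> `|nu - nu0| < e -> `|p| < e ->
    [/\ `|Hamx P nu u p| <= 1, `|Gamx P nu u p| <= 1 & `|dsubmx (dmx (Bsym P nu) u p)| <= 1].
  pose F := nbhs ((u0, nu0), (0 : state)).
  have cu : mx_cvg F (fun t => t.1.1) u0.
    by apply/mx_cvgP; apply: cvg_comp (fst_cvg _ _ _ _) (fst_cvg _ _ _ _).
  have cnu : mx_cvg F (fun t => t.1.2) nu0.
    by apply/mx_cvgP; apply: cvg_comp (fst_cvg _ _ _ _) (snd_cvg _ _ _ _).
  have cp : mx_cvg F (fun t => t.2) (0 : state) by apply/mx_cvgP; exact: snd_cvg.
  have h1 : \forall t \near F, `|Hamx P t.1.2 t.1.1 t.2 - Hamx P nu0 u0 0| <= 1.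
    exact: mx_cvg_near_le ltr01 (Hamx_cvg hset hstr hu0 cu cnu uE cp).
  have h2 : \forall t \near F, `|Gamx P t.1.2 t.1.1 t.2 - Gamx P nu0 u0 0| <= 1.
    exact: mx_cvg_near_le ltr01 (Gamx_cvg hset hstr hu0 cu cnu uE cp).
  have h3 : \forall t \near F, `|dsubmx (dmx (Bsym P t.1.2) t.1.1 t.2) -
      dsubmx (dmx (Bsym P nu0) u0 0)| <= 1.
    exact: mx_cvg_near_le ltr01 (mx_cvg_dsub (dmx_Bsym_cvg hset hstr hu0 cu cnu cp)).
  have : \forall t \near ((u0, nu0), (0 : state)), [/\ `|Hamx P t.1.2 t.1.1 t.2 - Hamx P nu0 u0 0| <= 1,
      `|Gamx P t.1.2 t.1.1 t.2 - Gamx P nu0 u0 0| <= 1 &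
      `|dsubmx (dmx (Bsym P t.1.2) t.1.1 t.2) - dsubmx (dmx (Bsym P nu0) u0 0)| <= 1].
    by apply: filterS3 h1 h2 h3.
  move=> /nbhs_ballP[e /= e0 he].
  exists e => // u nu p hu hnu hp.
  have hp' : `|p - 0| < e by rewrite subr0.
  have [] := he ((u, nu), p) (conj (conj (ball_of_norm hu) (ball_of_norm hnu)) (ball_of_norm hp')).
  have H0 : Hamx P nu0 u0 0 = 0 by have := HamxZ P nu0 u0 0 0; rewrite !scale0r.
  have Ga0 : Gamx P nu0 u0 0 = 0 by have := GamxZ P nu0 u0 0 0; rewrite !scale0r.
  have -> : dsubmx (dmx (Bsym P nu0) u0 0) = 0 by rewrite dmx0 linear0.
  by rewrite H0 Ga0 !subr0.
exists (2 / e); first by rewrite divr_gt0.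
move=> eps eps0.
pose F := nbhs (u0, nu0); have FF : Filter F by exact: nbhs_filter.
have cu : mx_cvg F (fun t => t.1) u0 by apply/mx_cvgP; exact: fst_cvg.
have cnu : mx_cvg F (fun t => t.2) nu0 by apply/mx_cvgP; exact: snd_cvg.
have h1 : \forall t \near F, `|Hmx P t.2 t.1 - Hmx P nu0 u0| <= eps.
  exact: mx_cvg_near_le eps0 (Hmx_cvg hstr hu0 cu cnu uE).
have h2 : \forall t \near F, `|Gmx P t.2 t.1 - Gmx P nu0 u0| <= eps.
  exact: mx_cvg_near_le eps0 (Gmx_cvg hstr hu0 cu cnu uE).
have h3 : \forall t \near F, `|drsubmx (Bsym P t.2 t.1) - drsubmx (Bsym P nu0 u0)| <= eps.
  exact: mx_cvg_near_le eps0 (mx_cvg_rsub (mx_cvg_dsub (Bsym_cvg hstr hu0 cu cnu))).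
have h4 : \forall t \near F, bulk_mx P t.2 t.1 \in unitmx.
  exact: (bulk_unit_near hstr hu0 cu cnu uE).
have h5 : \forall t \near F, states P t.1 by have := @states_near _ _ _ _ _ _ _ _ hset _ F FF _ _ hu0 cu; exact.
have h123 : \forall t \near (u0, nu0), [/\ `|Hmx P t.2 t.1 - Hmx P nu0 u0| <= eps,
    `|Gmx P t.2 t.1 - Gmx P nu0 u0| <= eps &
    `|drsubmx (Bsym P t.2 t.1) - drsubmx (Bsym P nu0 u0)| <= eps].
  by apply: filterS3 h1 h2 h3.
have : \forall t \near (u0, nu0), [/\ states P t.1, bulk_mx P t.2 t.1 \in unitmx,
    `|Hmx P t.2 t.1 - Hmx P nu0 u0| <= eps, `|Gmx P t.2 t.1 - Gmx P nu0 u0| <= eps &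
    `|drsubmx (Bsym P t.2 t.1) - drsubmx (Bsym P nu0 u0)| <= eps].
  by apply: filterS3 h123 h4 h5 => t [].
move=> /nbhs_ballP[e' /= e'0 he'].
pose rho := Num.min e e' / 2.
have m0 : 0 < Num.min e e' by rewrite lt_min e0.
exists rho; first by rewrite divr_gt0.
move=> u nu hu hnu.
have rm : rho < Num.min e e' by rewrite ltr_pdivrMr// ltr_pMr// ltr1n.
have /andP[re re'] : (rho < e) && (rho < e') by rewrite -lt_min.
split.
  exact: (he' (u, nu) (conj (ball_of_norm (le_lt_trans hu re')) (ball_of_norm (le_lt_trans hnu re')))).
have hH p (hp : `|p| < e) := he u nu p (le_lt_trans hu re) (le_lt_trans hnu re) hp.
move=> p; split.
- by apply: (homogeneous_bound e0 (HamxZ P nu u)) => q /hH[].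
- by apply: (homogeneous_bound e0 (GamxZ P nu u)) => q /hH[].
- apply: (homogeneous_bound e0 (f := fun p => dsubmx (dmx (Bsym P nu) u p))) => [c q|q /hH[//]].
  by rewrite dmxZ linearZ.
Qed.


End BulkNear.

(** * Blocks of the flux and their one-sided derivatives *)

Section HalfLineFlux.
Variables (R : realType) (n1 n2 : nat).

Lemma half_deriv_congr n (Y D D' : R -> 'cV[R]_n) :
  (forall z, 0 < z -> D z = D' z) -> half_deriv Y D -> half_deriv Y D'.
Proof. by move=> e [cY hY]; split=> // z i z0; rewrite -e//; exact: hY. Qed.

Lemma half_deriv_eqfun n (Y Y' D : R -> 'cV[R]_n) :
  (forall z, Y z = Y' z) -> half_deriv Y D -> half_deriv Y' D.
Proof. by move=> /funext ->. Qed.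

Lemma hl_is_deriv_usub (f : R -> 'cV[R]_(n1 + n2)) (z : R) df :
  hl_is_deriv f z df -> hl_is_deriv (fun t => usubmx (f t)) z (usubmx df).
Proof.
move=> /hl_is_deriv_entry h; apply/hl_is_deriv_entry => i.
by rewrite !mxE; under eq_fun do rewrite !mxE; exact: h.
Qed.

Lemma hl_is_deriv_cst n (c : 'cV[R]_n) (z : R) : hl_is_deriv (fun=> c) z 0.
Proof.
rewrite /hl_is_deriv /hl_quotient; under eq_fun do rewrite subrr scaler0.
exact: cvg_cst.
Qed.

Lemma hl_flux_split (f : R -> 'cV[R]_(n1 + n2)) : hl_derivable f ->
  (forall z, 0 <= z -> usubmx (f z) = 0) -> forall z, 0 <= z ->
  usubmx (hl_deriv f z) = 0 /\
  hl_is_deriv (fun t => dsubmx (f t)) z (dsubmx (hl_deriv f z)).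
Proof.
move=> hf f0 z z0; have h := hl_derivableP hf z0; split; last exact: hl_is_deriv_dsub.
rewrite -(hl_is_derivE z0 (hl_is_deriv_usub h)); apply: (hl_is_derivE z0).
by apply: (hl_is_deriv_congr (f := fun=> 0)) => // [t t0|]; [rewrite f0|exact: hl_is_deriv_cst].
Qed.

Lemma hl_flux_join (f : R -> 'cV[R]_(n1 + n2)) (b : R -> 'cV[R]_n2) (z : R) db :
  0 <= z -> (forall t, 0 <= t -> f t = col_mx 0 (b t)) -> hl_is_deriv b z db ->
  hl_is_deriv f z (col_mx 0 db).
Proof.
move=> z0 fE hb; apply: (hl_is_deriv_congr (f := fun t => col_mx 0 (b t))) => //.
  by move=> t t0; rewrite fE.
move/hl_is_deriv_entry : hb => hb; apply/hl_is_deriv_entry => i.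
rewrite -(fintype.splitK i); case: (fintype.split i) => j /=.
  have -> : col_mx 0 db (lshift n2 j) 0 = 0 by rewrite col_mxEu mxE.
  under eq_fun do rewrite !col_mxEu !mxE subrr mulr0.
  exact: cvg_cst.
have -> : col_mx 0 db (rshift n1 j) 0 = db j 0 by rewrite col_mxEd.
by under eq_fun do rewrite !col_mxEd; exact: hb.
Qed.

Lemma half_deriv_hl_entry n (Y D : R -> 'cV[R]_n) : half_deriv Y D ->
  (forall i, continuous (fun z => D z i 0)) ->
  hl_derivable Y /\ forall z, 0 <= z -> hl_deriv Y z = D z.
Proof.
move=> hY cD; have h z : 0 <= z -> hl_is_deriv Y z (D z) by exact: half_deriv_hl.
by split=> [|z z0]; [exact: hl_is_deriv_derivable h|exact: hl_is_derivE z0 (h z z0)].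
Qed.

End HalfLineFlux.

(** * The constant-coefficient system at a boundary state *)

Section BasePoint.
Variables (R : realType) (d n1 n2 n3 N1p r : nat) (P : bvp R d n1 n2 n3 N1p r).
Hypotheses (hset : setting P) (hstr : structural_hypotheses P).
Local Notation N := (n1 + n2)%N.
Variables (u0 : 'cV[R]_N) (nu0 : 'cV[R]_d).
Hypothesis hbd : Ubd_nu P (u0, nu0).
Local Notation H0 := (Hmx P nu0 u0).
Local Notation G0 := (Gmx P nu0 u0).
Local Notation B0 := (drsubmx (Bsym P nu0 u0)).

Lemma base_states : states P u0.
Proof. by left; exact: Ubd_piU hbd. Qed.

Lemma base_units : ulsubmx (Asym P nu0 u0) \in unitmx /\ B0 \in unitmx.
Proof.
have uA := Abar11_unit hstr (Ubd_Ustar hset hbd).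
by have [] := reduced_bar hset hstr base_states (Ustar_normal hset (Ubd_Ustar hset hbd)) uA.
Qed.

Lemma base_bulk_unit : bulk_mx P nu0 u0 \in unitmx.
Proof. by have [] := base_units; exact: bulk_unit. Qed.

Lemma base_HmxE : H0 = col_mx
  (- (invmx (ulsubmx (Asym P nu0 u0)) *m ursubmx (Asym P nu0 u0) *m invmx B0)) (invmx B0).
Proof.
have [uA uB] := base_units.
apply: (can_inj (mulKmx base_bulk_unit)); rewrite mulKVmx ?base_bulk_unit//.
rewrite mul_block_col mul0mx add0r mulmxV// mulmxN -!mulmxA (mulKVmx uA).
by rewrite addNr.
Qed.

(** G0 governs the flux and [Gnu] the derivative of the second component; the flux is [B0] times
    that derivative, so [B0] conjugates the two. *)
Lemma base_GmxE : G0 *m B0 = B0 *m Gnu P nu0 u0.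
Proof.
have [uA uB] := base_units.
rewrite /Gmx base_HmxE /Gnu (mulKVmx uB) -{1}(submxK (Asym P nu0 u0)) block_mxEv.
rewrite col_mxKd mul_row_col mulmxDl mulmxN mulNmx -!mulmxA (mulVmx uB) !mulmx1.
by rewrite addrC.
Qed.

Lemma base_Gmx_eig (p : pred R[i]) :
  num_eig p (cmx G0) = num_eig p (cmx (Gnu P nu0 u0)).
Proof.
have [_ uB] := base_units; apply: (@num_eig_sim R n2 p (cmx B0)).
  by rewrite /cmx map_unitmx.
by rewrite /cmx -!map_mxM base_GmxE.
Qed.

Lemma base_Gmx_hyperbolic (z : R[i]) : eigenvalue (cmx G0) z -> complex.Re z != 0.
Proof.
move=> hz; apply: (Gnu_hyperbolic hset hstr hbd); rewrite eigenvalue_root_char.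
have [_ uB] := base_units.
have <- : char_poly (cmx G0) = char_poly (cmx (Gnu P nu0 u0)).
  apply: (@char_poly_sim _ _ (cmx B0)); first by rewrite /cmx map_unitmx.
  by rewrite /cmx -!map_mxM base_GmxE.
by rewrite -eigenvalue_root_char.
Qed.

Lemma base_Gmx_unit : G0 \in unitmx.
Proof. by apply: unitmx_eigenvalue => /base_Gmx_hyperbolic; rewrite eqxx. Qed.

(** The second block of H0 G0^-1 is B0^-1 G0^-1, so b can be recovered from the second block of a =
    H0 G0^-1 b. This is what makes the Dirichlet data of a decaying solution determine it. *)
Lemma base_slow_linv : G0 *m B0 *m dsubmx (slow_mx G0 H0) = 1%:M.
Proof.
have [_ uB] := base_units.
rewrite /slow_mx -mul_dsub_mx base_HmxE col_mxKd.
move: base_Gmx_unit; move: (Gmx P nu0 u0) => g ug.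
by rewrite -!mulmxA (mulKVmx uB) mulmxV.
Qed.

End BasePoint.

(** * Reduction of the equation linearized at a layer to a first-order system *)

Section LayerReduction.
Variables (R : realType) (d n1 n2 n3 N1p r : nat) (P : bvp R d n1 n2 n3 N1p r).
Hypotheses (hset : setting P) (hstr : structural_hypotheses P).
Local Notation N := (n1 + n2)%N.
Local Notation state := 'cV[R]_N.
Variables (nu : 'cV[R]_d) (w : R -> state).
Hypotheses (nu_neq0 : nu != 0) (hw : layer P nu w).
Implicit Types (a : R -> state) (b : R -> 'cV[R]_n2).

Definition layer_flux z := dsubmx (Bsym P nu (w z) *m hl_deriv w z).
Local Notation W z := (w (Num.max z 0)).
Local Notation V z := (layer_flux (Num.max z 0)).

Lemma layer_states z : 0 <= z -> states P (w z).
Proof. by have [+ _ _ _ _] := hw; exact. Qed.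

Lemma layer_ext_states z : states P (W z).
Proof. exact/layer_states/max0_ge0. Qed.

Lemma Bsym_mul_top u (x : state) : states P u -> usubmx (Bsym P nu u *m x) = 0.
Proof.
by move=> hu; rewrite (Bsym_block hset nu hu) -mul_usub_mx col_mxKu row_mx0 mul0mx.
Qed.

Lemma Bsym_mul_bottom u (x : state) : states P u ->
  dsubmx (Bsym P nu u *m x) = drsubmx (Bsym P nu u) *m dsubmx x.
Proof.
move=> hu; rewrite {1}(Bsym_block hset nu hu) -{1}(vsubmxK x) mul_block_col col_mxKd.
by rewrite mul0mx add0r.
Qed.

Lemma layer_flux_eqs z : 0 <= z ->
  usubmx (Asym P nu (w z) *m hl_deriv w z) = 0 /\
  hl_is_deriv layer_flux z (dsubmx (Asym P nu (w z) *m hl_deriv w z)).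
Proof.
have [hs _ hf heq _] := hw => z0.
have [|h1 h2] := hl_flux_split hf _ z0.
  by move=> t t0; apply: Bsym_mul_top; exact: layer_states.
move/subr0_eq: (heq z z0) => e; split; first by rewrite e.
by rewrite e.
Qed.

Lemma layer_state_deriv : half_deriv (fun z : R => W z) (fun z => hl_deriv w (Num.max z 0)).
Proof. by apply: hl_half_deriv; have [] := hw. Qed.

Lemma layer_flux_derivable : hl_derivable layer_flux.
Proof.
apply: (@hl_is_deriv_derivable _ _ _
  (fun z => dsubmx (Asym P nu (w z) *m hl_deriv w z))) => z z0.
by have [] := layer_flux_eqs z0.
Qed.

Lemma layer_flux_continuous i : continuous (fun z : R => V z i 0).
Proof. by have [+ _] := hl_half_deriv layer_flux_derivable; exact. Qed.

Lemma ext_state_cvg (z : R) : mx_cvg (nbhs z) (fun t : R => W t) (W z).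
Proof. by move=> i j; rewrite (ord1 j); exact: layer_state_deriv.1. Qed.

Lemma layer_B22_unit u : states P u -> drsubmx (Bsym P nu u) \in unitmx.
Proof.
move=> hu; have [a [c [e [A0E ua ue]]]] := A0_blocks hset hstr hu.
have := Bbar22_unit hstr hu nu_neq0.
have : Bsym P nu u = coefA0 P u *m Bbar P u nu by rewrite BbarE mulKVmx// A0_unit.
rewrite (Bbar_block hset hstr nu hu) A0E mulmx_block !mul0mx !mulmx0 !add0r => ->.
by rewrite block_mxKdr unitmx_mul ue.
Qed.

Lemma layer_deriv2E z : 0 <= z ->
  dsubmx (hl_deriv w z) = invmx (drsubmx (Bsym P nu (w z))) *m layer_flux z.
Proof.
move=> z0; have hs := layer_states z0.
by rewrite /layer_flux Bsym_mul_bottom// mulKmx// layer_B22_unit.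
Qed.

(** The derivative of the second component is the inverse of B applied to the flux, and the flux is
    differentiable, hence continuous. *)
Lemma layer_deriv2_continuous i :
  continuous (fun z : R => (dsubmx (hl_deriv w (Num.max z 0))) i 0).
Proof.
have -> : (fun z : R => (dsubmx (hl_deriv w (Num.max z 0))) i 0) =
    (fun z : R => (invmx (drsubmx (Bsym P nu (W z))) *m V z) i 0).
  by apply/funext => z; rewrite layer_deriv2E// max0_ge0.
move=> z; rewrite /continuous_at.
have hB : mx_cvg (nbhs z) (fun t : R => Bsym P nu (W t)) (Bsym P nu (W z)).
  apply: (Bsym_cvg hstr (layer_ext_states z) (@ext_state_cvg z) (nu := fun=> nu)).
  exact: mx_cvg_cst.
have hV : mx_cvg (nbhs z) (fun t : R => V t) (V z).
  by move=> k j; rewrite (ord1 j); exact: layer_flux_continuous.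
have hI : mx_cvg (nbhs z) (fun t : R => invmx (drsubmx (Bsym P nu (W t))))
    (invmx (drsubmx (Bsym P nu (W z)))).
  exact: mx_cvg_inv (mx_cvg_rsub (mx_cvg_dsub hB)) (layer_B22_unit (layer_ext_states z)).
have hM : mx_cvg (nbhs z) (fun t : R => invmx (drsubmx (Bsym P nu (W t))) *m V t)
    (invmx (drsubmx (Bsym P nu (W z))) *m V z) by exact: mx_cvgM hI hV.
exact: hM.
Qed.

Hypothesis uE : forall z, 0 <= z -> bulk_mx P nu (w z) \in unitmx.

(** The derivative of w expressed through the flux, a form in which it is continuous on the whole
    line. *)
Definition layer_slope z : state := Hmx P nu (W z) *m V z.

Lemma layer_slopeE z : 0 <= z -> layer_slope z = hl_deriv w z.
Proof.
move=> z0; rewrite /layer_slope (max_idPl z0); apply/esym.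
have [h1 _] := layer_flux_eqs z0.
have := bulk_solve hset 0 0 (hl_deriv w z) (layer_flux z) (layer_states z0) (uE z0).
by move=> [+ _]; rewrite mulmx0 addr0 mulmx0 addr0 mulmx0 addr0; apply.
Qed.

Lemma layer_flux_half_deriv :
  half_deriv (fun z : R => V z) (fun z => Gmx P nu (W z) *m V z).
Proof.
apply: half_deriv_congr (hl_half_deriv layer_flux_derivable) => z /ltW z0.
have [_ h] := layer_flux_eqs z0.
rewrite (max_idPl z0) (hl_is_derivE z0 h) -layer_slopeE// /layer_slope (max_idPl z0).
by rewrite /Gmx -mulmxA mul_dsub_mx.
Qed.

Definition layer_coefs : coefs R N n2 :=
  Coefs (fun z => Hmx P nu (W z)) (fun z => Hamx P nu (W z) (layer_slope z))
        (fun z => Gmx P nu (W z)) (fun z => Gamx P nu (W z) (layer_slope z)).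

Lemma layer_coefsE z : 0 <= z ->
  [/\ cHb layer_coefs z = Hmx P nu (w z),
      cHa layer_coefs z = Hamx P nu (w z) (layer_slope z),
      cGb layer_coefs z = Gmx P nu (w z) &
      cGa layer_coefs z = Gamx P nu (w z) (layer_slope z)].
Proof. by move=> z0; rewrite /layer_coefs /cHb /cHa /cGb /cGa (max_idPl z0). Qed.

Lemma layer_coefs_continuous : coefs_continuous layer_coefs.
Proof.
have hnu (z : R) : mx_cvg (nbhs z) (fun=> nu) nu by exact: mx_cvg_cst.
have hV (z : R) : mx_cvg (nbhs z) (fun t : R => V t) (V z).
  by move=> i j; rewrite (ord1 j); exact: layer_flux_continuous.
have hu (z : R) : bulk_mx P nu (W z) \in unitmx by exact/uE/max0_ge0.
have hH (z : R) : mx_cvg (nbhs z) (fun t : R => Hmx P nu (W t)) (Hmx P nu (W z)).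
  exact: (Hmx_cvg hstr (layer_ext_states z) (@ext_state_cvg z) (hnu z) (hu z)).
have hp (z : R) : mx_cvg (nbhs z) layer_slope (layer_slope z) by exact: mx_cvgM.
split=> i j z.
- exact: hH.
- have h : mx_cvg (nbhs z) (fun t : R => Hamx P nu (W t) (layer_slope t))
      (Hamx P nu (W z) (layer_slope z)).
    exact: (Hamx_cvg hset hstr (layer_ext_states z) (@ext_state_cvg z) (hnu z) (hu z) (hp z)).
  exact: h.
- have h : mx_cvg (nbhs z) (fun t : R => Gmx P nu (W t)) (Gmx P nu (W z)).
    exact: (Gmx_cvg hstr (layer_ext_states z) (@ext_state_cvg z) (hnu z) (hu z)).
  exact: h.
- have h : mx_cvg (nbhs z) (fun t : R => Gamx P nu (W t) (layer_slope t))
      (Gamx P nu (W z) (layer_slope z)).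
    exact: (Gamx_cvg hset hstr (layer_ext_states z) (@ext_state_cvg z) (hnu z) (hu z) (hp z)).
  exact: h.
Qed.

Definition lin_flux a z : state :=
  Bsym P nu (w z) *m hl_deriv a z + 'D_(a z) (Bsym P nu) (w z) *m hl_deriv w z.

Lemma lin_flux_top a z : 0 <= z -> usubmx (lin_flux a z) = 0.
Proof.
move=> z0; have hs := layer_states z0; rewrite /lin_flux linearD /= Bsym_mul_top// add0r.
by rewrite -mul_usub_mx derive_Bsym_top// mul0mx.
Qed.

Lemma lin_flux_bottom a z : 0 <= z -> dsubmx (lin_flux a z) =
  dsubmx (Bsym P nu (w z) *m hl_deriv a z + dmx (Bsym P nu) (w z) (layer_slope z) *m a z).
Proof.
move=> z0; have hs := layer_states z0.
by rewrite /lin_flux layer_slopeE// dmx_mul//; exact: Bsym_differentiable.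
Qed.

Lemma derive_Asym_mul a z : 0 <= z -> 'D_(a z) (Asym P nu) (w z) *m hl_deriv w z =
  dmx (Asym P nu) (w z) (layer_slope z) *m a z.
Proof.
move=> z0; have hs := layer_states z0.
by rewrite layer_slopeE// dmx_mul//; exact: Asym_differentiable.
Qed.

(** The algebraic part of the linearized equation expresses a' through a and the flux by
    [bulk_solve]; its second block is then the differential equation of the flux. *)
Lemma linearized_sys a : linearized_sol P nu w a ->
  sys layer_coefs (fun z : R => a (Num.max z 0))
    (fun z => dsubmx (lin_flux a (Num.max z 0))).
Proof.
move=> [ha hf heq].
have key z : 0 <= z ->
    hl_deriv a z = Hmx P nu (w z) *m dsubmx (lin_flux a z) +
      Hamx P nu (w z) (layer_slope z) *m a z /\
    hl_is_deriv (fun t => dsubmx (lin_flux a t)) z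
      (Gmx P nu (w z) *m dsubmx (lin_flux a z) + Gamx P nu (w z) (layer_slope z) *m a z).
  move=> z0; have [|h1 h2] := hl_flux_split hf _ z0; first exact: lin_flux_top.
  move/subr0_eq: (heq z z0); rewrite derive_Asym_mul// => e.
  have aE : hl_deriv a z = Hmx P nu (w z) *m dsubmx (lin_flux a z) +
      Hamx P nu (w z) (layer_slope z) *m a z.
    apply/(bulk_solve hset (layer_slope z) (a z) (hl_deriv a z) _ (layer_states z0) (uE z0)).
    by rewrite e; split=> //; rewrite lin_flux_bottom.
  split=> //; move: h2; rewrite -e linearD /= -mul_dsub_mx aE mulmxDr.
  by rewrite /Gmx /Gamx mulmxDl -mul_dsub_mx !mulmxA addrA.
split.
- apply: half_deriv_congr (hl_half_deriv ha) => z /ltW z0.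
  by rewrite /= (max_idPl z0); have [-> _] := key z z0.
- have hb : hl_derivable (fun t => dsubmx (lin_flux a t)).
    by apply: (@hl_is_deriv_derivable _ _ _ (fun z => Gmx P nu (w z) *m dsubmx (lin_flux a z) +
      Gamx P nu (w z) (layer_slope z) *m a z)) => z /key[].
  apply: half_deriv_congr (hl_half_deriv hb) => z /ltW z0.
  have [_ h] := key z z0.
  by rewrite /= (max_idPl z0) (hl_is_derivE z0 h).
Qed.

(** Continuity of the coefficients gives one-sided derivatives at 0 as well, and [bulk_solve] read
    backwards identifies b with the flux. *)
Lemma sys_linearized a b : sys layer_coefs a b ->
  linearized_sol P nu w a /\ forall z, 0 <= z -> dsubmx (lin_flux a z) = b z.
Proof.
move=> [ha hb]; have [cHb' cHa' cGb' cGa'] := layer_coefs_continuous.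
have ca := ha.1; have cb := hb.1.
have cva (z : R) : mx_cvg (nbhs z) a (a z) by move=> i j; rewrite (ord1 j); exact: ca.
have cvb (z : R) : mx_cvg (nbhs z) b (b z) by move=> i j; rewrite (ord1 j); exact: cb.
have [|da daE] := half_deriv_hl_entry ha.
  move=> i z; have h : mx_cvg (nbhs z) (fun z => cHb layer_coefs z *m b z +
      cHa layer_coefs z *m a z) (cHb layer_coefs z *m b z + cHa layer_coefs z *m a z).
    by apply: mx_cvgD; apply: mx_cvgM => // k l; [exact: cHb'|exact: cHa'].
  exact: h.
have [|db dbE] := half_deriv_hl_entry hb.
  move=> i z; have h : mx_cvg (nbhs z) (fun z => cGb layer_coefs z *m b z +
      cGa layer_coefs z *m a z) (cGb layer_coefs z *m b z + cGa layer_coefs z *m a z).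
    by apply: mx_cvgD; apply: mx_cvgM => // k l; [exact: cGb'|exact: cGa'].
  exact: h.
have sol z : 0 <= z ->
    usubmx (Asym P nu (w z) *m hl_deriv a z +
      dmx (Asym P nu) (w z) (layer_slope z) *m a z) = 0 /\
    dsubmx (lin_flux a z) = b z.
  move=> z0; rewrite lin_flux_bottom//.
  apply/(bulk_solve hset (layer_slope z) (a z) (hl_deriv a z) (b z) (layer_states z0) (uE z0)).
  by have [<- <- _ _] := layer_coefsE z0; exact: daE.
have fE t : 0 <= t -> lin_flux a t = col_mx 0 (b t).
  by move=> t0; rewrite -[LHS]vsubmxK lin_flux_top//; have [_ ->] := sol t t0.
have df z : 0 <= z -> hl_is_deriv (lin_flux a) z (col_mx 0 (hl_deriv b z)).
  move=> z0; apply: (hl_flux_join z0 fE); exact: hl_derivableP.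
split; last by move=> z /sol[].
split; [exact: da|exact: hl_is_deriv_derivable df|].
move=> z z0; rewrite derive_Asym_mul// (hl_is_derivE z0 (df z z0)).
apply/eqP; rewrite subr_eq0; apply/eqP.
rewrite -[LHS]vsubmxK; have [-> _] := sol z z0; congr col_mx.
have [e1 e2 e3 e4] := layer_coefsE z0.
rewrite linearD /= -mul_dsub_mx (dbE z z0) (daE z z0) e1 e2 e3 e4.
by rewrite mulmxDr /Gmx /Gamx mulmxDl -!mul_dsub_mx !mulmxA addrA.
Qed.

End LayerReduction.

(** * Small layers as exponentially decaying perturbations of a constant state *)

Section LayerPerturbation.
Variables (R : realType) (d n1 n2 n3 N1p r : nat) (P : bvp R d n1 n2 n3 N1p r).
Hypotheses (hset : setting P) (hstr : structural_hypotheses P).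
Local Notation N := (n1 + n2)%N.
Variables (u0 : 'cV[R]_N) (nu0 : 'cV[R]_d).
Hypothesis hbd : Ubd_nu P (u0, nu0).
Local Notation H0 := (Hmx P nu0 u0).
Local Notation G0 := (Gmx P nu0 u0).
Local Notation B0 := (drsubmx (Bsym P nu0 u0)).
Variable D : dichotomy G0.
Local Notation kappa := (decay_rate D).

Definition near_base (rho : R) (nu : 'cV[R]_d) (w : R -> 'cV[R]_N) : Prop :=
  `|nu - nu0| <= rho /\
  forall z, 0 <= z -> `|w z - u0| <= rho /\ `|dsubmx (hl_deriv w z)| <= rho.

(** The flux solves v' = G(w) v with G(w) close to G0. Being bounded, it decays exponentially by
    [decay_inf], and with it the slope and the coefficients that are linear in the slope. *)
Lemma layer_perturbed (eps : R) : 0 < eps -> exists2 rho : R, 0 < rho &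
  forall nu w, nu != 0 -> layer P nu w -> near_base rho nu w ->
  [/\ forall z, 0 <= z -> bulk_mx P nu (w z) \in unitmx,
      perturbed D H0 eps (layer_coefs P nu w) &
      `|dsubmx (dmx (Bsym P nu) (w 0) (layer_slope P nu w 0))| <= eps].
Proof.
move=> eps0.
have [e [C [e0 C0 dec]]] := decay_inf D.
have [K K0 hK] := bulk_near hset hstr (base_states hbd) (base_bulk_unit hset hstr hbd).
have k0 := decay_rate_gt0 D.
have n0 : 0 < n2%:R + 1 :> R by rewrite ltr_wpDl.
pose eps1 := Num.min eps (Num.min 1 (e / (n2%:R + 1))).
have eps10 : 0 < eps1 by rewrite !lt_min eps0 ltr01 divr_gt0.
have /and3P[le1 le2 le3] : [&& eps1 <= eps, eps1 <= 1 & eps1 <= e / (n2%:R + 1)].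
  by rewrite -!le_min.
rewrite ler_pdivlMr// in le3.
have [rho1 rho10 h1] := hK eps1 eps10.
have [b1 [b10 b1E]] : exists b1 : R, 0 <= b1 /\ n2%:R * (`|B0| + 1) = b1.
  by exists (n2%:R * (`|B0| + 1)); rewrite mulr_ge0// addr_ge0.
(* b1 rho bounds the flux and M rho exp (- kappa z) the slope; rho is then taken with K M rho <=
   eps. *)
pose M := n2%:R * (`|H0| + 1) * (C * (n2%:R * `|projm D| * b1)).
have M0 : 0 <= M by do ?[exact: b10 | exact: (ltW C0) | apply: addr_ge0 | apply: mulr_ge0].
have KM0 : 0 < K * M + 1 by rewrite ltr_wpDl// mulr_ge0// ltW.
exists (Num.min rho1 (eps / (K * M + 1))); first by rewrite lt_min rho10 divr_gt0.
move=> nu w nuN0 hw [].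
set rho := Num.min _ _ => hnu hwz.
have /andP[rr1 rr2] : (rho <= rho1) && (rho <= eps / (K * M + 1)) by rewrite -le_min.
rewrite ler_pdivlMr// in rr2.
have rho0 : 0 <= rho by apply: le_trans hnu.
have near z (z0 : 0 <= z) := h1 (w z) nu (le_trans (hwz z z0).1 rr1) (le_trans hnu rr1).
have uE z : 0 <= z -> bulk_mx P nu (w z) \in unitmx by move=> /near[[]].
have fluxb z : 0 <= z -> `|layer_flux P nu w z| <= b1 * rho.
  move=> z0; have [[hs _ _ _ hB] _] := near z z0.
  rewrite /layer_flux Bsym_mul_bottom//; apply: le_trans (mulmx_norm _ _) _.
  rewrite -b1E ler_pM ?mulr_ge0//; last by have [] := hwz z z0.
  rewrite ler_wpM2l// -(subrK B0 (drsubmx _)) addrC (le_trans (ler_normD _ _))// lerD2l.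
  exact: le_trans le2.
have fluxd z : 0 <= z ->
    `|layer_flux P nu w z| <= C * (n2%:R * `|projm D| * b1) * rho * expR (- kappa * z).
  move=> z0.
  have B1 (t : R) : `|layer_flux P nu w (Num.max t 0)| <= b1 * rho by exact/fluxb/max0_ge0.
  have := dec _ _ 0 ((b1 * rho) ^+ 2) (layer_flux_half_deriv hset hw uE) (lexx _).
  have q1 (t : R) : 0 <= t ->
      `|layer_flux P nu w (Num.max t 0)| ^+ 2 <= (b1 * rho) ^+ 2 * expR (rate D / 2 * t).
    move=> t0; apply: (@le_trans _ _ ((b1 * rho) ^+ 2)).
      by rewrite ler_pXn2r ?nnegrE ?mulr_ge0.
    rewrite ler_peMr ?sqr_ge0// -expR0 ler_expR mulr_ge0// divr_ge0// ltW//.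
    exact: rate_gt0.
  have q2 (t : R) : 0 < t -> `|Gmx P nu (w (Num.max t 0)) *m layer_flux P nu w (Num.max t 0) -
       G0 *m layer_flux P nu w (Num.max t 0)| <=
      e * `|layer_flux P nu w (Num.max t 0)| + 0 * expR (- kappa * t).
    move=> _; rewrite mul0r addr0 -mulmxBl; apply: le_trans (mulmx_norm _ _) _.
    rewrite ler_wpM2r//; have [[_ _ _ hG _] _] := near _ (max0_ge0 t).
    apply: le_trans (ler_wpM2l _ hG) _; first exact: ler0n.
    by lra.
  move=> /(_ q1 q2 z z0); rewrite (max_idPl z0) addr0 maxxx => h; apply: le_trans h _.
  rewrite ler_wpM2r ?expR_ge0// -!mulrA ler_wpM2l ?(ltW C0)//.
  apply: le_trans (mulmx_norm _ _) _; rewrite -!mulrA ler_wpM2l// ler_wpM2l//.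
  exact: fluxb.
have slopeb z : 0 <= z -> `|layer_slope P nu w z| <= M * rho * expR (- kappa * z).
  move=> z0; rewrite /layer_slope (max_idPl z0); apply: le_trans (mulmx_norm _ _) _.
  rewrite /M -[_ * rho]mulrA -[leRHS]mulrA ler_pM ?mulr_ge0//; last exact: fluxd.
  rewrite ler_wpM2l// -(subrK H0 (Hmx _ _ _)) addrC (le_trans (ler_normD _ _))// lerD2l.
  by have [[_ _ hH _ _] _] := near z z0; exact: le_trans le2.
have small z : 0 <= z -> K * `|layer_slope P nu w z| <= eps * expR (- kappa * z).
  move=> z0; apply: le_trans (ler_wpM2l (ltW K0) (slopeb z z0)) _.
  by rewrite mulrA ler_wpM2r ?expR_ge0//; lra.
split=> //.
- move=> z z0; have [e1 e2 e3 e4] := layer_coefsE P nu w z0; rewrite e1 e2 e3 e4.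
  have [[_ _ hH hG _] hp] := near z z0; have [h2 h3 _] := hp (layer_slope P nu w z).
  split; [exact: le_trans le1|exact: le_trans le1| |]; exact: le_trans (small z z0).
- have [_ hp] := near 0 (lexx _); have [_ _ h3] := hp (layer_slope P nu w 0).
  by apply: le_trans h3 _; have := small 0 (lexx _); rewrite mulr0 expR0 mulr1.
Qed.

End LayerPerturbation.

Lemma small_products (R : realFieldType) (x s e : R) : 0 <= x -> 0 <= s -> 0 <= e ->
  e * (2 * (x * (s + 1) + 1)) <= 1 -> x * e * s <= 1 / 2 /\ x * e <= 1 / 2.
Proof.
move=> x0 s0 e0.
have : 0 <= x * e by rewrite mulr_ge0.
have : 0 <= x * e * s by rewrite !mulr_ge0.
by split; lra.
Qed.

(** The term x s b is at most b / 2 and is absorbed into the left-hand side. *)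
Lemma absorb_bound (R : realFieldType) (x s q c b a : R) :
  b <= x * a -> x * a <= x * (c + s * b) -> x * c <= 1 / 2 * c -> x * s * b <= 1 / 2 * b ->
  0 <= q * c -> 0 <= c -> b <= (q + 1) * c.
Proof. by move=> *; lra. Qed.

(** * Solutions of the linearized equation at a small layer *)

Section LocalSolutions.
Variables (R : realType) (d n1 n2 n3 N1p r : nat) (P : bvp R d n1 n2 n3 N1p r).
Hypotheses (hset : setting P) (hstr : structural_hypotheses P).
Local Notation N := (n1 + n2)%N.
Local Notation state := 'cV[R]_N.
Variables (u0 : 'cV[R]_N) (nu0 : 'cV[R]_d).
Hypothesis hbd : Ubd_nu P (u0, nu0).
Local Notation H0 := (Hmx P nu0 u0).
Local Notation G0 := (Gmx P nu0 u0).
Local Notation B0 := (drsubmx (Bsym P nu0 u0)).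
Variable D : dichotomy G0.
Local Notation kappa := (decay_rate D).

Lemma cvg0_eventually (a : R -> state) : a z @[z --> +oo] --> (0 : state) ->
  forall e : R, 0 < e -> exists Z, forall z, Z <= z -> `|a (Num.max z 0)| <= e.
Proof.
move=> /cvgrPdist_le h e /h[M [_ hM]]; exists (Num.max (M + 1) 0) => z.
rewrite ge_max => /andP[Mz z0]; rewrite (max_idPl z0) -[a z]subr0 distrC; apply: hM.
by apply: lt_le_trans Mz; rewrite ltrDl.
Qed.

(** Each condition at 0 bounds the flux b by the slow variable c, as [decaying_unique] requires. If
    a^2(0) = 0, then b = - Q c. If the derivative of a^2 vanishes at 0, only the term of b with the
    derivative of B remains: it is of order eps |a|, and a = c + E0 b allows absorption. *)
Lemma layer_decaying_unique : exists2 rho : R, 0 < rho &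
  forall nu w a, nu != 0 -> layer P nu w -> near_base u0 nu0 rho nu w ->
  linearized_sol P nu w a -> a z @[z --> +oo] --> (0 : state) ->
  dsubmx (a 0) = 0 \/ dsubmx (hl_deriv a 0) = 0 -> forall z, 0 <= z -> a z = 0.
Proof.
have uG := base_Gmx_unit hset hstr hbd.
pose Q : 'M[R]_(n2, N) := G0 *m B0 *m dsubmx 1%:M.
have QM k (v : 'M[R]_(N, k)) : Q *m v = G0 *m B0 *m dsubmx v.
  have dE : dsubmx 1%:M *m v = dsubmx v by rewrite mul_dsub_mx mul1mx.
  by rewrite /Q -[_ *m dsubmx _ *m v]mulmxA dE.
have QE : Q *m slow_mx G0 H0 = 1%:M by rewrite QM; exact: base_slow_linv.
have C30 : 0 <= N%:R * `|Q| + 1 by rewrite addr_ge0// mulr_ge0.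
have [eps0 eps00 uniq] := decaying_unique D uG QE C30.
pose E1 := N%:R * (n2%:R * `|slow_mx G0 H0| + 1) : R.
have E10 : 0 <= E1 by rewrite mulr_ge0// addr_ge0// mulr_ge0.
have E2 : 0 < 2 * (E1 + 1) by rewrite mulr_gt0// ltr_wpDl.
have [eps [eps_gt0 le1 le2]] : exists eps : R,
    [/\ 0 < eps, eps <= eps0 & eps * (2 * (E1 + 1)) <= 1].
  exists (Num.min eps0 (1 / (2 * (E1 + 1)))); split.
  - by rewrite lt_min eps00 divr_gt0.
  - by rewrite ge_min lexx.
  - by rewrite -ler_pdivlMr// ge_min lexx orbT.
have [rho rho0 hrho] := layer_perturbed hset hstr hbd D eps_gt0.
exists rho => // nu w a nuN0 hw hnear ha a0 ha0.
have [uE pert JB] := hrho nu w nuN0 hw hnear.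
have hs := linearized_sys hset hstr hw uE ha.
have eps_ge0 := ltW eps_gt0.
have key := uniq eps _ _ _ le1 pert hs (cvg0_eventually a0).
suff bc : `|dsubmx (lin_flux P nu w a (Num.max 0 0))| <= (N%:R * `|Q| + 1) *
   `|slow_var G0 H0 (fun z : R => a (Num.max z 0))
      (fun z => dsubmx (lin_flux P nu w a (Num.max z 0))) 0|.
  by move=> z z0; have := key bc z z0; rewrite (max_idPl z0).
rewrite /slow_var maxxx.
set b0 := dsubmx _; set c0 := a 0 - _.
have c00 : 0 <= `|c0| by [].
case: ha0 => ha0.
  have -> : b0 = - (Q *m c0).
    by rewrite /c0 mulmxBr mulmxA QE mul1mx QM ha0 mulmx0 sub0r opprK.
  rewrite normrN; apply: le_trans (mulmx_norm _ _) _.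
  by rewrite ler_wpM2r// lerDl.
have b0E : b0 = dsubmx (dmx (Bsym P nu) (w 0) (layer_slope P nu w 0)) *m a 0.
  rewrite /b0 (lin_flux_bottom hset hstr hw uE)//.
  have hs0 := layer_states hw (lexx 0).
  by rewrite linearD /= Bsym_mul_bottom// ha0 mulmx0 add0r mul_dsub_mx.
have b0le : `|b0| <= N%:R * eps * `|a 0|.
  rewrite b0E; apply: le_trans (mulmx_norm _ _) _.
  by rewrite ler_wpM2r// ler_wpM2l.
have a0le : `|a 0| <= `|c0| + n2%:R * `|slow_mx G0 H0| * `|b0|.
  rewrite -(subrK (slow_mx G0 H0 *m b0) (a 0)); apply: le_trans (ler_normD _ _) _.
  by rewrite lerD2l; exact: mulmx_norm.
have b00 : 0 <= `|b0| by [].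
have N0 : 0 <= N%:R :> R by [].
have S0 : 0 <= n2%:R * `|slow_mx G0 H0| by rewrite mulr_ge0.
have [w1 w2] := small_products N0 S0 eps_ge0 le2.
have w3 := ler_wpM2l (mulr_ge0 N0 eps_ge0) a0le.
have w4 := ler_wpM2r c00 w2.
have w5 := ler_wpM2r b00 w1.
have w6 : 0 <= N%:R * `|Q| * `|c0| by rewrite !mulr_ge0.
exact: absorb_bound b0le w3 w4 w5 w6 c00.
Qed.

(** The solution given by [decaying_exists] has a limit because its derivative is exponentially
    small. *)
Lemma layer_decaying_exists : exists2 rho : R, 0 < rho &
  forall nu w, nu != 0 -> layer P nu w -> near_base u0 nu0 rho nu w ->
  forall (al : state) (be : 'cV_(dimm D)), exists a,
  [/\ linearized_sol P nu w a, cvg (a z @[z --> +oo]), a 0 = al &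
      projm D *m dsubmx (lin_flux P nu w a 0) = be].
Proof.
have uG := base_Gmx_unit hset hstr hbd.
have [eps0 [C [eps00 C0 hex]]] := decaying_exists D H0 uG.
have [rho rho0 hrho] := layer_perturbed hset hstr hbd D eps00.
exists rho => // nu w nuN0 hw hnear al be.
have [uE pert _] := hrho nu w nuN0 hw hnear.
have cX := layer_coefs_continuous hset hstr hw uE.
have [a [b [hs a0 b0 hab]]] := hex eps0 _ (lexx _) pert cX al be.
have [ha hb] := sys_linearized hset hstr hw uE hs.
exists a; split => //; last by rewrite hb.
set S := C * (`|al| + `|be|) in hab.
have S0 : 0 <= S by rewrite mulr_ge0 ?addr_ge0// ltW.
apply: (half_deriv_cvg (decay_rate_gt0 D) _ hs.1
  (C := n2%:R * (`|H0| + eps0) * S + N%:R * eps0 * S)).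
  by rewrite addr_ge0// !mulr_ge0// ?addr_ge0// ltW.
move=> z /ltW z0; have [p1 _ p3 _] := pert z z0; have [h1 h2] := hab z z0.
rewrite mulrDl; apply: le_trans (ler_normD _ _) _; apply: lerD.
  apply: le_trans (mulmx_norm _ _) _; rewrite -[leRHS]mulrA ler_pM ?mulr_ge0//.
  rewrite ler_wpM2l// -(subrK H0 (cHb _ z)) addrC (le_trans (ler_normD _ _))// lerD2l//.
apply: le_trans (mulmx_norm _ _) _.
rewrite [leRHS]mulrAC ler_pM ?mulr_ge0// -mulrA ler_wpM2l//.
Qed.

End LocalSolutions.

(** * Real and imaginary parts *)

Section RealImaginary.
Variable R : realType.
Local Notation C := R[i].

Lemma rpart_mul m n (M : 'M[R]_(m, n)) (v : 'cV[C]_n) :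
  rpart (cmx M *m v) = M *m rpart v.
Proof.
apply/matrixP => i j; rewrite !mxE raddf_sum; apply: eq_bigr => k _.
by rewrite !mxE; case: (v k j) => x y /=; rewrite mul0r subr0.
Qed.

Lemma ipart_mul m n (M : 'M[R]_(m, n)) (v : 'cV[C]_n) :
  ipart (cmx M *m v) = M *m ipart v.
Proof.
apply/matrixP => i j; rewrite !mxE raddf_sum; apply: eq_bigr => k _.
by rewrite !mxE; case: (v k j) => x y /=; rewrite mul0r addr0.
Qed.

Lemma rpart_pair n (x y : 'cV[R]_n) : rpart (cmx x + 'i%C *: cmx y) = x.
Proof. by apply/matrixP => i j; rewrite !mxE /= mul0r mul1r subr0 addr0. Qed.

Lemma ipart_pair n (x y : 'cV[R]_n) : ipart (cmx x + 'i%C *: cmx y) = y.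
Proof. by apply/matrixP => i j; rewrite !mxE /= mul0r mul1r !add0r. Qed.

Lemma rpart_cmx n (x : 'cV[R]_n) : rpart (cmx x) = x.
Proof. by apply/matrixP => i j; rewrite !mxE. Qed.

Lemma ipart_cmx n (x : 'cV[R]_n) : ipart (cmx x) = 0.
Proof. by apply/matrixP => i j; rewrite !mxE. Qed.

Lemma rpart_dsub m n (v : 'cV[C]_(m + n)) : rpart (dsubmx v) = dsubmx (rpart v).
Proof. by apply/matrixP => i j; rewrite !mxE. Qed.

Lemma ipart_dsub m n (v : 'cV[C]_(m + n)) : ipart (dsubmx v) = dsubmx (ipart v).
Proof. by apply/matrixP => i j; rewrite !mxE. Qed.

Lemma parts_eq0 n (v : 'cV[C]_n) : rpart v = 0 -> ipart v = 0 -> v = 0.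
Proof.
move=> hr hi; apply/matrixP => i j.
have := congr1 (fun M : 'cV[R]_n => M i j) hr; have := congr1 (fun M : 'cV[R]_n => M i j) hi.
by rewrite !mxE; case: (v i j) => x y /= -> ->.
Qed.

Lemma rpart0 n : rpart (0 : 'cV[C]_n) = 0.
Proof. by apply/matrixP => i j; rewrite !mxE. Qed.

Lemma ipart0 n : ipart (0 : 'cV[C]_n) = 0.
Proof. by apply/matrixP => i j; rewrite !mxE. Qed.

Lemma full_rank_inj m n (M : 'M[R]_(m, n)) (v : 'cV[R]_n) :
  \rank M = n -> M *m v = 0 -> v = 0.
Proof.
move=> /eqP/row_fullP[L LM] h.
by rewrite -[v]mul1mx -LM -mulmxA h mulmx0.
Qed.

Lemma rank_delta m k (e : k = m) :
  \rank (\matrix_(i < m, j < k) ((i == cast_ord e j)%:R : C)) = k.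
Proof.
case: m / e; rewrite (_ : (\matrix_(i, j) _) = 1%:M) ?mxrank1//.
by apply/matrixP => i j; rewrite !mxE cast_ord_id.
Qed.

End RealImaginary.

(** * Transversality expressed with real solutions *)

Section LocalTransversality.
Variables (R : realType) (d n1 n2 n3 N1p r : nat) (P : bvp R d n1 n2 n3 N1p r).
Hypotheses (hset : setting P) (hstr : structural_hypotheses P).
Local Notation N := (n1 + n2)%N.
Local Notation state := 'cV[R]_N.

Lemma piUstar_open : open (piUstar P).
Proof.
rewrite openE => u [t [x [ht hx hu]]].
have [hO _ _] := Ostar_continuous hset.
have : nbhs u (Ostar P (t, x)) by apply: open_nbhs_nbhs; split => //; exact: hO.
by apply: filterS => v hv; exists t, x.
Qed.

Lemma linearized_sol0 nu w : linearized_sol P nu w (fun=> 0).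
Proof.
have h0 (z : R) : 0 <= z -> hl_deriv (fun=> 0 : state) z = 0.
  by move=> z0; exact: hl_is_derivE z0 (hl_is_deriv_cst _ _).
have f0 (z : R) : 0 <= z -> lin_flux P nu w (fun=> 0) z = 0.
  by move=> z0; rewrite /lin_flux h0// mulmx0 derive0 mul0mx addr0.
have df (z : R) : 0 <= z -> hl_is_deriv (lin_flux P nu w (fun=> 0)) z 0.
  move=> z0; apply: (hl_is_deriv_congr (f := fun=> 0)) => // [t t0|]; first by rewrite f0.
  exact: hl_is_deriv_cst.
split.
- exact: hl_is_deriv_derivable (fun z _ => hl_is_deriv_cst 0 z).
- exact: (@hl_is_deriv_derivable _ _ (lin_flux P nu w (fun=> 0)) (fun=> 0) df).
- move=> z z0; rewrite h0// mulmx0 derive0 mul0mx addr0.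
  by rewrite (hl_is_derivE z0 (df z z0)) subr0.
Qed.

Lemma S0sol_parts nu w a : S0sol P nu w a ->
  (linearized_sol P nu w (fun z => rpart (a z)) /\
   rpart (a z) @[z --> +oo] --> (0 : state)) /\
  (linearized_sol P nu w (fun z => ipart (a z)) /\
   ipart (a z) @[z --> +oo] --> (0 : state)).
Proof. by move=> [[h1 h2 _ _] h3 h4]. Qed.

Lemma Gamma_real w a : hl_derivable a ->
  Gamma P w (fun z => cmx (a z)) =
  cmx (col_mx (jacobian_mx (Ups1 P) (usubmx (w 0)) *m usubmx (a 0))
        (col_mx (jacobian_mx (Ups2 P) (dsubmx (w 0)) *m dsubmx (a 0))
          (Knu P *m dsubmx (hl_deriv a 0)))).
Proof.
move=> ha; rewrite /Gamma /chl_deriv.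
have -> : (fun s => rpart (dsubmx (cmx (a s)))) = (fun s => dsubmx (a s)).
  by apply/funext => s; rewrite rpart_dsub rpart_cmx.
have -> : (fun s => ipart (dsubmx (cmx (a s)))) = (fun=> 0).
  by apply/funext => s; rewrite ipart_dsub ipart_cmx linear0.
rewrite (hl_is_derivE (lexx 0) (hl_is_deriv_dsub (hl_derivableP ha (lexx 0)))).
rewrite (hl_is_derivE (lexx 0) (hl_is_deriv_cst _ _)).
rewrite [cmx 0]map_mx0 scaler0 addr0 /cmx -map_usubmx -map_dsubmx.
by rewrite -!map_mxM -!map_col_mx.
Qed.

Lemma real_Ssol nu w a : linearized_sol P nu w a -> cvg (a z @[z --> +oo]) ->
  Ssol P nu w (fun z => cmx (a z)).
Proof.
have re : (fun z => rpart (cmx (a z))) = a by apply/funext => z; exact: rpart_cmx.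
have im : (fun z => ipart (cmx (a z))) = (fun=> 0) by apply/funext => z; exact: ipart_cmx.
move=> ha ca; split.
- by rewrite re.
- by rewrite im; exact: linearized_sol0.
- by rewrite re.
- by rewrite im; exact: is_cvg_cst.
Qed.

(** [Nb] is the number of rows of [Gamma], so the rank condition is surjectivity, and it is enough
    to reach the canonical basis by real solutions. *)
Lemma has_rank_surjective nu w : (n3 <= n2)%N ->
  (forall y : 'cV[R]_(N1p + (n2 - n3 + n3)), exists a,
    [/\ linearized_sol P nu w a, cvg (a z @[z --> +oo]) &
        col_mx (jacobian_mx (Ups1 P) (usubmx (w 0)) *m usubmx (a 0))
          (col_mx (jacobian_mx (Ups2 P) (dsubmx (w 0)) *m dsubmx (a 0))
            (Knu P *m dsubmx (hl_deriv a 0))) = y]) ->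
  has_rank (Ssol P nu w) (Gamma P w) (Nb n2 N1p).
Proof.
move=> n32 surj.
have E : Nb n2 N1p = (N1p + (n2 - n3 + n3))%N by rewrite /Nb subnK// addnC.
split; last first.
  by move=> l e _; rewrite [leqRHS]E; exact: rank_leq_row.
have [a ha] := choice (fun j : 'I_(Nb n2 N1p) => surj (delta_mx (cast_ord E j) 0)).
exists (fun j z => cmx (a j z)); split.
  by move=> j; have [h1 h2 _] := ha j; exact: real_Ssol.
rewrite -[RHS](@rank_delta R _ _ E); congr (\rank _); apply/matrixP => i j.
have [[h1 _ _] _ h3] := ha j.
rewrite [LHS]mxE [RHS]mxE (Gamma_real w h1) h3 !mxE eqxx andbT.
by case: (i == _).
Qed.

End LocalTransversality.

(** * Transversality near a boundary state in the extreme cases *)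

Section NearTransversality.
Variables (R : realType) (d n1 n2 n3 N1p r : nat) (P : bvp R d n1 n2 n3 N1p r).
Hypotheses (hset : setting P) (hstr : structural_hypotheses P).
Local Notation N := (n1 + n2)%N.
Local Notation state := 'cV[R]_N.
Variables (u0 : 'cV[R]_N) (nu0 : 'cV[R]_d).
Hypothesis hbd : Ubd_nu P (u0, nu0).
Local Notation G0 := (Gmx P nu0 u0).

Lemma base_dichotomy : inhabited (dichotomy G0).
Proof. by apply: dichotomy_exists => z; exact: base_Gmx_hyperbolic. Qed.

Lemma base_dimm (D : dichotomy G0) : dimm D = num_Re_neg (Gnu P nu0 u0).
Proof. by rewrite dimm_eig /num_Re_neg (base_Gmx_eig hset hstr hbd). Qed.

(** In each extreme case one of the Jacobian of [Ups2] and [Knu] has full column rank. *)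
Lemma boundary_data_kernel (w : R -> state) (x1 x2 : 'cV[R]_n2) :
  piUstar P (w 0) -> n3 = 0%N \/ n3 = n2 ->
  jacobian_mx (Ups2 P) (dsubmx (w 0)) *m x1 = 0 -> Knu P *m x2 = 0 -> x1 = 0 \/ x2 = 0.
Proof.
move=> hw [] e h1 h2; [left|right].
  by apply: (full_rank_inj _ h1); rewrite (Ups2_rank hstr hw) e subn0.
by apply: (full_rank_inj _ h2); rewrite (Ups3_rank hstr) e.
Qed.

Lemma surjective_mul m n (M : 'M[R]_(m, n)) (y : 'cV[R]_m) :
  \rank M = m -> exists x, M *m x = y.
Proof.
move=> /eqP/row_freeP[L ML]; exists (L *m y).
by rewrite mulmxA ML mul1mx.
Qed.

Lemma col0_eq m (x y : 'cV[R]_m) : m = 0%N -> x = y.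
Proof. by move=> m0; subst m; apply/matrixP => -[]. Qed.

(** Uniqueness is applied separately to the real and imaginary parts of a decaying solution.
    Surjectivity uses that a(0) is free and, in the Neumann case, that the whole flux at 0 is free
    too. *)
Lemma layer_transversal_near : (n3 <= n2)%N ->
  n3 = 0%N \/ (n3 = n2 /\ num_Re_neg (Gnu P nu0 u0) = n2) ->
  exists2 rho : R, 0 < rho & forall nu w, nu != 0 -> layer P nu w ->
    near_base u0 nu0 rho nu w -> transversal_layer P nu w.
Proof.
move=> n32 hcase; have [D] := base_dichotomy.
have [rho1 rho10 uniq] := layer_decaying_unique hset hstr hbd D.
have [rho2 rho20 hex] := layer_decaying_exists hset hstr hbd D.
have [rho3 rho30 hrho3] : exists2 rho : R, 0 < rho & forall u, `|u - u0| <= rho -> piUstar P u.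
  have /nbhs_ballP[e /= e0 he] : \forall u \near u0, piUstar P u.
    apply: open_nbhs_nbhs; split; first exact: piUstar_open.
    exact: Ustar_piUstar (Ubd_Ustar hset hbd).
  exists (e / 2); first by rewrite divr_gt0.
  move=> u hu; apply: he; apply: ball_of_norm; apply: le_lt_trans hu _.
  by rewrite ltr_pdivrMr// ltr_pMr// ltr1n.
exists (Num.min rho1 (Num.min rho2 rho3)); first by rewrite !lt_min rho10 rho20.
move=> nu w nuN0 hw [hnu hnear].
have near_le rho : Num.min rho1 (Num.min rho2 rho3) <= rho -> near_base u0 nu0 rho nu w.
  move=> h; split=> [|z /hnear[h1 h2]]; first exact: le_trans h.
  by split; exact: le_trans h.
have nb1 : near_base u0 nu0 rho1 nu w by apply: near_le; rewrite ge_min lexx.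
have nb2 : near_base u0 nu0 rho2 nu w by apply: near_le; rewrite !ge_min lexx orbT.
have hw0 : piUstar P (w 0).
  apply: hrho3; have [h _] := hnear 0 (lexx _); apply: le_trans h _.
  by rewrite !ge_min lexx !orbT.
have c1 := Ups1_rank hstr hw0; have c2 := Ups2_rank hstr hw0; have c3 := Ups3_rank hstr.
have n3case : n3 = 0%N \/ n3 = n2 by case: hcase => [|[]]; [left|right].
split.
- move=> a ha Ga z z0; have [[la al0] [li li0]] := S0sol_parts ha.
  have [g2 g3] : cmx (jacobian_mx (Ups2 P) (dsubmx (w 0))) *m dsubmx (a 0) = 0 /\
      cmx (Knu P) *m chl_deriv (fun z => dsubmx (a z)) 0 = 0.
    by move: Ga; rewrite /Gamma -!col_mx0 => /eq_col_mx[_ /eq_col_mx[-> ->]].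
  have part (f : R -> state) : linearized_sol P nu w f -> f z @[z --> +oo] --> (0 : state) ->
      jacobian_mx (Ups2 P) (dsubmx (w 0)) *m dsubmx (f 0) = 0 ->
      Knu P *m dsubmx (hl_deriv f 0) = 0 -> f z = 0.
    move=> lf f0 h1 h2; apply: (uniq nu w f nuN0 hw nb1 lf f0 _ z z0).
    exact: boundary_data_kernel hw0 n3case h1 h2.
  apply: parts_eq0.
  + apply: (part (fun z => rpart (a z)) la al0).
      by rewrite -rpart_dsub -rpart_mul g2 rpart0.
    move: g3 => /(congr1 (@rpart R n3)); rewrite rpart_mul /chl_deriv rpart_pair rpart0.
    have -> : (fun s => rpart (dsubmx (a s))) = (fun s => dsubmx (rpart (a s))).
      by apply/funext => s; rewrite rpart_dsub.
    have [da _ _] := la.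
    by rewrite (hl_is_derivE (lexx 0) (hl_is_deriv_dsub (hl_derivableP da (lexx 0)))).
  + apply: (part (fun z => ipart (a z)) li li0).
      by rewrite -ipart_dsub -ipart_mul g2 ipart0.
    move: g3 => /(congr1 (@ipart R n3)); rewrite ipart_mul /chl_deriv ipart_pair ipart0.
    have -> : (fun s => ipart (dsubmx (a s))) = (fun s => dsubmx (ipart (a s))).
      by apply/funext => s; rewrite ipart_dsub.
    have [da _ _] := li.
    by rewrite (hl_is_derivE (lexx 0) (hl_is_deriv_dsub (hl_derivableP da (lexx 0)))).
- apply: has_rank_surjective => // y.
  rewrite -(vsubmxK y) -[dsubmx y]vsubmxK.
  move: (usubmx y) (usubmx (dsubmx y)) (dsubmx (dsubmx y)) => y1 y2 y3.
  have [x1 x1E] := surjective_mul y1 c1.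
  case: hcase => [n30|[n3n2 dim]].
    have [x2 x2E] := surjective_mul y2 c2.
    have [a [la ca a0 _]] := hex nu w nuN0 hw nb2 (col_mx x1 x2) 0.
    exists a; split=> //; rewrite a0 col_mxKu col_mxKd x1E x2E.
    by congr (col_mx _ (col_mx _ _)); exact: col0_eq.
  have [q qE] := surjective_mul y3 c3.
  have hs0 := layer_states hw (lexx 0).
  pose al : state := col_mx x1 0.
  (* The flux at 0 of a solution with a(0) = [al] whose second component has derivative q. *)
  pose b0 := drsubmx (Bsym P nu (w 0)) *m q +
    dsubmx ('D_al (Bsym P nu) (w 0) *m hl_deriv w 0).
  have [a [la ca a0 hb]] := hex nu w nuN0 hw nb2 al (projm D *m b0).
  exists a; split=> //; rewrite a0 col_mxKu col_mxKd x1E.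
  congr (col_mx _ (col_mx _ _)); first by apply: col0_eq; rewrite n3n2 subnn.
  rewrite -qE; congr (_ *m _).
  (* As N^2_- = N' there are no expanding coordinates, so prescribing the contracting ones
     prescribes the flux. *)
  have dimp0 : dimp D = 0%N.
    by apply/eqP; rewrite -(eqn_add2r (dimm D)) dim_split add0n base_dimm dim.
  have bE : dsubmx (lin_flux P nu w a 0) = b0.
    apply/eqP; rewrite -subr_eq0; apply/eqP; apply: (@proj_inj _ _ _ D).
      exact: col0_eq.
    by rewrite mulmxBr hb subrr.
  move: bE; rewrite /lin_flux linearD /= a0 (Bsym_mul_bottom hset)// /b0.
  move/addIr; apply: (can_inj (mulKmx (layer_B22_unit hset hstr nuN0 hs0))).
Qed.

End NearTransversality.

(** * Bounded solutions of the constant-coefficient system *)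

Section ConstantCoefficients.
Variables (R : realType) (N n : nat) (G0 : 'M[R]_n) (D : dichotomy G0).
Variable H0 : 'M[R]_(N, n).
Hypothesis G0_unit : G0 \in unitmx.

(** The slow variable c is constant, so b = Q (a - c) is bounded for large z together with a,
    whereas a nonzero expanding part would grow exponentially. *)
Lemma bounded_expanding_eq0 (Q : 'M[R]_(n, N)) (M Z : R) (a : R -> 'cV[R]_N)
    (b : R -> 'cV[R]_n) :
  Q *m slow_mx G0 H0 = 1%:M ->
  half_deriv a (fun z => H0 *m b z) -> half_deriv b (fun z => G0 *m b z) ->
  (forall z, Z <= z -> `|a z| <= M) -> projp D *m b 0 = 0.
Proof.
move=> QE ha hb aM.
have hc := half_derivD ha (half_derivN (half_deriv_mul (slow_mx G0 H0) hb)).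
have cE z : 0 <= z -> slow_var G0 H0 a b z = slow_var G0 H0 a b 0.
  move=> z0; apply/matrixP => i j; rewrite (ord1 j).
  apply/eqP; rewrite -subr_eq0 -normr_le0.
  have := @is_derive_dist R (fun z => slow_var G0 H0 a b z i 0)
    (fun z => (H0 *m b z - slow_mx G0 H0 *m (G0 *m b z)) i 0) (cst 0) (cst 0) 0 z z0.
  rewrite subr0; apply.
  - exact: hc.1.
  - by move=> x; exact: cvg_cst.
  - by move=> x x0 _; exact: hc.2.
  - by move=> x _ _; rewrite /slow_mx mulmxA mulmxKV// subrr mxE normr0.
set c := slow_var G0 H0 a b 0 in cE.
have bE z : 0 <= z -> b z = Q *m (a z - c).
  by move=> z0; rewrite -(cE z z0) /slow_var opprB addrCA subrr addr0 mulmxA QE mul1mx.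
pose F z := sqv (formp D *m (projp D *m b z)).
have hF := half_deriv_mul (formp D) (half_deriv_mul (projp D) hb).
have r0 := rate_gt0 D.
have grow z : 0 <= z -> F 0 * expR (2 * rate D * z) <= F z.
  move=> z0.
  have := @gronwall_ge R F (fun z => 2 * dotv (formp D *m (projp D *m b z))
     (formp D *m (projp D *m (G0 *m b z)))) (2 * rate D) 0 z z0.
  rewrite subr0; apply.
  - exact: sqv_continuous hF.
  - by move=> x x0 _; exact: sqv_derive hF x0.
  - move=> x _ _; rewrite -mulrA ler_pM2l//; exact: proj_expand.
have bound : exists B : R, forall z, Num.max Z 0 <= z -> F z <= B.
  exists ((szp D)%:R * ((dimp D)%:R * `|formp D| * (n%:R * `|projp D| *
    (N%:R * `|Q| * (M + `|c|)))) ^+ 2) => z; rewrite ge_max => /andP[Zz z0].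
  apply: le_trans (sqv_norm _) _; rewrite ler_wpM2l//.
  set W := _ * (_ * _ * _).
  have hW : `|formp D *m (projp D *m b z)| <= W.
    apply: le_trans (mulmx_norm _ _) _; rewrite ler_wpM2l ?mulr_ge0//.
    apply: le_trans (mulmx_norm _ _) _; rewrite ler_wpM2l ?mulr_ge0//.
    rewrite bE//; apply: le_trans (mulmx_norm _ _) _; rewrite ler_wpM2l ?mulr_ge0//.
    by apply: le_trans (ler_normB _ _) _; rewrite lerD2r aM.
  have W0 : 0 <= W by apply: le_trans hW.
  by rewrite ler_pXn2r ?nnegrE.
have [B hB] := bound.
have F0 : F 0 = 0.
  apply/eqP; apply: contraT => F00.
  have Fpos : 0 < F 0 by rewrite lt0r F00; exact: sqv_ge0.
  have [] := @exp_dominates R (F 0) B (rate D) (Num.max Z 0) Fpos r0.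
  move=> z Zz; have z0 : 0 <= z by move: Zz; rewrite ge_max => /andP[].
  apply: le_trans (grow z z0) _; apply: le_trans (hB z Zz) _.
  have B0 : 0 <= B by apply: le_trans (hB _ Zz); exact: sqv_ge0.
  by rewrite ler_peMr// -expR0 ler_expR mulr_ge0// ltW.
apply: formp_inj; apply/eqP; rewrite -normr_le0 -(@ler_pXn2r _ 2)// ?nnegrE// expr0n /=.
by apply: le_trans (norm_sqv _) _; rewrite -/(F 0) F0.
Qed.

Lemma projp_row_free : row_free (projp D).
Proof.
have [|L LE] := @injective_linv R _ _ (col_mx (projp D) (projm D)).
  move=> v; rewrite mul_col_mx -col_mx0 => /eq_col_mx[]; exact: proj_inj.
have := mulmx_linv (dim_split D) LE => LE'.
apply: inj_row_free => v hv.
have : row_mx v 0 *m col_mx (projp D) (projm D) = 0.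
  by rewrite mul_row_col hv mul0mx addr0.
move=> /(congr1 (mulmx^~ L)); rewrite -mulmxA LE' mulmx1 mul0mx -row_mx0.
by move=> /eq_row_mx[].
Qed.

End ConstantCoefficients.

(** * Constant layers and the number of Neumann conditions *)

Section ConstantLayer.
Variables (R : realType) (d n1 n2 n3 N1p r : nat) (P : bvp R d n1 n2 n3 N1p r).
Hypotheses (hset : setting P) (hstr : structural_hypotheses P).
Local Notation N := (n1 + n2)%N.
Local Notation state := 'cV[R]_N.
Variables (u : 'cV[R]_N) (nu : 'cV[R]_d).
Hypothesis hbd : Ubd_nu P (u, nu).
Local Notation w := (fun _ : R => u).

Lemma constant_layer : layer P nu w.
Proof.
have h0 (z : R) : 0 <= z -> hl_deriv w z = 0.
  by move=> z0; exact: hl_is_derivE z0 (hl_is_deriv_cst _ _).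
have df (z : R) : 0 <= z -> hl_is_deriv (fun z => Bsym P nu (w z) *m hl_deriv w z) z 0.
  move=> z0; apply: (hl_is_deriv_congr (f := fun=> 0)) => // [t t0|].
    by rewrite h0// mulmx0.
  exact: hl_is_deriv_cst.
split.
- by move=> z _; exact: base_states hbd.
- exact: hl_is_deriv_derivable (fun z _ => hl_is_deriv_cst u z).
- exact: hl_is_deriv_derivable df.
- by move=> z z0; rewrite h0// mulmx0 (hl_is_derivE z0 (df z z0)) subrr.
- exact: is_cvg_cst.
Qed.

(** The slope of a constant layer is 0, so the flux is [B_nu] applied to the derivative of a^2; its
    expanding coordinates vanish when a has a limit. *)
Lemma constant_layer_contracting (D : dichotomy (Gmx P nu u)) (a : R -> state) :
  linearized_sol P nu w a -> cvg (a z @[z --> +oo]) ->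
  projp D *m drsubmx (Bsym P nu u) *m dsubmx (hl_deriv a 0) = 0.
Proof.
move=> ha ca; have uE (z : R) : 0 <= z -> bulk_mx P nu (w z) \in unitmx.
  by move=> _; exact: base_bulk_unit.
have hs := linearized_sys hset hstr constant_layer uE ha.
have p0 (z : R) : 0 <= z -> layer_slope P nu w z = 0.
  move=> z0; rewrite (layer_slopeE hset constant_layer uE z0).
  exact: hl_is_derivE z0 (hl_is_deriv_cst _ _).
have Ha0 : Hamx P nu u 0 = 0 by have := HamxZ P nu u 0 0; rewrite !scale0r.
have Ga0 : Gamx P nu u 0 = 0 by have := GamxZ P nu u 0 0; rewrite !scale0r.
set at_ := (fun z : R => a (Num.max z 0)) in hs.
set bt := (fun z : R => dsubmx (lin_flux P nu w a (Num.max z 0))) in hs.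
have hA : half_deriv at_ (fun z => Hmx P nu u *m bt z).
  apply: half_deriv_congr hs.1 => z /ltW z0.
  by have [-> -> _ _] := layer_coefsE P nu w z0; rewrite p0// Ha0 mul0mx addr0.
have hB : half_deriv bt (fun z => Gmx P nu u *m bt z).
  apply: half_deriv_congr hs.2 => z /ltW z0.
  by have [_ _ -> ->] := layer_coefsE P nu w z0; rewrite p0// Ga0 mul0mx addr0.
have /cvg_ex[l al] := ca.
have [M [Z hM]] : exists M Z : R, forall z, Z <= z -> `|at_ z| <= M.
  move/cvgrPdist_le : al => /(_ 1 ltr01)[Z [_ hZ]].
  exists (`|l| + 1), (Num.max (Z + 1) 0) => z; rewrite ge_max => /andP[Zz z0].
  rewrite /at_ (max_idPl z0) -(subKr l (a z)); apply: le_trans (ler_normB _ _) _.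
  by rewrite lerD2l; apply: hZ; apply: lt_le_trans Zz; rewrite ltrDl.
have uG := base_Gmx_unit hset hstr hbd.
pose Q : 'M[R]_(n2, N) := Gmx P nu u *m drsubmx (Bsym P nu u) *m dsubmx 1%:M.
have QE : Q *m slow_mx (Gmx P nu u) (Hmx P nu u) = 1%:M.
  have dE (X : 'M[R]_(N, n2)) : dsubmx 1%:M *m X = dsubmx X by rewrite mul_dsub_mx mul1mx.
  by rewrite /Q -[_ *m dsubmx _ *m _]mulmxA dE; exact: base_slow_linv.
have := bounded_expanding_eq0 D uG QE hA hB hM.
rewrite /bt maxxx (lin_flux_bottom hset hstr constant_layer uE)// p0// dmx0 mul0mx addr0.
by rewrite (Bsym_mul_bottom hset nu _ (base_states hbd)) mulmxA.
Qed.

Lemma cmx_pair_mul m n (M : 'M[R]_(m, n)) (x y : 'cV[R]_n) :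
  cmx M *m (cmx x + 'i%C *: cmx y) = cmx (M *m x) + 'i%C *: cmx (M *m y).
Proof. by rewrite mulmxDr -scalemxAr /cmx !map_mxM. Qed.

(** The derivatives of a^2 at 0 fill a space of dimension at most N^2_-, by the previous constraint,
    while a boundary operator of full rank needs their images under [Knu] to span [n3]
    dimensions. *)
Lemma constant_layer_neumann_le :
  (n3 <= n2)%N -> transversal_layer P nu w -> (n3 <= num_Re_neg (Gnu P nu u))%N.
Proof.
move=> n32 [_ [[e [he rk]] _]].
have [D] := base_dichotomy hset hstr hbd.
rewrite -(base_dimm hset hstr hbd D).
set M := \matrix_(i, j) _ in rk.
have E : (N1p + (n2 - n3 + n3))%N = Nb n2 N1p by rewrite /Nb subnK// addnC.
have freeM : row_free M by rewrite /row_free rk E.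
(* The columns are the normal derivatives at 0 of the second components of the solutions that
   realize the rank. *)
pose Y : 'M[R[i]]_(n2, Nb n2 N1p) :=
  \matrix_(i, j) (chl_deriv (fun z => dsubmx (e j z)) 0) i 0.
have KY : dsubmx (dsubmx M) = cmx (Knu P) *m Y.
  apply/matrixP => i j.
  have -> : dsubmx (dsubmx M) i j = Gamma P w (e j) (rshift N1p (rshift (n2 - n3) i)) 0.
    by rewrite 3!mxE.
  rewrite /Gamma !col_mxEd mxE [RHS]mxE; apply: eq_bigr => k _.
  by rewrite [Y k j]mxE.
have freeKY : row_free (cmx (Knu P) *m Y).
  rewrite -KY; apply: inj_row_free => v hv.
  have : row_mx 0 (row_mx 0 v) *m M = 0.
    rewrite -(vsubmxK M) -[dsubmx M]vsubmxK mul_row_col mul0mx add0r mul_row_col.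
    by rewrite mul0mx add0r.
  rewrite -(mul0mx _ M) => /(row_free_inj freeM); rewrite -!row_mx0.
  by move=> /eq_row_mx[_ /eq_row_mx[]].
have PY : cmx (projp D *m drsubmx (Bsym P nu u)) *m Y = 0.
  apply/matrixP => i j; rewrite !mxE.
  have -> : \sum_k cmx (projp D *m drsubmx (Bsym P nu u)) i k * Y k j =
      (cmx (projp D *m drsubmx (Bsym P nu u)) *m
       chl_deriv (fun z => dsubmx (e j z)) 0) i 0.
    by rewrite mxE; apply: eq_bigr => k _; rewrite [Y k j]mxE.
  have [h1 h2 h3 h4] := he j.
  have dE (f : R -> state) : hl_derivable f ->
      hl_deriv (fun s => dsubmx (f s)) 0 = dsubmx (hl_deriv f 0).
    move=> hf; exact: hl_is_derivE (lexx 0) (hl_is_deriv_dsub (hl_derivableP hf (lexx 0))).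
  have c1 := constant_layer_contracting D h1 h3.
  have c2 := constant_layer_contracting D h2 h4.
  rewrite /chl_deriv cmx_pair_mul.
  have -> : (fun s => rpart (dsubmx (e j s))) = (fun s => dsubmx (rpart (e j s))).
    by apply/funext => s; rewrite rpart_dsub.
  have -> : (fun s => ipart (dsubmx (e j s))) = (fun s => dsubmx (ipart (e j s))).
    by apply/funext => s; rewrite ipart_dsub.
  have [d1 _ _] := h1; have [d2 _ _] := h2.
  by rewrite (dE _ d1) (dE _ d2) c1 c2 [cmx 0]map_mx0 scaler0 addr0 mxE.
have rkP : \rank (cmx (projp D *m drsubmx (Bsym P nu u))) = dimp D.
  have [_ uB] := base_units hset hstr hbd.
  rewrite /cmx mxrank_map mxrankMfree; first exact/eqP/projp_row_free.
  by rewrite row_free_unit.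
have := mulmx0_rank_max PY; rewrite rkP => rkY.
have n3Y : (n3 <= \rank Y)%N.
  by rewrite -{1}(eqP freeKY); exact: mxrankM_maxr.
by apply: leq_trans n3Y _; rewrite -(leq_add2l (dimp D)) dim_split.
Qed.

End ConstantLayer.

(** * From local to compact families of base states *)

Section SmallLayers.
Variables (R : realType) (d n1 n2 n3 N1p r : nat) (P : bvp R d n1 n2 n3 N1p r).
Hypotheses (hset : setting P) (hstr : structural_hypotheses P).
Local Notation N := (n1 + n2)%N.
Local Notation state := 'cV[R]_N.

Lemma norm_le_enorm n (v : 'cV[R]_n) : `|v| <= enorm v.
Proof.
apply: mx_norm_le => [|i j]; first exact: sqrtr_ge0.
rewrite (ord1 j) -sqrtr_sqr; apply: ler_wsqrtr.
by rewrite (bigD1 i)//= lerDl sumr_ge0// => k _; exact: sqr_ge0.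
Qed.

(** The components in the essential bound are continuous along a layer, so the bound holds at every
    point, 0 included. *)
Lemma layer_Linf_pointwise nu (w : R -> state) u (e : R) : nu != 0 -> layer P nu w ->
  (Linf_norm (fun z => (col_mx (w z) (dsubmx (hl_deriv w z)) - col_mx u 0)%R) <= e%:E)%E ->
  forall z, 0 <= z -> `|w z - u| <= e /\ `|dsubmx (hl_deriv w z)| <= e.
Proof.
move=> nuN0 hw hL.
pose g (z : R) := col_mx (w (Num.max z 0)) (dsubmx (hl_deriv w (Num.max z 0))) - col_mx u 0.
have cg i : continuous (fun z => g z i 0).
  move=> z; have h : mx_cvg (nbhs z) g (g z).
    apply: mx_cvgD; last exact: mx_cvg_cst.
    apply: mx_cvg_col; first exact: (ext_state_cvg hw).
    move=> k j; rewrite (ord1 j).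
    exact: (layer_deriv2_continuous hset hstr nuN0 hw).
  exact: h.
have fg z : 0 < z -> col_mx (w z) (dsubmx (hl_deriv w z)) - col_mx u 0 = g z.
  by move=> /ltW z0; rewrite /g (max_idPl z0).
move=> z z0; have := Linf_norm_pointwise cg fg hL z0.
rewrite /g (max_idPl z0) opp_col_mx add_col_mx oppr0 addr0 => /(le_trans (norm_le_enorm _)) h.
have e0 : 0 <= e by apply: le_trans h.
split; apply: mx_norm_le => // i j; apply: le_trans h; rewrite (ord1 j).
  by rewrite -(col_mxEu _ (dsubmx (hl_deriv w z))) entry_le_norm.
by rewrite -(col_mxEd (w z - u)) entry_le_norm.
Qed.

(** Compactness of D makes the local radius uniform: half of it is spent on moving the base point,
    half on the distance to the layer. *)
Lemma small_layers_transversal_of_local :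
  (forall u0 nu0, Ubd_nu P (u0, nu0) -> exists2 rho : R, 0 < rho &
    forall nu w, nu != 0 -> layer P nu w -> near_base u0 nu0 rho nu w ->
      transversal_layer P nu w) ->
  small_layers_transversal P.
Proof.
move=> loc D cD DU.
pose Q (e : R) (p : state * 'cV[R]_d) := forall (x0 : 'cV[R]_d) (w : R -> state),
  bdry (Omega P) x0 -> layer P (inner_normal P x0) w ->
  (Linf_norm (fun z => (col_mx (w z) (dsubmx (hl_deriv w z)) - col_mx p.1 0)%R) <= e%:E)%E ->
  enorm (inner_normal P x0 - p.2) <= e -> transversal_layer P (inner_normal P x0) w.
have cov : \forall e \near (0 : R)^'+, D `<=` Q e.
  have /compact_near_coveringP := cD; apply => -[u0 nu0] hD.
  have [rho rho0 hrho] := loc u0 nu0 (DU _ hD).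
  have r20 : 0 < rho / 2 by rewrite divr_gt0.
  exists (ball (u0, nu0) (rho / 2), [set e | e <= rho / 2]).
    split; first exact: nbhsx_ballx.
    by near=> e; apply: ltW; near: e; exact: nbhs_right_lt.
  move=> [[u nu] e] /= [[hu hnu] he] x0 w hx hw hL hn.
  have nuN0 := normal_neq0 hset hx.
  have hz := layer_Linf_pointwise nuN0 hw hL.
  have dist (V : normedModType R) (x y z : V) : `|x - y| <= e -> ball z (rho / 2) y ->
      `|x - z| <= rho.
    rewrite -ball_normE /= => h1 /ltW h2.
    rewrite -(subrK y x) -addrA; apply: le_trans (ler_normD _ _) _.
    rewrite distrC in h2; have := lerD (le_trans h1 he) h2.
    by rewrite -splitr.
  apply: (hrho _ _ nuN0 hw); split.
    exact: (dist _ _ nu) (le_trans (norm_le_enorm _) hn) hnu.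
  move=> z z0; have [h1 h2] := hz z z0; split; first exact: (dist _ _ u) h1 hu.
  apply: le_trans h2 _; apply: le_trans he _.
  by rewrite ler_pdivrMr// ler_peMr ?ltW// ltr1n.
have [e [e0 he]] := filter_ex (filterI (nbhs_right_gt 0) cov).
exists e => // x0 w u nu hx hw hD hL hn; exact: (he (u, nu) hD x0 w hx hw hL hn).
Unshelve. all: by end_near. Qed.

End SmallLayers.

Theorem corollary2p5 (R : realType) (d n1 n2 n3 N1p r : nat)
  (P : bvp R d n1 n2 n3 N1p r) (Np N2m : nat)
  (hd : (1 <= d)%N) (hn2 : (1 <= n2)%N) (hn3 : (n3 <= n2)%N)
  (hset : setting P) (hstr : structural_hypotheses P)
  (hNp : forall u nu, Ubd_nu P (u, nu) -> num_pos (Abar P u nu) = Np)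
  (hN1p : forall u nu, Ustar_nu P (u, nu) -> num_pos (Abar11 P u nu) = N1p)
  (hN2m : forall u nu, Ubd_nu P (u, nu) -> num_Re_neg (Gnu P nu u) = N2m) :
  ((n3 = 0%N \/ (n3 = N2m /\ N2m = n2)) -> small_layers_transversal P) /\
  (forall u nu, Ubd_nu P (u, nu) ->
     [/\ (N2m < n3)%N -> ~ transversal_layer P nu (fun _ => u),
         transversal_layer P nu (fun _ => u) -> (Np <= (n2 - n3) + N1p)%N &
         (N2m < n3)%N <-> ~ (Np <= (n2 - n3) + N1p)%N]).
Proof.
split=> [hcase|u nu hu].
  apply: (small_layers_transversal_of_local hset hstr) => u0 nu0 hbd.
  apply: (layer_transversal_near hset hstr hbd hn3).
  by case: hcase => [|[e1 e2]]; [left|right]; rewrite ?(hN2m _ _ hbd) ?e1 ?e2.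
(* With this identity, N'' <= N^2_- and N_+ <= (N' - N'') + N^1_+ are the same condition. *)
have index : (Np + N2m = n2 + N1p)%N.
  have := boundary_index hset hstr hu.
  by rewrite (hNp _ _ hu) (hN2m _ _ hu) (hN1p _ _ (Ubd_Ustar hset hu)).
have neumann (ht : transversal_layer P nu (fun=> u)) : (n3 <= N2m)%N.
  by rewrite -(hN2m _ _ hu); exact: (constant_layer_neumann_le hset hstr hu hn3 ht).
split=> [lt ht|ht|].
- by have := neumann ht; rewrite leqNgt lt.
- by have := neumann ht; lia.
- by split=> [h|/negP h]; [apply/negP|]; lia.
Qed.
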